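(* Let $\lambda>0$. (i) If $\mu$ is a Carleson measure on $(0,\infty)\times(0,\infty)$, then the balayage of $\mu$ with respect to the Poisson semigroup $\{P_t^\lambda\}_{t>0}$, defined by $$S_{\mu,P^\lambda}(x):=\int_0^\infty\int_0^\infty P_t^\lambda(x,y)\,d\mu(y,t),\quad x\in(0,\infty),$$ is in $BMO_{\mathrm{o}}(\mathbb{R})$ and $$\|S_{\mu,P^\lambda}\|_{BMO_{\mathrm{o}}(\mathbb{R})}\le C\|\mu\|_{\mathcal{C}},$$ where $C>0$ does not depend on $\mu$. (ii) Let $f\in BMO_{\mathrm{o}}(\mathbb{R})$ be such that $f=0$ on $(a,\infty)$ for some $a>0$. Then there exist $g\in L^\infty(0,\infty)$ and a Carleson measure $\mu$ on $(0,\infty)\times(0,\infty)$ such that $f=g+S_{\mu,P^\lambda}$ and $$\|g\|_{L^\infty(0,\infty)}+\|\mu\|_{\mathcal{C}}\le C\|f\|_{BMO_{\mathrm{o}}(\mathbb{R})},$$ where $C>0$ does not depend on $f$.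
   Context: For $\lambda>0$, the Poisson kernel associated with the Bessel operator $B_\lambda:=-x^{-\lambda}\frac{d}{dx}x^{2\lambda}\frac{d}{dx}x^{-\lambda}=-\frac{d^2}{dx^2}+\frac{\lambda(\lambda-1)}{x^2}$ on $(0,\infty)$ is $$P_t^\lambda(x,y):=\frac{2\lambda}{\pi}(xy)^\lambda t\int_0^\pi\frac{(\sin\theta)^{2\lambda-1}}{[(x-y)^2+t^2+2xy(1-\cos\theta)]^{\lambda+1}}\,d\theta,\quad x,y,t\in(0,\infty).$$ The space $BMO_{\mathrm{o}}(\mathbb{R})$ consists of the functions $f$ on $(0,\infty)$ with $f\in L^1(0,a)$ for every $a>0$, for which there exists $C>0$ such that: (a) for every bounded interval $I\subset(0,\infty)$, $\frac{1}{|I|}\int_I|f(y)-f_I|\,dy\le C$, where $f_I:=\frac1{|I|}\int_I f(y)\,dy$; and (b) for every $a\in(0,\infty)$, $\frac1a\int_0^a|f(y)|\,dy\le C$. The norm $\|f\|_{BMO_{\mathrm{o}}(\mathbb{R})}$ is the infimum of all $C>0$ for which (a) and (b) hold. Functions are identified when equal almost everywhere. A Borel measure $\mu$ on $(0,\infty)\times(0,\infty)$ (not necessarily positive), with total variation measure $|\mu|$, is a Carleson measure on $(0,\infty)\times(0,\infty)$ if $$\|\mu\|_{\mathcal{C}}:=\sup_I\frac{|\mu|(\widehat I)}{|I|}<\infty,$$ where the supremum is over all bounded intervals $I\subset(0,\infty)$, $|I|$ is the length of $I$, and $\widehat I:=I\times(0,|I|)$. *)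

(* Defs.v *)
From HB Require Import structures.
From mathcomp Require Import all_boot all_order all_algebra.
From mathcomp Require Import all_classical all_reals all_analysis.

Set Implicit Arguments.
Unset Strict Implicit.
Unset Printing Implicit Defensive.

Import Order.TTheory GRing.Theory Num.Theory.
Import numFieldNormedType.Exports.

Local Open Scope classical_set_scope.
Local Open Scope ring_scope.

(* A real signed measure, given by its Jordan decomposition: two mutually
   singular positive measures.  The library's charges are finite, which is too
   restrictive for Carleson measures: |mu| is finite on the boxes ]0, r[^2, but
   both the positive and the negative part may have infinite total mass. *)
Record signed_measure d (T : measurableType d) (R : realType) := SignedMeasure {
  pos_part : {measure set T -> \bar R} ;
  neg_part : {measure set T -> \bar R} ;
  mutually_singular : exists2 P : set T, measurable P &
    (pos_part (~` P) = 0 /\ neg_part P = 0)%E }.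

Section signed_measure.
Context d (T : measurableType d) (R : realType).
Implicit Types (mu : signed_measure T R) (A : set T) (f : T -> R).

Definition variation_measure mu : {measure set T -> \bar R} :=
  measure_add (pos_part mu) (neg_part mu).

(* Meaningful when one of the two terms is finite, e.g. if |mu|(A) < +oo. *)
Definition signed_value mu A : \bar R := (pos_part mu A - neg_part mu A)%E.

(* Meaningful when f is integrable on A with respect to |mu|. *)
Definition signed_integral mu A f : R :=
  \int[pos_part mu]_(z in A) f z - \int[neg_part mu]_(z in A) f z.

Lemma variation_measureE mu A :
  variation_measure mu A = (pos_part mu A + neg_part mu A)%E.
Proof. exact: measure_addE. Qed.

Lemma variation_measure_sup mu A : measurable A ->
  variation_measure mu A = ereal_sup [set s | exists n (F : nat -> set T),
    [/\ forall i, measurable (F i), trivIset [set: nat] F,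
        \big[setU/set0]_(i < n) F i = A
      & s = (\sum_(i < n) `| signed_value mu (F i) |)%E]].
Proof.
move=> mA; apply/eqP; rewrite eq_le; apply/andP; split; last first.
  apply: ge_ereal_sup => _ [n [F [mF tF <- ->]]].
  rewrite measure_semi_additive//; last exact: bigsetU_measurable.
  apply: lee_sum => i _; rewrite [leRHS]variation_measureE /signed_value.
  by rewrite (le_trans (lee_abs_sub _ _))// !gee0_abs.
have [P mP [pP nP]] := mutually_singular mu.
have mCP : measurable (~` P) by exact: measurableC.
have mAP : measurable (A `&` P) by exact: measurableI.
have mAC : measurable (A `&` ~` P) by exact: measurableI.
have p0 : pos_part mu (A `&` ~` P) = 0%E by exact: subset_measure0 pP.
have n0 : neg_part mu (A `&` P) = 0%E by exact: subset_measure0 nP.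
have AE : A = (A `&` P) `|` (A `&` ~` P) by rewrite -setIUr setUv setIT.
have A0 : (A `&` P) `&` (A `&` ~` P) = set0 by rewrite setIACA setICr setI0.
have pE : pos_part mu A = pos_part mu (A `&` P).
  by rewrite [in LHS]AE measureU// [X in (_ + X)%E]p0 adde0.
have nE : neg_part mu A = neg_part mu (A `&` ~` P).
  by rewrite [in LHS]AE measureU// [X in (X + _)%E]n0 add0e.
apply: ereal_sup_ubound.
exists 2%N, (bigcup2 (A `&` P) (A `&` ~` P)); split.
- by move=> [|[|i]] //=; exact: measurable0.
- by rewrite -trivIset_bigcup2 .
- by rewrite !big_ord_recl big_ord0/= setU0 -AE.
- rewrite !big_ord_recl big_ord0/= adde0 /signed_value p0 n0 sube0 sub0e.
  by rewrite abseN !gee0_abs// variation_measureE pE nE.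
Qed.

Lemma signed_measure_of_charge (nu : {charge set T -> \bar R}) :
  exists mu, forall A, measurable A -> signed_value mu A = nu A.
Proof.
have [P [N nuPN]] := Hahn_decomposition nu.
have [[mP _] [mN _] PNT PN0] := nuPN.
have NC : ~` P = N.
  apply/seteqP; split => x.
    by move=> nPx; have : (P `|` N) x by [rewrite PNT]; case.
  by move=> Nx Px; have : (P `&` N) x by []; rewrite PN0.
have sing : exists2 Q : set T, measurable Q &
    (jordan_pos nuPN (~` Q) = 0 /\ jordan_neg nuPN Q = 0)%E.
  exists P => //; split.
    rewrite jordan_posE cjordan_posE /crestr0 mem_set; last first.
      exact: measurableC.
    by rewrite /crestr setICl charge0.
  rewrite jordan_negE cjordan_negE /crestr0 mem_set//.
  by rewrite /crestr PN0 charge0 oppe0.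
exists (SignedMeasure sing) => A mA.
by rewrite (jordan_decomp nuPN mA) /cadd/= cscaleN1.
Qed.

End signed_measure.

Section bessel.
Context {R : realType}.
Implicit Types (f : R -> R) (I : set R).
Local Notation leb := (@lebesgue_measure R).

Definition itv_length I : R := fine (leb I).

(* Nondegenerate, with endpoints included or not; the left endpoint may be 0. *)
Definition bounded_interval I : Prop :=
  [/\ is_interval I, 0 < itv_length I & exists b : R, I `<=` `]0, b]].

Definition mean f I : R := (itv_length I)^-1 * \int[leb]_(y in I) f y.

(* Functions on (0, +oo) are represented by functions on R, whose values
   outside (0, +oo) play no role. *)
Definition bmo_bound f (C : R) : Prop :=
  (forall I, bounded_interval I ->
     (itv_length I)^-1 * \int[leb]_(y in I) `| f y - mean f I | <= C) /\
  (forall a : R, 0 < a -> a^-1 * \int[leb]_(y in `]0, a[) `| f y | <= C).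

Definition bmo_o f : Prop :=
  (forall a : R, 0 < a -> leb.-integrable `]0, a[ (EFin \o f)) /\
  (exists2 C : R, 0 < C & bmo_bound f C).

Definition bmo_norm f : \bar R :=
  ereal_inf [set C%:E | C in [set C : R | 0 < C /\ bmo_bound f C]].

(* [Lnorm _ +oo] is the essential supremum of the absolute value. *)
Definition Linfty_norm f : \bar R :=
  Lnorm leb +oo%E (EFin \o (f \_ `]0, +oo[)).

Definition Linfty f : Prop :=
  measurable_fun (`]0, +oo[ : set R) f /\ (Linfty_norm f < +oo)%E.

Definition quadrant : set (measurableTypeR R * measurableTypeR R) :=
  `]0, +oo[ `*` `]0, +oo[.

Definition tent I : set (measurableTypeR R * measurableTypeR R) :=
  I `*` `]0, itv_length I[.

Definition borel_measure :=
  signed_measure (measurableTypeR R * measurableTypeR R)%type R.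
Implicit Type mu : borel_measure.

Definition carleson_norm mu : \bar R :=
  ereal_sup [set (((itv_length I)^-1)%:E * variation_measure mu (tent I))%E
            | I in bounded_interval].

(* A measure on the quadrant is a measure on the plane that is concentrated
   on the quadrant. *)
Definition carleson mu : Prop :=
  variation_measure mu (~` quadrant) = 0%E /\ (carleson_norm mu < +oo)%E.

Definition poisson (lam t x y : R) : R :=
  2 * lam / pi * (x * y) `^ lam * t *
  \int[leb]_(theta in `]0, pi[)
    (sin theta `^ (2 * lam - 1) /
     ((x - y) ^+ 2 + t ^+ 2 + 2 * (x * y) * (1 - cos theta)) `^ (lam + 1)).

(* For a Carleson measure the balayage is defined for almost every x only: the
   integral may diverge at some points, where [balayage] takes an arbitrary
   value. *)
Definition balayage_converges (lam : R) mu (x : R) : Prop :=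
  (variation_measure mu).-integrable quadrant
    (fun z => (poisson lam z.2 x z.1)%:E).

Definition balayage (lam : R) mu (x : R) : R :=
  signed_integral mu quadrant (fun z => poisson lam z.2 x z.1).

End bessel.

(* Main.v *)
(* Part (i). Reduce to a positive measure and let d = min (lam, 1).  For an
   interval of length l with left endpoint a, the points (y, t) for which
   |a - y| + t < 2 l contribute O(l) to the integral of the balayage over the
   interval, since the Poisson kernel is dominated by a Cauchy kernel; the
   contribution of the other points oscillates by O(1), by the Hoelder estimate
   |P_t(x, y) - P_t(a, y)| <= C |x - a|^d / (|a - y| + t)^(1 + d) summed over
   dyadic rings.  The kernel vanishes at a = 0, whence condition (b).

   Part (ii). Let K bound the mean oscillations of f and let the cells of level k
   be the intervals [e^(i/2^k), e^((i+1)/2^k)[.  Replace the mean of f on a cell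
   by the value of the parent cell unless these differ by more than 2 K.  In that
   case the new value lowers the oscillation of f around it, so that such jumps
   are packed.  The piecewise linear functions h_k that interpolate the values of
   level k stay within O(K) of f in the limit, while h_(k+1) - h_k has
   coefficients that are O(K) and packed.  In the coordinate u = 2^k ln y the
   Poisson kernel along a ray t = s y averages at scale 2^k s, so h_(k+1) - h_k
   = v_0 can be expanded as the sum of T_n v_n, where v_(n+1) = v_n - T_n v_n
   decreases geometrically and T_n are averages of geometrically decreasing
   widths.  Thus h_(k+1) - h_k is the balayage of a measure carried by countably
   many rays.  The rays for distinct (k, n) are distinct, which exhibits the Jordan
   decomposition of the total measure, whose balayage is the limit of h_k. *)
From HB Require Import structures.
Require Import Defs.
From mathcomp Require Import all_boot all_order all_algebra.
From mathcomp Require Import all_classical all_reals all_analysis.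
From mathcomp Require Import measurable_realfun.
From mathcomp Require Import ring lra zify.

Set Implicit Arguments.
Unset Strict Implicit.
Unset Printing Implicit Defensive.

Import Order.TTheory GRing.Theory Num.Theory.
Import numFieldNormedType.Exports.

Local Open Scope classical_set_scope.
Local Open Scope ring_scope.

(** * Calculus and the Poisson kernel *)

(** The kernel is homogeneous of degree -1, so its integral along a ray [t = s y] is a convolution
    in ln y; hence rays carry the measure of part (ii), and cells are equally spaced in ln y.
    Condition (b) bounds the means on the cells of level 0, so the approximation can start from the
    value 0 there. The mass of the kernel on a ray is never computed: a Cauchy majorant and a
    positive lower bound suffice, since the averages are normalized. Cauchy tails decay too slowly
    for the coefficients to stay localized; the packing is therefore carried by a weight, the Cauchy
    smoothing of the coefficients, which further Cauchy averages enlarge by a constant factor only.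
    All bounds on the Neumann iterates are relative to this weight. A tent may also meet rays of
    levels coarser than its base, about which packing says nothing, but along the n-th rays there
    are only O(n + 1) such levels, against a density O(4^-n). Slopes combine powers of 2 for the
    levels with powers of 3 for the Neumann steps, so that unique factorization keeps the rays
    apart. *)

Section lebesgue_translation.
Context {R : realType}.
Local Notation leb := (@lebesgue_measure R).

Lemma measurable_shift (c : R) :
  measurable_fun [set: measurableTypeR R] (fun x : measurableTypeR R => x + c : measurableTypeR R).
Proof. by apply: measurable_funD => //; exact: measurable_cst. Qed.

Lemma lebesgue_measure_shift (c : R) (A : set (measurableTypeR R)) : measurable A ->
  leb A = pushforward leb (fun x : measurableTypeR R => x + c : measurableTypeR R) A.
Proof.
move=> mA.
apply: (@lebesgue_measure_unique R) => //; first exact: measurable_shift.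
move=> ms X [[a b]] /= ab <-.
rewrite /pushforward.
have -> : (fun x : measurableTypeR R => x + c) @^-1` `]a, b] = `]a - c, b - c]%classic.
  by apply/seteqP; split => x /=; rewrite !in_itv/= ltrBlDr lerBrDr.
rewrite !lebesgue_measure_itv /= !lte_fin ltrD2r.
by case: ifP => // _; congr (_%:E); ring.
Qed.

Lemma ge0_integral_shift (c : R) (f : R -> \bar R) :
  measurable_fun [set: R] f -> (forall x, 0 <= f x)%E ->
  (\int[leb]_x f (x + c)%R = \int[leb]_x f x)%E.
Proof.
move=> mf f0.
have ms := measurable_shift c.
transitivity (\int[pushforward leb (fun x : measurableTypeR R => (x + c)%R : measurableTypeR R)]_x f x)%E.
  by rewrite ge0_integral_pushforward.
by apply: eq_measure_integral => A mA _; exact/esym/lebesgue_measure_shift.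
Qed.

End lebesgue_translation.

Section ftc_open.
Context {R : realType}.
Local Notation leb := (@lebesgue_measure R).

(* [f] may blow up at [a], where it need not be integrable a priori. *)
Lemma integral_oc_le_primitive (f F : R -> R) (a b : R) : a < b ->
  (forall x, a < x <= b -> 0 <= f x) ->
  (forall x, a < x <= b -> {for x, continuous f}) ->
  (forall x, a < x <= b -> is_derive x 1 F (f x)) ->
  (forall x, a < x <= b -> 0 <= F x) ->
  (\int[leb]_(x in `]a, b]) (f x)%:E <= (F b)%:E)%E.
Proof.
move=> ab f0 fc dF F0.
(* With [n.+2] in place of [n.+1] the left endpoint is strictly below [b] already for [n = 0]. *)
pose G n := (`[a + (b - a) / n.+2%:R, b] : set R)%classic.
have an n : a < a + (b - a) / n.+2%:R by rewrite ltrDl divr_gt0// subr_gt0.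
have nb n : a + (b - a) / n.+2%:R < b.
  rewrite -ltrBrDl ltr_pdivrMr// ltr_pMr ?subr_gt0//.
  by rewrite ltr1n.
have GE : `]a, b]%classic = \bigcup_n G n.
  apply/seteqP; split => x /=.
    rewrite in_itv/= => /andP[ax xb].
    pose k := Num.truncn ((b - a) / (x - a)).
    exists k => //; rewrite /G/= in_itv/= xb andbT -lerBrDl.
    rewrite ler_pdivrMr// mulrC -ler_pdivrMr ?subr_gt0//.
    by rewrite (le_trans (ltW (truncnS_gt _)))// ler_nat.
  by move=> [n _]; rewrite /G/= !in_itv/= => /andP[/(lt_le_trans (an n)) -> ->].
have GS n x : G n x -> a < x <= b.
  by rewrite /G/= in_itv/= => /andP[/(lt_le_trans (an n)) -> ->].
rewrite GE.
have cG : (\int[leb]_(x in G i) (f x)%:E)%E @[i --> \oo] -->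
    (\int[leb]_(x in \bigcup_i G i) (f x)%:E)%E.
  apply: ge0_nondecreasing_set_cvg_integral.
  - move=> n m nm; apply/subsetPset => x; rewrite /G/= !in_itv/= => /andP[+ ->].
    rewrite andbT; apply: le_trans; rewrite lerD2l ler_pM2l ?subr_gt0//.
    by rewrite lef_pV2 ?posrE// ler_nat ltnS.
  - by move=> i; exact: measurable_itv.
  - move=> i; apply/measurable_EFinP; apply: subspace_continuous_measurable_fun.
      exact: measurable_itv.
    apply: continuous_in_subspaceT => x; rewrite inE => /GS xab; exact: fc.
  - by move=> i x /GS xab; rewrite lee_fin f0.
rewrite -(cvg_lim _ cG)//; apply: lime_le; first by apply/cvg_ex; exists (\int[leb]_(x in \bigcup_i G i) (f x)%:E)%E.
apply: nearW => n; rewrite (@continuous_FTC2 _ f F)//.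
- by rewrite -EFinB lee_fin lerBlDr lerDl F0// an ltW.
- apply: continuous_in_subspaceT => x; rewrite inE => /GS xab; exact: fc.
- have cF x : a < x <= b -> F z @[z --> x] --> F x.
    by move=> /dF [dFx _]; exact/differentiable_continuous/derivable1_diffP.
  split.
  + move=> x; rewrite in_itv/= => /andP[/(lt_trans (an n)) ax xb].
    by have [] : is_derive x 1 F (f x) by apply: dF; rewrite ax ltW.
  + by apply: cvg_at_right_filter; apply: cF; rewrite an ltW.
  + by apply: cvg_at_left_filter; apply: cF; rewrite ab lexx.
- move=> x; rewrite in_itv/= => /andP[/(lt_trans (an n)) ax xb].
  have [_ dE] : is_derive x 1 F (f x) by apply: dF; rewrite ax ltW.
  by rewrite derive1E dE.
Qed.

End ftc_open.

Section cauchy_kernel.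
Context {R : realType}.
Local Notation leb := (@lebesgue_measure R).

(** The Poisson kernel of the half-plane without its factor 1/pi; its integral is pi for every
    [s > 0]. *)
Definition cauchy (s x : R) : R := s / (s ^+ 2 + x ^+ 2).

Lemma cauchy_ge0 (s x : R) : 0 <= s -> 0 <= cauchy s x.
Proof. by move=> s0; rewrite divr_ge0// addr_ge0// sqr_ge0. Qed.

Lemma cauchyN (s x : R) : cauchy s (- x) = cauchy s x.
Proof. by rewrite /cauchy sqrrN. Qed.

Lemma cauchy_denom_gt0 (s x : R) : 0 < s -> 0 < s ^+ 2 + x ^+ 2.
Proof. by move=> s0; rewrite ltr_pwDl ?exprn_gt0 ?sqr_ge0. Qed.

Lemma continuous_cauchy (s : R) : 0 < s -> continuous (cauchy s).
Proof.
move=> s0 x; apply: cvgM; first exact: cvg_cst.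
apply: cvgV; first by rewrite gt_eqF// cauchy_denom_gt0.
by apply: cvgD; [exact: cvg_cst|exact: exprn_continuous].
Qed.

Lemma measurable_cauchy (s : R) : 0 < s -> measurable_fun [set: R] (cauchy s).
Proof. by move=> s0; apply: continuous_measurable_fun; exact: continuous_cauchy. Qed.

Lemma integral_cauchy (s : R) : 0 < s -> (\int[leb]_x (cauchy s x)%:E = pi%:E)%E.
Proof.
move=> s0.
have dF x : is_derive x (1 : R) (fun x => atan (x / s)) (cauchy s x).
  have -> : cauchy s x = (1 + (x / s) ^+ 2)^-1 * s^-1.
    rewrite /cauchy; field.
    by rewrite !gt_eqF// ?cauchy_denom_gt0//.
  apply: (@is_derive1_comp _ atan (fun x => x / s)).
  rewrite (_ : *%R^~ s^-1 = s^-1 \*: (@id R)); last first.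
    by apply/funext => y /=; rewrite mulrC.
  by apply: is_derive_eq; rewrite /GRing.scale/= mulr1.
rewrite ge0_symfun_integralT.
- rewrite (_ : [set x | _] = `[0%R, +oo[%classic); last first.
    by apply/seteqP; split => x /=; rewrite in_itv/= andbT.
  rewrite (@ge0_continuous_FTC2y _ _ (fun x => atan (x / s)) 0 (pi / 2))//.
  + by rewrite mul0r atan0 sube0 -EFinM; congr (_%:E); field.
  + by move=> x _; exact: cauchy_ge0 (ltW s0).
  + by apply: continuous_subspaceT; exact: continuous_cauchy.
  + apply: (cvg_comp _ _ _ (@cvgy_atan R)).
    by apply: gt0_cvgMly; rewrite ?invr_gt0//.
  + apply: cvg_at_right_filter.
    have [d0 _] := dF 0.
    exact: (differentiable_continuous ((derivable1_diffP _ _).1 d0)).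
  + by move=> x _; rewrite derive1E; have [_ ->] := dF x.
- by move=> x; exact: cauchy_ge0 (ltW s0).
- exact: continuous_cauchy.
- by move=> x /=; rewrite cauchyN.
Qed.

Lemma integral_cauchy_shift (s u : R) : 0 < s ->
  (\int[leb]_x (cauchy s (x - u))%:E = pi%:E)%E.
Proof.
move=> s0; rewrite -(integral_cauchy s0).
apply: (@ge0_integral_shift R (- u) (fun x => (cauchy s x)%:E)).
  by apply/measurable_EFinP; exact: measurable_cauchy.
by move=> x; rewrite lee_fin cauchy_ge0// ltW.
Qed.

End cauchy_kernel.

Lemma measurable_patch {d} {T : measurableType d} {R : realType} (D : set T) (f : T -> \bar R) :
  measurable D -> measurable_fun setT f -> measurable_fun setT (f \_ D)%E.
Proof. by move=> mD mf; apply/(measurable_restrictT f mD); exact: measurable_funTS. Qed.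

Section lebesgue_reflection.
Context {R : realType}.
Local Notation leb := (@lebesgue_measure R).

Lemma ge0_integral_reflect (c : R) (f : R -> \bar R) :
  measurable_fun [set: R] f -> (forall x, 0 <= f x)%E ->
  (\int[leb]_x f (c - x)%R = \int[leb]_x f x)%E.
Proof.
move=> mf f0; rewrite -(@ge0_integral_shift R c f)//.
have mN : measurable_fun [set: measurableTypeR R] (-%R : measurableTypeR R -> measurableTypeR R).
  exact: oppr_measurable.
have mfc : measurable_fun [set: R] (fun x => f (x + c)%R).
  by apply: measurableT_comp => //; exact: measurable_shift.
transitivity (\int[pushforward leb (-%R : measurableTypeR R -> measurableTypeR R)]_x f (x + c)%R)%E.
  rewrite ge0_integral_pushforward//.
  by apply: eq_integral => x _ /=; rewrite addrC.
by apply: eq_measure_integral => A mA _; exact: lebesgue_measureN.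
Qed.

End lebesgue_reflection.

Lemma powRD_gt0 {R : realType} (x r s : R) : 0 < x -> x `^ (r + s) = x `^ r * x `^ s.
Proof. by move=> x0; rewrite powRD//; apply/implyP => _; rewrite gt_eqF. Qed.

Lemma powRV {R : realType} (x r : R) : 0 <= x -> x^-1 `^ r = (x `^ r)^-1.
Proof. by move=> x0; rewrite -powR_inv1// -powRrM mulN1r powRN. Qed.

Lemma continuous_powR_at {R : realType} (a x : R) : 0 < x ->
  {for x, continuous (fun y : R => y `^ a)}.
Proof.
by move=> x0; have [/derivable1_diffP/differentiable_continuous] := is_derive1_powR a x0.
Qed.

Section angular_integral.
Context {R : realType} (lam : R) (lam_gt0 : 0 < lam).
Local Notation leb := (@lebesgue_measure R).

Definition angular (A B th : R) : R :=
  sin th `^ (2 * lam - 1) / (A + B * (1 - cos th)) `^ (lam + 1).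

(** One summand for each half of the range of the angle. *)
Definition angular_cst : R := 2 `^ lam / lam *+ 2.

Lemma angular_cst_gt0 : 0 < angular_cst.
Proof. by rewrite pmulrn_lgt0// divr_gt0// powR_gt0. Qed.

Lemma angular_ge0 (A B th : R) : 0 <= angular A B th.
Proof. by rewrite divr_ge0// powR_ge0. Qed.

Lemma measurable_angular (A B : R) : measurable_fun [set: R] (angular A B).
Proof.
apply: measurable_funM.
  apply: (measurableT_comp (measurable_powR _)).
  by apply: continuous_measurable_fun; exact: continuous_sin.
under eq_fun do rewrite -powRN.
apply: (measurableT_comp (measurable_powR _)).
apply: measurable_funD; first exact: measurable_cst.
apply: measurable_funM; first exact: measurable_cst.
apply: measurable_funB; first exact: measurable_cst.
by apply: continuous_measurable_fun; exact: continuous_cos.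
Qed.

Lemma angular_denom_gt0 (A B th : R) : 0 < A -> 0 <= B -> 0 < A + B * (1 - cos th).
Proof. by move=> A0 B0; rewrite ltr_pwDl// mulr_ge0// subr_ge0 cos_le1. Qed.

(* [(v / (A + B v)) ^ lam], with [v = 1 - cos th], is a primitive of
   [lam A v ^ (lam - 1) sin th / (A + B v) ^ (lam + 1)]. *)
Lemma integral_angular_left (A B : R) : 0 < A -> 0 <= B ->
  (\int[leb]_(th in `]0%R, (pi / 2)%R]) (angular A B th)%:E <=
   (2 `^ lam / lam / (A * (A + B) `^ lam))%:E)%E.
Proof.
move=> A0 B0.
pose v (th : R) := 1 - cos th.
pose F (th : R) := (v th / (A + B * v th)) `^ lam.
pose f (th : R) := lam * (v th / (A + B * v th)) `^ (lam - 1) *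
   (A * sin th / (A + B * v th) ^+ 2).
have pi20 : 0 < pi / 2 :> R by rewrite divr_gt0// pi_gt0.
have v0 (th : R) : 0 < th <= pi / 2 -> 0 < v th.
  move=> /andP[t0 tp]; rewrite subr_gt0 -cos0 ltr_cos ?in_itv/= ?lexx ?pi_ge0//.
  rewrite ltW//= (le_trans tp)// ler_pdivrMr// ler_peMr ?pi_ge0//.
  by rewrite ler1n.
have d0 (th : R) : 0 < A + B * v th by exact: angular_denom_gt0.
have s0 (th : R) : 0 < th <= pi / 2 -> 0 < sin th.
  move=> /andP[t0 tp]; rewrite sin_gt0_pi// t0 (le_lt_trans tp)//.
  by rewrite ltr_pdivrMr// ltr_pMr ?pi_gt0// ltr1n.
have vd0 (th : R) : 0 < th <= pi / 2 -> 0 < v th / (A + B * v th).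
  by move=> th0; rewrite divr_gt0// v0.
have dv (th : R) : is_derive th (1 : R) v (sin th).
  by rewrite (_ : v = cst 1 - cos)//; apply: is_derive_eq; rewrite sub0r opprK.
have dF (th : R) : 0 < th <= pi / 2 -> is_derive th (1 : R) F (f th).
  move=> th0.
  have dq : is_derive th (1 : R) (fun th => v th / (A + B * v th))
     (A * sin th / (A + B * v th) ^+ 2).
    have dd : is_derive th (1 : R) (fun th => A + B * v th) (B * sin th).
      rewrite (_ : (fun th => _) = (cst A + B \*: v)).
        by apply: is_derive_eq; rewrite add0r.
      by apply/funext => y.
    have dn0 : A + B * v th != 0 by rewrite gt_eqF.
    have di : is_derive th (1 : R) (fun th => (A + B * v th)^-1)
        (- (A + B * v th) ^- 2 *: (B * sin th)).
      exact: is_deriveV.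
    have := @is_deriveM _ _ v (fun th => (A + B * v th)^-1) _ _ _ _ (dv th) di.
    move=> H; apply: is_derive_eq H _.
    rewrite /GRing.scale/=.
    by field.
  have := is_derive1_powR (lam) (vd0 _ th0).
  move=> dp; have H := @is_derive1_comp R (fun y : R => y `^ lam) (fun th => v th / (A + B * v th)) th _ _ dp dq.
  by apply: is_derive_eq H _; rewrite /f /GRing.scale/=; ring.
have f0 (th : R) : 0 < th <= pi / 2 -> 0 <= f th.
  move=> th0; apply: mulr_ge0; first by rewrite mulr_ge0 ?powR_ge0// ltW.
  by rewrite divr_ge0 ?sqr_ge0// mulr_ge0 ?ltW// s0.
have fc (th : R) : 0 < th <= pi / 2 -> {for th, continuous f}.
  move=> th0.
  have cv : {for th, continuous v}.
    by have [/derivable1_diffP/differentiable_continuous] := dv th.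
  have cd : {for th, continuous (fun th => A + B * v th)}.
    by apply: cvgD; [exact: cvg_cst|apply: cvgM; [exact: cvg_cst|exact: cv]].
  have dn0 : A + B * v th != 0 by rewrite gt_eqF.
  apply: cvgM.
    apply: cvgM; first exact: cvg_cst.
    apply: (@continuous_comp _ _ _ (fun th => v th / (A + B * v th)) (fun y : R => y `^ (lam - 1))).
      by apply: cvgM; [exact: cv|exact: cvgV].
    exact/continuous_powR_at/vd0.
  apply: cvgM; first by apply: cvgM; [exact: cvg_cst|exact: continuous_sin].
  apply: cvgV; first by rewrite expf_neq0.
  by rewrite expr2; under eq_fun do rewrite expr2; exact: cvgM.
have F0 (th : R) : 0 < th <= pi / 2 -> 0 <= F th by move=> _; exact: powR_ge0.
have := integral_oc_le_primitive pi20 f0 fc dF F0.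
have fE (th : R) : 0 < th <= pi / 2 -> f th = lam * A * (v th `^ (lam - 1) * sin th / (A + B * v th) `^ (lam + 1)).
  move=> th0; have d1 : (A + B * v th) `^ (lam - 1) != 0 by rewrite gt_eqF// powR_gt0.
  rewrite /f powRM ?invr_ge0; [|exact/ltW/v0|exact/ltW/d0].
  rewrite powRV ?(ltW (d0 _))//.
  have -> : (A + B * v th) `^ (lam + 1) = (A + B * v th) `^ (lam - 1) * (A + B * v th) ^+ 2.
    rewrite -powR_mulrn ?(ltW (d0 _))// -powRD_gt0//.
    by congr (_ `^ _); ring.
  field.
  by rewrite d1 gt_eqF.
have angle (th : R) : 0 < th <= pi / 2 ->
    angular A B th <= 2 `^ lam / (lam * A) * f th.
  move=> th0; have sth := s0 _ th0; have vth := v0 _ th0.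
  have cth : 0 <= cos th.
    by apply: cos_ge0_pihalf; case/andP: th0 => t0 ->; rewrite andbT (le_trans _ (ltW t0))// oppr_le0 ltW.
  have sE : sin th `^ (2 * lam - 1) = sin th * (v th `^ (lam - 1) * (1 + cos th) `^ (lam - 1)).
    have c0 : 0 <= 1 + cos th by rewrite addr_ge0.
    rewrite -(powRM _ (ltW vth) c0).
    rewrite (_ : v th * _ = sin th ^+ 2); last by rewrite sin2cos2 /v; ring.
    have -> : 2 * lam - 1 = 1 + 2 * (lam - 1) by ring.
    by rewrite (powRD_gt0 1 _ sth) powRr1 ?(ltW sth)// powRrM powR_mulrn ?(ltW sth).
  (* As [1 + cos th] is between 1 and 2, raising the exponent from [lam - 1] to [lam] only increases
     the power; this covers [lam < 1] as well. *)
  have c2 : (1 + cos th) `^ (lam - 1) <= 2 `^ lam.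
    have c1 : 1 <= 1 + cos th <= 2.
      by rewrite lerDl cth/= (_ : 2 = 1 + 1) ?lerD2l ?cos_le1.
    case/andP: c1 => c1 c2.
    apply: (@le_trans _ _ ((1 + cos th) `^ lam)).
      by rewrite ler_powR// gerBl.
    by rewrite ge0_ler_powR// ?nnegrE ?(ltW lam_gt0) ?addr_ge0.
  rewrite /angular sE -/(v th) fE//.
  set V := v th `^ _; set D := (_ + _) `^ (lam + 1).
  have V0 : 0 <= V := powR_ge0 _ _.
  have D0 : 0 < D by rewrite powR_gt0.
  rewrite (_ : 2 `^ lam / (lam * A) * _ = sin th * (V * 2 `^ lam) / D); last first.
    by field; rewrite !gt_eqF.
  by rewrite ler_pM2r ?invr_gt0// ler_pM2l// ler_wpM2l.
have mf : measurable_fun `]0, (pi / 2)] f.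
  apply: subspace_continuous_measurable_fun; first exact: measurable_itv.
  by apply: continuous_in_subspaceT => x; rewrite inE/= in_itv/=; exact: fc.
move=> ifF.
apply: (@le_trans _ _ (\int[leb]_(th in `]0%R, (pi / 2)%R]) (2 `^ lam / (lam * A) * f th)%:E)%E).
  apply: ge0_le_integral => //.
  - by move=> x _; rewrite lee_fin angular_ge0.
  - by apply/measurable_EFinP; apply: measurable_funTS; exact: measurable_angular.
  - by apply/measurable_EFinP; apply: measurable_funM; first exact: measurable_cst.
have lA : 0 < lam * A by rewrite mulr_gt0.
under eq_integral do rewrite EFinM.
rewrite ge0_integralZl_EFin//; first last.
- by rewrite divr_ge0 ?powR_ge0// ltW.
- exact/measurable_EFinP.
apply: le_trans; first by apply: lee_wpmul2l ifF; rewrite lee_fin divr_ge0 ?powR_ge0// ltW.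
rewrite -EFinM lee_fin /F /v cos_pihalf subr0 mulr1 div1r.
rewrite powRV ?addr_ge0 ?(ltW A0)//.
have AB : (A + B) `^ lam != 0 by rewrite gt_eqF// powR_gt0// ltr_pwDl.
rewrite le_eqVlt; apply/orP; left; apply/eqP; field.
by rewrite AB !gt_eqF.
Qed.

(** The reflection [th -> pi - th] carries this to the case [A = 1], [B = 0] of the left half. *)
Lemma integral_sin_powR_right :
  (\int[leb]_(th in `](pi / 2)%R, pi[) (sin th `^ (2 * lam - 1))%:E <=
   (2 `^ lam / lam)%:E)%E.
Proof.
pose g (th : R) : \bar R := ((fun th => (sin th `^ (2 * lam - 1))%:E) \_ `](pi / 2)%R, pi[)%E th.
have ms : measurable_fun [set: R] (fun th : R => (sin th `^ (2 * lam - 1))%:E).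
  apply/measurable_EFinP; apply: (measurableT_comp (measurable_powR _)).
  by apply: continuous_measurable_fun; exact: continuous_sin.
rewrite integral_mkcond -(ge0_integral_reflect pi); first last.
- by move=> x; apply: erestrict_ge0 => y _; rewrite lee_fin powR_ge0.
- by apply: measurable_patch => //; exact: measurable_itv.
apply: (@le_trans _ _ (\int[leb]_(th in `]0%R, (pi / 2)%R]) (angular 1 0 th)%:E)%E); last first.
  apply: le_trans (integral_angular_left _ _) _ => //.
  by rewrite addr0 powR1 mulr1 divr1.
rewrite [leRHS]integral_mkcond; apply: ge0_le_integral => //.
- by move=> x _; apply: erestrict_ge0 => y _; rewrite lee_fin powR_ge0.
- apply: (@measurableT_comp _ _ _ _ _ _ ((fun th => (sin th `^ (2 * lam - 1))%:E) \_ `](pi / 2)%R, pi[)%E).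
    by apply: measurable_patch => //; exact: measurable_itv.
  by apply: measurable_funB; [exact: measurable_cst|exact: measurable_id].
- apply: measurable_patch; first exact: measurable_itv.
  by apply/measurable_EFinP; exact: measurable_angular.
move=> x _; rewrite /patch !mem_setE !in_itv/=.
have -> : sin (pi - x) = sin x.
  by rewrite sinB sinpi cospi; ring.
rewrite /angular mul0r addr0 powR1 divr1.
case: ifPn => [/andP[h1 h2]|_]; last by case: ifP; rewrite ?lee_fin ?powR_ge0.
rewrite ifT//.
have p2 : pi / 2 + pi / 2 = pi :> R by field.
by apply/andP; split; lra.
Qed.

(** The peak at angle 0 is handled by the primitive. Beyond pi/2 one has [1 - cos th >= 1], so the
    denominator is at least (A + B)^(lam + 1), which is even larger than A (A + B)^lam; the third
    summand of the rewritten bound is this slack. *)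
Lemma integral_angular (A B : R) : 0 < A -> 0 <= B ->
  (\int[leb]_(th in `]0%R, pi[) (angular A B th)%:E <=
   (angular_cst / (A * (A + B) `^ lam))%:E)%E.
Proof.
move=> A0 B0.
have pi0 : 0 < pi :> R by exact: pi_gt0.
have -> : `]0%R, pi[%classic = `]0%R, (pi / 2)%R] `|` `](pi / 2)%R, pi[ :> set R.
  by rewrite -itv_bndbnd_setU// bnd_simp; lra.
rewrite ge0_integral_setU//=; first last.
- by rewrite disj_set2E; apply/eqP/seteqP; split => // x [] /=; rewrite !in_itv/=; lra.
- by move=> x _; rewrite lee_fin angular_ge0.
- by apply/measurable_EFinP; apply: measurable_funTS; exact: measurable_angular.
have AB0 : 0 < A + B by rewrite ltr_pwDl.
have p0 := powR_gt0 lam AB0.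
have -> : angular_cst / (A * (A + B) `^ lam) =
    2 `^ lam / lam / (A * (A + B) `^ lam) + ((A + B) `^ (lam + 1))^-1 * (2 `^ lam / lam) +
    ((A * (A + B) `^ lam)^-1 - ((A + B) `^ (lam + 1))^-1) * (2 `^ lam / lam).
  by rewrite /angular_cst; ring.
rewrite -[leLHS]adde0 EFinD; apply: leeD; last first.
  rewrite lee_fin mulr_ge0 ?divr_ge0 ?powR_ge0 ?(ltW lam_gt0)// subr_ge0.
  rewrite lef_pV2 ?posrE ?mulr_gt0 ?powR_gt0//.
  by rewrite powRD_gt0// powRr1 ?(ltW AB0)// mulrC ler_pM2l// lerDl.
rewrite EFinD; apply: leeD; first exact: integral_angular_left.
apply: (@le_trans _ _ (\int[leb]_(th in `](pi / 2)%R, pi[)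
   ((((A + B) `^ (lam + 1))^-1)%:E * (sin th `^ (2 * lam - 1))%:E))%E).
  have ms : measurable_fun [set: R] (fun th : R => sin th `^ (2 * lam - 1)).
    apply: (measurableT_comp (measurable_powR _)).
    by apply: continuous_measurable_fun; exact: continuous_sin.
  apply: ge0_le_integral => //.
  - by move=> x _; rewrite lee_fin angular_ge0.
  - by apply/measurable_EFinP; apply: measurable_funTS; exact: measurable_angular.
  - apply/measurable_EFinP; apply: measurable_funM; first exact: measurable_cst.
    exact: measurable_funTS.
  move=> th; rewrite /= in_itv/= => /andP[t1 t2].
  rewrite -EFinM lee_fin mulrC ler_wpM2l ?powR_ge0//.
  rewrite lef_pV2 ?posrE ?powR_gt0 ?angular_denom_gt0//.
  rewrite ge0_ler_powR ?nnegrE ?(ltW AB0) ?(ltW (angular_denom_gt0 _ _ _))//.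
    by rewrite addr_ge0// ltW.
  rewrite lerD2l ler_peMr// lerBrDr -lerBrDl subrr.
  by rewrite -cos_pihalf ltW// ltr_cos ?in_itv/= ?ltW//; lra.
rewrite ge0_integralZl_EFin ?invr_ge0 ?powR_ge0//.
- rewrite EFinM; apply: lee_wpmul2l; last exact: integral_sin_powR_right.
  by rewrite lee_fin invr_ge0 powR_ge0.
- by move=> x _; rewrite lee_fin powR_ge0.
- apply/measurable_EFinP; apply: measurable_funTS.
  apply: (measurableT_comp (measurable_powR _)).
  by apply: continuous_measurable_fun; exact: continuous_sin.
Qed.

End angular_integral.

Section trigonometric_bounds.
Context {R : realType}.
Implicit Types x : R.

Lemma sin_MVT x : 0 < x -> exists2 c : R, 0 < c < x & sin x = cos c * x.
Proof.
move=> x0.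
have ds c : c \in `]0, x[ -> is_derive c (1 : R) (sin : R -> R) (cos c).
  by move=> _; exact: is_derive_sin.
have cs : {within `[0, x], continuous (sin : R -> R)}.
  by apply: continuous_subspaceT; exact: continuous_sin.
have [c cx E] := MVT x0 ds cs.
by exists c; [move: cx; rewrite in_itv|rewrite -[x in RHS]subr0 -E sin0 subr0].
Qed.

Lemma sin_le_id x : 0 <= x -> sin x <= x.
Proof.
rewrite le_eqVlt => /predU1P[<-|x0]; first by rewrite sin0.
have [c _ ->] := sin_MVT x0.
by rewrite ger_pMl// cos_le1.
Qed.

Lemma sin_ge_cos_half x : 0 <= x <= 2^-1 -> cos 2^-1 * x <= sin x.
Proof.
move=> /andP[]; rewrite le_eqVlt => /predU1P[<-|x0 x1]; first by rewrite sin0 mulr0.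
have [c /andP[c0 cx] ->] := sin_MVT x0.
rewrite ler_pM2r//.
have p2 : 2 <= pi :> R by exact: pi_ge2.
by rewrite ltW// ltr_cos ?in_itv/=; lra.
Qed.

Lemma cos_half_gt0 : 0 < cos 2^-1 :> R.
Proof.
have p2 : 2 <= pi :> R by exact: pi_ge2.
by apply: cos_gt0_pihalf; lra.
Qed.

Lemma oneBcos_le_sqr x : 0 <= x <= 1 -> 1 - cos x <= x ^+ 2.
Proof.
move=> /andP[x0 x1].
have p2 : 2 <= pi :> R by exact: pi_ge2.
have c0 : 0 <= cos x by apply: cos_ge0_pihalf; lra.
have c1 := cos_le1 x.
apply: (@le_trans _ _ (sin x ^+ 2)).
  by rewrite sin2cos2 lerD2l lerN2 expr2 ler_piMl.
have s0 : 0 <= sin x by apply: sin_ge0_pi; lra.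
by rewrite !expr2 ler_pM// sin_le_id.
Qed.

End trigonometric_bounds.

Section powR_bounds.
Context {R : realType}.
Implicit Types u x p : R.

Lemma ler_powR_base (x y p : R) : 0 <= p -> 0 <= x -> x <= y -> x `^ p <= y `^ p.
Proof.
by move=> p0 x0 xy; apply: ge0_ler_powR; rewrite ?nnegrE// (le_trans x0).
Qed.

Lemma powR_le1 (x p : R) : 0 <= p -> 0 <= x <= 1 -> x `^ p <= 1.
Proof. by move=> p0 /andP[x0 x1]; have := ler_powR_base p0 x0 x1; rewrite powR1. Qed.

Lemma bernoulli_expr u n : 0 <= u <= 1 -> 1 - u ^+ n <= n%:R * (1 - u).
Proof.
move=> /andP[u0 u1]; elim: n => [|n IH]; first by rewrite expr0 subrr mul0r.
have un : u ^+ n <= 1 by rewrite exprn_ile1.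
have -> : 1 - u ^+ n.+1 = (1 - u ^+ n) + u ^+ n * (1 - u) by rewrite exprS; ring.
rewrite -natr1 mulrDl mul1r lerD//.
by rewrite ler_piMl// subr_ge0.
Qed.

(** An integer above [p]: on [0, 1] a larger exponent gives a smaller power, so Bernoulli's
    inequality for this integer implies one for the real exponent. *)
Definition powR_lip p : R := (Num.truncn p).+1%:R.

Lemma powR_lip_ge1 p : 1 <= powR_lip p.
Proof. by rewrite /powR_lip ler1n. Qed.

Lemma bernoulli_powR u p : 0 <= p -> 0 <= u <= 1 -> 1 - u `^ p <= powR_lip p * (1 - u).
Proof.
move=> p0 /andP[]; rewrite le_eqVlt => /predU1P[<- _|u0 u1].
  have [->|p1] := eqVneq p 0; first by rewrite powRr0 subrr mulr_ge0// ?subr_ge0// ltW// (lt_le_trans _ (powR_lip_ge1 _)).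
  by rewrite powR0// !subr0 mulr1 powR_lip_ge1.
apply: le_trans (bernoulli_expr _ _); last by rewrite ltW.
rewrite lerD2l lerN2 -powR_mulrn ?(ltW u0)//.
rewrite ger_powR ?u0//; by rewrite ltW// truncnS_gt.
Qed.

Lemma powRB_le x a p : 0 <= p -> 0 <= a <= x -> 0 < x ->
  x `^ p - a `^ p <= powR_lip p * ((x - a) / x) * x `^ p.
Proof.
move=> p0 /andP[a0 ax] x0.
have u01 : 0 <= a / x <= 1.
  by rewrite divr_ge0 ?(ltW x0)//= ler_pdivrMr// mul1r.
have := bernoulli_powR p0 u01.
rewrite -(@ler_pM2r _ (x `^ p)) ?powR_gt0//.
rewrite mulrBl mul1r -powRM ?divr_ge0// ?(ltW x0)// divfK ?gt_eqF//.
by rewrite (_ : 1 - a / x = (x - a) / x)// mulrBl divff// gt_eqF.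
Qed.

Lemma powR_oneB_le (z M p : R) : 0 <= p -> 0 <= z <= M -> 1 <= M ->
  `|z `^ p - 1| <= powR_lip p * M `^ p * `|z - 1|.
Proof.
move=> p0 /andP[z0 zM] M1.
have Mp : 1 <= M `^ p by rewrite -[leLHS](powRr0 M) ler_powR.
have L0 : 0 < powR_lip p by rewrite (lt_le_trans _ (powR_lip_ge1 _)).
have [z1|z1] := leP z 1.
  have zp : z `^ p <= 1.
    by rewrite powR_le1// z0.
  rewrite distrC (ger0_norm (_ : 0 <= 1 - z `^ p)) ?subr_ge0//.
  rewrite distrC (ger0_norm (_ : 0 <= 1 - z)) ?subr_ge0//.
  apply: le_trans (bernoulli_powR p0 _) _; first by rewrite z0.
  by rewrite ler_wpM2r ?subr_ge0// ler_peMr// ltW.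
have zp : 1 <= z `^ p by rewrite -[leLHS](powRr0 z) ler_powR// ltW.
rewrite !ger0_norm ?subr_ge0 ?(ltW z1)//.
have z'0 : 0 < z by rewrite (lt_trans _ z1).
have := @powRB_le z 1 p p0 _ z'0; rewrite ler01 (ltW z1) powR1 => /(_ isT) h.
apply: le_trans h _.
have -> : powR_lip p * M `^ p * (z - 1) = powR_lip p * (z - 1) * M `^ p by ring.
apply: ler_pM; rewrite ?powR_ge0//; last exact: ler_powR_base.
  by rewrite mulr_ge0 ?(ltW L0)// divr_ge0 ?(ltW z'0)// subr_ge0 ltW.
by rewrite ler_pM2l// ler_piMr ?subr_ge0 ?(ltW z1)// invf_le1// ltW.
Qed.

End powR_bounds.

Lemma powR_div {R : realType} (a b p : R) : 0 <= a -> 0 <= b ->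
  (a / b) `^ p = a `^ p / b `^ p.
Proof. by move=> a0 b0; rewrite powRM ?invr_ge0// powRV. Qed.

Section poisson_kernel.
Context {R : realType} (lam : R) (lam_gt0 : 0 < lam).
Local Notation leb := (@lebesgue_measure R).
Local Notation ang := (angular lam).
Implicit Types x y t a : R.

Definition sqdist t x y : R := (x - y) ^+ 2 + t ^+ 2.

Definition angular_int (A B : R) : R := \int[leb]_(th in `]0, pi[) ang A B th.

Lemma poissonE t x y : poisson lam t x y =
  2 * lam / pi * (x * y) `^ lam * t * angular_int (sqdist t x y) (2 * (x * y)).
Proof. by []. Qed.

Lemma sqdist_gt0 t x y : 0 < t -> 0 < sqdist t x y.
Proof. by move=> t0; rewrite ltr_wpDl ?sqr_ge0// exprn_gt0. Qed.

Lemma integrable_angular (A B : R) : 0 < A -> 0 <= B ->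
  leb.-integrable `]0, pi[ (EFin \o ang A B).
Proof.
move=> A0 B0; apply/integrableP; split.
  by apply/measurable_EFinP; apply: measurable_funTS; exact: measurable_angular.
apply: le_lt_trans (ltry (angular_cst lam / (A * (A + B) `^ lam))).
under eq_integral do rewrite /= ger0_norm ?angular_ge0//.
exact: integral_angular.
Qed.

Lemma angular_int_ge0 (A B : R) : 0 <= angular_int A B.
Proof. by apply: Rintegral_ge0 => x _; exact: angular_ge0. Qed.

Lemma angular_int_le (A B : R) : 0 < A -> 0 <= B ->
  angular_int A B <= angular_cst lam / (A * (A + B) `^ lam).
Proof.
move=> A0 B0; rewrite -lee_fin /angular_int /Rintegral fineK.
  exact: integral_angular.
by apply: integrable_fin_num => //; exact: integrable_angular.
Qed.

Definition poisson_cst : R := 2 * lam / pi * angular_cst lam.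

Lemma poisson_cst_gt0 : 0 < poisson_cst.
Proof. by rewrite mulr_gt0 ?angular_cst_gt0// divr_gt0 ?pi_gt0// mulr_gt0. Qed.

Let c0 : 0 <= 2 * lam / pi.
Proof. by rewrite divr_ge0 ?pi_ge0// mulr_ge0// ltW. Qed.

Lemma poisson_ge0 t x y : 0 <= t -> 0 <= poisson lam t x y.
Proof.
move=> t0; rewrite poissonE.
by rewrite mulr_ge0 ?angular_int_ge0// mulr_ge0// mulr_ge0// powR_ge0.
Qed.

Lemma poisson0x t y : poisson lam t 0 y = 0.
Proof.
rewrite poissonE.
have -> : (0 : R) * y = 0 by exact: mul0r.
by rewrite powR0 ?gt_eqF// mulr0 !mul0r.
Qed.

(** The source of all upper bounds on the kernel: the last power is at most 1, it decays once 2 x y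
    is dropped from its denominator, and it vanishes with [x]. *)
Lemma poisson_le t x y : 0 < t -> 0 <= x -> 0 <= y ->
  poisson lam t x y <= poisson_cst * (t / sqdist t x y) *
    (x * y / (sqdist t x y + 2 * (x * y))) `^ lam.
Proof.
move=> t0 x0 y0; have A0 := sqdist_gt0 x y t0.
have xy0 : 0 <= x * y by rewrite mulr_ge0.
have AB0 : 0 < sqdist t x y + 2 * (x * y) by rewrite ltr_pwDl// mulr_ge0.
rewrite poissonE powR_div ?(ltW AB0)//.
apply: (@le_trans _ _ (2 * lam / pi * (x * y) `^ lam * t *
   (angular_cst lam / (sqdist t x y * (sqdist t x y + 2 * (x * y)) `^ lam)))).
  rewrite ler_wpM2l//.
    by rewrite mulr_ge0 ?(ltW t0)// mulr_ge0// powR_ge0.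
  by rewrite angular_int_le// mulr_ge0.
have /lt0r_neq0 n1 := powR_gt0 lam AB0; have /lt0r_neq0 n2 := A0.
have /lt0r_neq0 H := pi_gt0 R; rewrite le_eqVlt; apply/orP; left; apply/eqP.
rewrite /poisson_cst; move: (@pi R) H => q qn0; field.
by rewrite n1 n2 qn0.
Qed.

Lemma poisson_le_cauchy t x y : 0 < t -> 0 <= x -> 0 <= y ->
  poisson lam t x y <= poisson_cst * (t / sqdist t x y).
Proof.
move=> t0 x0 y0; have A0 := sqdist_gt0 x y t0.
have xy0 : 0 <= x * y by rewrite mulr_ge0.
have AB0 : 0 < sqdist t x y + 2 * (x * y) by rewrite ltr_pwDl// mulr_ge0.
apply: le_trans (poisson_le t0 x0 y0) _.
rewrite ler_piMr//.
  by rewrite mulr_ge0 ?(ltW poisson_cst_gt0)// divr_ge0// ltW.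
rewrite powR_le1 ?(ltW lam_gt0)// divr_ge0 ?(ltW AB0)//= ler_pdivrMr// mul1r.
by lra.
Qed.

Lemma poisson_le_far t x y : 0 < t -> 0 <= x -> 0 <= y ->
  poisson lam t x y <=
  poisson_cst * t * (x * y) `^ lam / sqdist t x y `^ (lam + 1).
Proof.
move=> t0 x0 y0; have A0 := sqdist_gt0 x y t0.
have xy0 : 0 <= x * y by rewrite mulr_ge0.
have AB0 : 0 < sqdist t x y + 2 * (x * y) by rewrite ltr_pwDl// mulr_ge0.
apply: le_trans (poisson_le t0 x0 y0) _.
have -> : poisson_cst * t * (x * y) `^ lam / sqdist t x y `^ (lam + 1) =
    poisson_cst * (t / sqdist t x y) * ((x * y) / sqdist t x y) `^ lam.
  rewrite powRD_gt0// powRr1 ?(ltW A0)// powR_div ?(ltW A0)//.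
  by field; rewrite !gt_eqF// powR_gt0.
rewrite ler_wpM2l//.
  by rewrite mulr_ge0 ?(ltW poisson_cst_gt0)// divr_ge0// ltW.
rewrite ler_powR_base ?(ltW lam_gt0)//; first by rewrite divr_ge0// ltW.
rewrite ler_wpM2l// lef_pV2 ?posrE// lerDl; lra.
Qed.

(** An additive substitute for the distance from (x, 0) to (y, t), better suited to intervals and
    tents; its square is comparable with [sqdist]. *)
Definition reach t x y : R := `|x - y| + t.

Lemma reach_gt0 t x y : 0 < t -> 0 < reach t x y.
Proof. by move=> t0; rewrite ltr_wpDl. Qed.

Lemma reach_sqdist t x y : 0 < t ->
  sqdist t x y <= reach t x y ^+ 2 <= 2 * sqdist t x y.
Proof.
move=> t0; rewrite /reach /sqdist -(real_normK (num_real (x - y))).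
have := normr_ge0 (x - y); set u := `|_| => u0.
have : 0 <= (u - t) ^+ 2 by exact: sqr_ge0.
have : 0 <= u * t by rewrite mulr_ge0// ltW.
by rewrite !expr2 => ? ?; apply/andP; split; lra.
Qed.

(** For [lam < 1] the factor x^lam of the kernel is only Hoelder continuous of order [lam] at 0; for
    larger [lam] a Lipschitz bound is enough. *)
Definition hoelder_exp : R := Num.min lam 1.
Local Notation del := hoelder_exp.

Lemma hoelder_exp_gt0 : 0 < del.
Proof. by rewrite lt_min lam_gt0 ltr01. Qed.

Lemma hoelder_exp_le1 : del <= 1.
Proof. by rewrite ge_min lexx orbT. Qed.

Lemma hoelder_exp_le : del <= lam.
Proof. by rewrite ge_min lexx. Qed.

Lemma t_sqdist_le t x y : 0 < t -> t / sqdist t x y <= 2 / reach t x y.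
Proof.
move=> t0; have A0 := sqdist_gt0 x y t0; have r0 := reach_gt0 x y t0.
have /andP[_ rA] := reach_sqdist x y t0.
rewrite ler_pdivrMr// mulrAC ler_pdivlMr//.
apply: le_trans rA; rewrite expr2 ler_pM2r// /reach lerDr//.
Qed.

(** The gain (x / reach)^del reflects the vanishing of the kernel at [x = 0]. The ratio [z] of
    [poisson_le] is at most 4 x / reach: if y is at most twice the reach, [sqdist] is large enough
    in its denominator; otherwise the reach is below x and the term 2 x y is. *)
Lemma poisson_le_reach t x y : 0 < t -> 0 <= x -> 0 <= y ->
  poisson lam t x y <= 8 * poisson_cst * (x / reach t x y) `^ del / reach t x y.
Proof.
move=> t0 x0 y0; have A0 := sqdist_gt0 x y t0; have r0 := reach_gt0 x y t0.
have xy0 : 0 <= x * y by rewrite mulr_ge0.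
have AB0 : 0 < sqdist t x y + 2 * (x * y) by rewrite ltr_pwDl// mulr_ge0.
have p0 := poisson_cst_gt0.
have d0 := hoelder_exp_gt0.
have /andP[rA1 rA] := reach_sqdist x y t0.
set z := x * y / (sqdist t x y + 2 * (x * y)).
have z0 : 0 <= z by rewrite divr_ge0// ltW.
have z1 : z <= 1 by rewrite ler_pdivrMr// mul1r; lra.
have zr : z <= 4 * (x / reach t x y).
  rewrite mulrA ler_pdivrMr// mulrAC ler_pdivlMr//.
  rewrite -!mulrA [4 * _]mulrCA ler_wpM2l//.
  have yr : y <= x + reach t x y.
    rewrite /reach; have := ler_norm (y - x); rewrite distrC; lra.
  have [yr2|yr2] := leP y (2 * reach t x y).
    apply: (@le_trans _ _ (2 * reach t x y * reach t x y)).
      by rewrite ler_wpM2r// ltW.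
    rewrite -mulrA -expr2; lra.
  have rx : reach t x y <= x by lra.
  have := ler_wpM2r y0 rx; lra.
have zd : z `^ lam <= 4 * (x / reach t x y) `^ del.
  have xr0 : 0 <= x / reach t x y by rewrite divr_ge0// ltW.
  have [z00|zn0] := eqVneq z 0.
    by rewrite z00 powR0 ?gt_eqF// mulr_ge0// powR_ge0.
  have zgt0 : 0 < z by rewrite lt_neqAle eq_sym zn0.
  apply: (@le_trans _ _ (z `^ del)); first by rewrite ger_powR ?zgt0// hoelder_exp_le.
  apply: (@le_trans _ _ ((4 * (x / reach t x y)) `^ del)).
    by rewrite ler_powR_base// ltW.
  rewrite powRM// ler_wpM2r ?powR_ge0//.
  by rewrite -[leRHS]powRr1// ler_powR ?hoelder_exp_le1// ler1n.
apply: le_trans (poisson_le t0 x0 y0) _; rewrite -/z.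
have := t_sqdist_le x y t0.
set w := t / _ => w2.
have w0 : 0 <= w by rewrite divr_ge0// ltW.
rewrite (_ : 8 * _ * _ / _ = poisson_cst * (2 / reach t x y) * (4 * (x / reach t x y) `^ del)); last by ring.
have pw0 : 0 <= poisson_cst * w by rewrite mulr_ge0// ltW.
by apply: ler_pM => //; [exact: powR_ge0|rewrite ler_pM2l].
Qed.

(** The angular integral is homogeneous of degree -(lam + 1) in its two parameters, both of which
    scale by c^2; the prefactor has degree 2 lam + 1. This is what turns the kernel on a ray into a
    convolution kernel. *)
Lemma poisson_scale (c : R) t x y : 0 < c -> 0 < t -> 0 <= x -> 0 <= y ->
  poisson lam (c * t) (c * x) (c * y) = c^-1 * poisson lam t x y.
Proof.
move=> c_gt0 t0 x0 y0; rewrite !poissonE.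
have -> : sqdist (c * t) (c * x) (c * y) = c ^+ 2 * sqdist t x y.
  by rewrite /sqdist; ring.
have -> : 2 * (c * x * (c * y)) = c ^+ 2 * (2 * (x * y)) by ring.
have A0 := sqdist_gt0 x y t0.
have xy0 : 0 <= 2 * (x * y) by rewrite mulr_ge0// mulr_ge0.
have c20 : 0 <= c ^+ 2 by rewrite sqr_ge0.
have -> : angular_int (c ^+ 2 * sqdist t x y) (c ^+ 2 * (2 * (x * y))) =
    (c ^+ 2) `^ (- (lam + 1)) * angular_int (sqdist t x y) (2 * (x * y)).
  rewrite /angular_int -RintegralZl//; last exact: integrable_angular.
  apply: eq_Rintegral => th _; rewrite /angular.
  rewrite -(mulrA (c ^+ 2)) -mulrDr powRM// ?(ltW (angular_denom_gt0 _ _ _))//.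
  by rewrite powRN invfM; ring.
have -> : c * x * (c * y) = c ^+ 2 * (x * y) by ring.
rewrite powRM// ?mulr_ge0// powRN powRD_gt0 ?exprn_gt0// powRr1//.
have c2 : 0 < c ^+ 2 by rewrite exprn_gt0.
have /lt0r_neq0 n1 := powR_gt0 lam c2; have /lt0r_neq0 n2 := c_gt0.
have /lt0r_neq0 H := pi_gt0 R; move: (@pi R) H => q qn0; field.
by rewrite ?n1 ?n2 ?qn0.
Qed.

End poisson_kernel.

(** * Hoelder regularity of the Poisson kernel in its first point *)

Section poisson_regularity.
Context {R : realType} (lam : R) (lam_gt0 : 0 < lam).
Local Notation leb := (@lebesgue_measure R).
Local Notation ang := (angular lam).
Local Notation del := (hoelder_exp lam).
Implicit Types x y t a : R.

Let dist2 t x y (th : R) : R := sqdist t x y + 2 * (x * y) * (1 - cos th).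

(** With the square completed in [x], the remaining terms are nonnegative and do not involve [x]. *)
Let dist2E t x y th :
  dist2 t x y th = (x - y * cos th) ^+ 2 + (y ^+ 2 * (1 - cos th ^+ 2) + t ^+ 2).
Proof. by rewrite /dist2 /sqdist; ring. Qed.

Let angular_lip_cst : R := powR_lip (lam + 1) * 12 `^ (lam + 1) * 48.

(** Moving the first point by [h] changes the denominator by h (h + 2 e), where |e| times the reach
    is at most 3/2 of the denominator at [a]. The relative change is thus at most 4 h / r; the new
    denominator keeps at least a twelfth of the old one, and 48 = 4 * 12. *)
Let angular_lip t x a y th : 0 < t -> 0 < y -> 0 <= a -> a <= x ->
  2 * (x - a) <= reach t a y ->
  `|ang (sqdist t x y) (2 * (x * y)) th - ang (sqdist t a y) (2 * (a * y)) th| <=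
  angular_lip_cst * ((x - a) / reach t a y) * ang (sqdist t a y) (2 * (a * y)) th.
Proof.
move=> t0 y0 a0 ax hR.
have Aa := sqdist_gt0 a y t0; have Ax := sqdist_gt0 x y t0.
have r0 := reach_gt0 a y t0.
have /andP[rA1 rA2] := reach_sqdist a y t0.
have x0 : 0 <= x by apply: le_trans ax.
have Da : 0 < dist2 t a y th by apply: angular_denom_gt0 => //; rewrite !mulr_ge0// ltW.
have Dx : 0 < dist2 t x y th by apply: angular_denom_gt0 => //; rewrite !mulr_ge0// ltW.
have Da1 : sqdist t a y <= dist2 t a y th.
  by rewrite lerDl mulr_ge0 ?subr_ge0 ?cos_le1// !mulr_ge0// ltW.
set h := x - a in hR *; have h0 : 0 <= h by rewrite subr_ge0.
set r := reach t a y in r0 rA1 rA2 hR *.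
have xE : x = a + h by rewrite /h; ring.
set e := a - y * cos th.
have e2 : e ^+ 2 <= dist2 t a y th.
  rewrite dist2E lerDl addr_ge0 ?sqr_ge0// mulr_ge0 ?sqr_ge0//.
have DxE : dist2 t x y th = dist2 t a y th + h * (h + 2 * e).
  by rewrite !dist2E /e xE; ring.
have er : `|e| * r <= 3 / 2 * dist2 t a y th.
  have : 0 <= (`|e| - r) ^+ 2 by exact: sqr_ge0.
  have : `|e| ^+ 2 <= dist2 t a y th by rewrite real_normK ?num_real.
  rewrite !expr2; rewrite !expr2 in rA2; lra.
have hr : h * r <= dist2 t a y th.
  have : (2 * h) * r <= r * r by rewrite ler_wpM2r// ltW.
  rewrite expr2 in rA2; lra.
have dD : `|dist2 t a y th - dist2 t x y th| <= 4 * (h / r) * dist2 t a y th.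
  rewrite DxE opprD addrA subrr add0r normrN normrM (ger0_norm h0).
  have -> : 4 * (h / r) * dist2 t a y th = h * (4 * dist2 t a y th / r) by ring.
  rewrite ler_wpM2l// ler_pdivlMr//.
  have : `|h + 2 * e| <= h + 2 * `|e|.
    by rewrite (le_trans (ler_normD _ _))// normrM (ger0_norm h0) (ger0_norm (_ : 0 <= 2)).
  move=> /(ler_wpM2r (ltW r0)); lra.
have D12 : dist2 t a y th <= 12 * dist2 t x y th.
  have h2 : h ^+ 2 <= dist2 t a y th / 2.
    have : h * (2 * h) <= h * r by rewrite ler_wpM2l.
    have : (2 * h) * r <= r * r by rewrite ler_wpM2r// ltW.
    rewrite expr2 in rA2; rewrite expr2; lra.
  (* Eight times this square, with [h2] for the [h ^+ 2] that is left over, gives the inequality. *)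
  have : 0 <= (e + 3 / 2 * h) ^+ 2 by exact: sqr_ge0.
  have K0 : 0 <= y ^+ 2 * (1 - cos th ^+ 2) + t ^+ 2.
    by rewrite addr_ge0 ?sqr_ge0// -sin2cos2 mulr_ge0 ?sqr_ge0.
  move: h2; rewrite !dist2E -/e xE (_ : a + h - y * cos th = e + h); last by rewrite /e; ring.
  move: K0; set K := (_ + _); rewrite !expr2; lra.
set z := dist2 t a y th / dist2 t x y th.
have z0 : 0 <= z by rewrite divr_ge0// ltW.
have z12 : z <= 12 by rewrite ler_pdivrMr.
have z1 : `|z - 1| <= 48 * (h / r).
  have -> : z - 1 = (dist2 t a y th - dist2 t x y th) / dist2 t x y th.
    by rewrite /z mulrBl divff// gt_eqF.
  rewrite normrM normfV (gtr0_norm Dx) ler_pdivrMr//.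
  apply: (le_trans dD).
  have hr0 : 0 <= h / r by rewrite divr_ge0// ltW.
  have := ler_wpM2l hr0 D12; lra.
have -> : ang (sqdist t x y) (2 * (x * y)) th =
    z `^ (lam + 1) * ang (sqdist t a y) (2 * (a * y)) th.
  rewrite /z powR_div ?(ltW Da) ?(ltW Dx)// /angular -!/(dist2 _ _ _ _).
  have := powR_gt0 (lam + 1) Dx; have := powR_gt0 (lam + 1) Da.
  by move=> /lt0r_neq0 n1 /lt0r_neq0 n2; field; rewrite n1 n2.
rewrite -[X in _ - X]mul1r -mulrBl normrM (ger0_norm (angular_ge0 _ _ _ _)).
rewrite ler_wpM2r ?angular_ge0//.
have l10 : 0 <= lam + 1 by rewrite addr_ge0// ltW.
apply: le_trans (powR_oneB_le l10 (M := 12) _ _) _; rewrite ?z0 ?z12 ?ler1n//.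
rewrite /angular_lip_cst -!mulrA ler_pM2l ?(lt_le_trans _ (powR_lip_ge1 _))//.
by rewrite ler_pM2l ?powR_gt0.
Qed.

Let angular_int_lip t x a y : 0 < t -> 0 < y -> 0 <= a -> a <= x ->
  2 * (x - a) <= reach t a y ->
  `|angular_int lam (sqdist t x y) (2 * (x * y)) - angular_int lam (sqdist t a y) (2 * (a * y))| <=
  angular_lip_cst * ((x - a) / reach t a y) * angular_int lam (sqdist t a y) (2 * (a * y)).
Proof.
move=> t0 y0 a0 ax hR.
have x0 : 0 <= x by apply: le_trans ax.
have ya0 : 0 <= 2 * (a * y) by rewrite !mulr_ge0// ltW.
have yx0 : 0 <= 2 * (x * y) by rewrite !mulr_ge0// ltW.
have ix := integrable_angular lam_gt0 (sqdist_gt0 x y t0) yx0.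
have ia := integrable_angular lam_gt0 (sqdist_gt0 a y t0) ya0.
rewrite /angular_int -RintegralB//.
have ixa : leb.-integrable `]0, pi[ (EFin \o (fun th => ang (sqdist t x y) (2 * (x * y)) th - ang (sqdist t a y) (2 * (a * y)) th)).
  rewrite (_ : _ \o _ = (EFin \o ang (sqdist t x y) (2 * (x * y))) \- (EFin \o ang (sqdist t a y) (2 * (a * y))))%E//.
  exact: integrableB.
apply: le_trans (le_normr_Rintegral _ _) _ => //.
rewrite -RintegralZl//; apply: le_Rintegral => //.
- rewrite (_ : _ \o _ = abse \o (EFin \o (fun th => ang (sqdist t x y) (2 * (x * y)) th - ang (sqdist t a y) (2 * (a * y)) th)))//.
  exact: integrable_abse.
- have := @integrableZl _ _ _ leb `]0, pi[%classic (measurable_itv _) (angular_lip_cst * ((x - a) / reach t a y)) _ ia.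
  by [].
- by move=> th _; exact: angular_lip.
Qed.

Definition poisson_hoelder_cst : R :=
  32 * powR_lip lam * poisson_cst lam + 2 * angular_lip_cst * poisson_cst lam.

Lemma poisson_hoelder_cst_gt0 : 0 < poisson_hoelder_cst.
Proof.
have p0 := poisson_cst_gt0 lam_gt0.
have L1 p : 0 < powR_lip p :> R by rewrite (lt_le_trans _ (powR_lip_ge1 _)).
have a0 : 0 < angular_lip_cst by rewrite /angular_lip_cst mulr_gt0// mulr_gt0 ?powR_gt0.
by rewrite /poisson_hoelder_cst; apply: addr_gt0; apply: mulr_gt0 => //; apply: mulr_gt0.
Qed.

(** The difference splits into a variation of x^lam, measured against the kernel at [x], and a
    variation of the angular integral, measured against the kernel at [a]. The first is of relative
    size (h / x)^del, singular for small x, but the kernel at [x] brings (x / reach)^del and the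
    powers of x cancel. *)
Lemma poisson_hoelder t a x y : 0 < t -> 0 < y -> 0 <= a -> a <= x ->
  2 * (x - a) <= reach t a y ->
  `|poisson lam t x y - poisson lam t a y| <=
  poisson_hoelder_cst * ((x - a) / reach t a y) `^ del / reach t a y.
Proof.
move=> t0 y0 a0; rewrite le_eqVlt => /predU1P[<- _|ax hR].
  rewrite !subrr normr0 divr_ge0 ?mulr_ge0 ?powR_ge0 ?(ltW poisson_hoelder_cst_gt0)//.
  by rewrite ltW// reach_gt0.
have x0 : 0 < x by rewrite (le_lt_trans a0).
have p0 := poisson_cst_gt0 lam_gt0.
have d0 := hoelder_exp_gt0 lam_gt0.
have r0 := reach_gt0 a y t0; have rx0 := reach_gt0 x y t0.
set r := reach t a y in r0 hR *.
set h := x - a in hR *; have h0 : 0 < h by rewrite subr_gt0.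
have hr1 : 0 < h / r <= 1 by rewrite divr_gt0//= ler_pdivrMr// mul1r; lra.
have Aa := sqdist_gt0 a y t0; have Ax := sqdist_gt0 x y t0.
have rrx : r <= 2 * reach t x y.
  have : `|a - y| <= `|x - y| + h.
    have -> : a - y = (x - y) - h by rewrite /h; ring.
    by rewrite (le_trans (ler_normB _ _))// (gtr0_norm h0).
  by move: hR; rewrite /r /reach; lra.
set Ix := angular_int lam (sqdist t x y) (2 * (x * y)).
set Ia := angular_int lam (sqdist t a y) (2 * (a * y)).
have PE : poisson lam t x y - poisson lam t a y =
   2 * lam / pi * y `^ lam * t * ((x `^ lam - a `^ lam) * Ix) +
   2 * lam / pi * y `^ lam * t * (a `^ lam * (Ix - Ia)).
  rewrite !poissonE -/Ix -/Ia !powRM ?(ltW y0) ?(ltW x0)//; ring.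
have c0 : 0 <= 2 * lam / pi * y `^ lam * t.
  rewrite mulr_ge0 ?(ltW t0)// mulr_ge0 ?powR_ge0// divr_ge0 ?pi_ge0//.
  by rewrite mulr_ge0// ltW.
have -> : poisson_hoelder_cst * (h / r) `^ del / r =
    32 * powR_lip lam * poisson_cst lam * (h / r) `^ del / r +
    2 * angular_lip_cst * poisson_cst lam * (h / r) `^ del / r.
  by rewrite /poisson_hoelder_cst; ring.
rewrite PE (le_trans (ler_normD _ _))//; apply: lerD.
  have xa0 : 0 <= x `^ lam - a `^ lam.
    by rewrite subr_ge0 ler_powR_base ?(ltW lam_gt0)// ltW.
  rewrite ger0_norm; last by rewrite mulr_ge0// mulr_ge0// angular_int_ge0.
  have hx1 : 0 < h / x <= 1.
    by rewrite divr_gt0//= ler_pdivrMr// mul1r /h gerBl.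
  apply: (@le_trans _ _ (powR_lip lam * (h / x) * poisson lam t x y)).
    have -> : powR_lip lam * (h / x) * poisson lam t x y =
       2 * lam / pi * y `^ lam * t * ((powR_lip lam * (h / x) * x `^ lam) * Ix).
      by rewrite poissonE -/Ix powRM ?(ltW y0) ?(ltW x0)//; ring.
    rewrite ler_wpM2l// ler_wpM2r ?angular_int_ge0//.
    by apply: powRB_le; rewrite ?(ltW lam_gt0)// a0 ltW.
  have hxd : h / x <= (h / x) `^ del.
    by rewrite ger1_powR// hoelder_exp_le1.
  apply: (@le_trans _ _ (powR_lip lam * (h / x) `^ del *
     (8 * poisson_cst lam * (x / reach t x y) `^ del / reach t x y))).
    apply: ler_pM; rewrite ?poisson_ge0 ?(ltW t0)//.
    - by rewrite mulr_ge0 ?divr_ge0 ?(ltW h0) ?(ltW x0).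
    - by rewrite ler_wpM2l.
    - by apply: poisson_le_reach => //; exact: ltW.
  have -> : powR_lip lam * (h / x) `^ del *
     (8 * poisson_cst lam * (x / reach t x y) `^ del / reach t x y) =
     8 * powR_lip lam * poisson_cst lam * ((h / reach t x y) `^ del / reach t x y).
    have -> : h / reach t x y = h / x * (x / reach t x y).
      by field; rewrite !gt_eqF.
    by rewrite [in RHS]powRM ?divr_ge0 ?(ltW h0) ?(ltW x0) ?(ltW rx0)//; ring.
  have -> : 32 * powR_lip lam * poisson_cst lam * (h / r) `^ del / r =
     8 * powR_lip lam * poisson_cst lam * (4 * (h / r) `^ del / r) by ring.
  have L0 : 0 <= powR_lip lam by rewrite (le_trans _ (powR_lip_ge1 _)).
  rewrite ler_wpM2l//; first by apply: mulr_ge0 (ltW p0); exact: mulr_ge0.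
  have -> : 4 * (h / r) `^ del / r = (2 * (h / r) `^ del) * (2 / r) by ring.
  have ir : (reach t x y)^-1 <= 2 / r.
    by rewrite ler_pdivlMr// ler_pdivrMl// mulrC.
  apply: ler_pM; rewrite ?powR_ge0 ?invr_ge0 ?(ltW rx0)//.
  apply: (@le_trans _ _ ((2 * (h / r)) `^ del)).
    rewrite ler_powR_base ?(ltW d0) ?divr_ge0 ?(ltW h0) ?(ltW rx0)//.
    rewrite mulrCA ler_wpM2l// ltW//.
  rewrite powRM ?divr_ge0 ?(ltW h0) ?(ltW r0)// ler_wpM2r ?powR_ge0//.
  by rewrite -[leRHS]powRr1// ler_powR ?hoelder_exp_le1// ler1n.
rewrite normrM (ger0_norm c0) normrM (ger0_norm (powR_ge0 _ _)).
have cst0 : 0 <= angular_lip_cst * (h / r).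
  rewrite mulr_ge0 ?divr_ge0 ?(ltW h0) ?(ltW r0)//.
  by rewrite !mulr_ge0 ?powR_ge0.
have dI : `|Ix - Ia| <= angular_lip_cst * (h / r) * Ia.
  by apply: angular_int_lip => //; exact: ltW.
apply: (@le_trans _ _ (angular_lip_cst * (h / r) * poisson lam t a y)).
  have -> : angular_lip_cst * (h / r) * poisson lam t a y =
     2 * lam / pi * y `^ lam * t * (a `^ lam * (angular_lip_cst * (h / r) * Ia)).
    by rewrite poissonE -/Ia powRM ?(ltW y0)//; ring.
  by rewrite ler_wpM2l// ler_wpM2l ?powR_ge0.
have Pa : poisson lam t a y <= poisson_cst lam * (2 / r).
  apply: le_trans (poisson_le_cauchy _ t0 _ _) _; rewrite ?(ltW y0)//.
  by rewrite ler_pM2l// t_sqdist_le.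
have hrd : h / r <= (h / r) `^ del by rewrite ger1_powR// hoelder_exp_le1.
have -> : 2 * angular_lip_cst * poisson_cst lam * (h / r) `^ del / r =
   (angular_lip_cst * (h / r) `^ del) * (poisson_cst lam * (2 / r)) by ring.
apply: ler_pM => //; first by rewrite poisson_ge0// ltW.
by rewrite ler_wpM2l// !mulr_ge0 ?powR_ge0.
Qed.

End poisson_regularity.

Section poisson_lower_bound.
Context {R : realType} (lam : R) (lam_gt0 : 0 < lam).
Local Notation leb := (@lebesgue_measure R).
Local Notation ang := (angular lam).
Implicit Types x y t a : R.

(** For [p >= 0] the lower bound on the sine decides, for [p < 0] the upper bound [sin th <= a]; the
    minimum covers both, as 2 lam - 1 may have either sign. *)
Lemma sin_powR_ge (p a th : R) : 0 < a -> a <= 2^-1 -> a / 2 <= th <= a ->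
  Num.min 1 ((cos 2^-1 / 2) `^ p) * a `^ p <= sin th `^ p.
Proof.
move=> a0 a1 /andP[ath tha].
have th0 : 0 < th by lra.
have c0 := @cos_half_gt0 R.
have sa : sin th <= a by rewrite (le_trans (sin_le_id _))// ltW.
have th1 : 0 <= th <= 2^-1 by rewrite ltW//= (le_trans tha).
have sc : cos 2^-1 / 2 * a <= sin th.
  by apply: le_trans (sin_ge_cos_half th1); rewrite -mulrA ler_pM2l//; lra.
have ca0 : 0 < cos 2^-1 / 2 * a by rewrite mulr_gt0// divr_gt0.
have s0 : 0 < sin th by exact: lt_le_trans sc.
have [p0|p0] := leP 0 p.
  apply: (@le_trans _ _ ((cos 2^-1 / 2) `^ p * a `^ p)).
    by rewrite ler_wpM2r ?powR_ge0// ge_min lexx orbT.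
  rewrite -powRM ?(ltW a0)//; last by rewrite divr_ge0// ltW.
  by rewrite ler_powR_base// ltW.
apply: (@le_trans _ _ (a `^ p)).
  by rewrite ler_piMl ?powR_ge0// ge_min lexx.
have -> : p = - (- p) by rewrite opprK.
rewrite -oppr_gt0 in p0; move: (- p) p0 => q q0.
rewrite powRN (powRN (sin th)) lef_pV2 ?posrE ?powR_gt0//.
by apply: ler_powR_base => //; exact: ltW.
Qed.

Let low_cst : R := Num.min 1 ((cos 2^-1 / 2) `^ (2 * lam - 1)).

Let low_cst_gt0 : 0 < low_cst.
Proof. by rewrite lt_min ltr01 powR_gt0// divr_gt0// cos_half_gt0. Qed.

(** Only the angles in [a/2, a] are kept; on them [1 - cos th <= a ^+ 2]. *)
Lemma angular_int_ge (A B a : R) : 0 < A -> 0 <= B -> 0 < a -> a <= 2^-1 ->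
  low_cst / 2 * a `^ (2 * lam) / (A + B * a ^+ 2) `^ (lam + 1) <=
  angular_int lam A B.
Proof.
move=> A0 B0 a0 a1.
have D0 : 0 < A + B * a ^+ 2 by rewrite ltr_pwDl// mulr_ge0// sqr_ge0.
have p2 : 2 <= pi :> R by exact: pi_ge2.
rewrite -lee_fin /angular_int /Rintegral fineK; last first.
  by apply: integrable_fin_num => //; exact: integrable_angular.
apply: (@le_trans _ _ (\int[leb]_(th in `[(a / 2)%R, a]) (low_cst * a `^ (2 * lam - 1) / (A + B * a ^+ 2) `^ (lam + 1))%:E)%E).
  rewrite integral_cst//= lebesgue_measure_itv/= lte_fin ifT; last by lra.
  rewrite -EFinD -EFinM lee_fin le_eqVlt; apply/orP; left; apply/eqP.
  rewrite (_ : a - a / 2 = a / 2); last by field.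
  rewrite (_ : 2 * lam = 1 + (2 * lam - 1)); last by ring.
  by rewrite (powRD_gt0 1 _ a0) powRr1 ?(ltW a0)// addrAC subrr add0r; ring.
apply: (@le_trans _ _ (\int[leb]_(th in `[(a / 2)%R, a]) (ang A B th)%:E)%E); last first.
  apply: ge0_subset_integral => //.
  - by apply/measurable_EFinP; apply: measurable_funTS; exact: measurable_angular.
  - by move=> th _; rewrite lee_fin angular_ge0.
  - by move=> th /=; rewrite !in_itv/=; lra.
apply: ge0_le_integral => //.
- move=> th _; rewrite lee_fin divr_ge0 ?powR_ge0// mulr_ge0 ?powR_ge0//.
  exact: ltW.
- by apply/measurable_EFinP; apply: measurable_funTS; exact: measurable_angular.
move=> th; rewrite /= in_itv/= => tha; rewrite lee_fin.
have th01 : 0 <= th <= 1 by lra.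
have th0 : 0 <= th by lra.
have dth := angular_denom_gt0 th A0 B0.
have la0 : 0 <= low_cst * a `^ (2 * lam - 1).
  by apply: mulr_ge0; [exact: ltW|exact: powR_ge0].
rewrite /angular ler_pM ?invr_ge0 ?powR_ge0//; first exact: sin_powR_ge.
rewrite lef_pV2 ?posrE ?powR_gt0// ler_powR_base ?(ltW dth)//.
  by rewrite addr_ge0// ltW.
rewrite lerD2l ler_wpM2l// (le_trans (oneBcos_le_sqr th01))//.
by rewrite !expr2 ler_pM//; lra.
Qed.

Definition poisson_low_cst : R :=
  2 * lam / pi * (low_cst / 2 * 2^-1 `^ (3 * lam) / 9 `^ (lam + 1)).

Lemma poisson_low_cst_gt0 : 0 < poisson_low_cst.
Proof.
have l0 := low_cst_gt0.
apply: mulr_gt0; first by rewrite divr_gt0 ?pi_gt0// mulr_gt0.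
by apply: divr_gt0; rewrite ?powR_gt0//; apply: mulr_gt0; rewrite ?powR_gt0//; apply: divr_gt0.
Qed.

Lemma poisson_ge t x y : 0 < t -> t <= x -> x / 2 <= y <= 2 * x ->
  `|x - y| <= 2 * t -> poisson_low_cst / t <= poisson lam t x y.
Proof.
move=> t0 tx /andP[yl yu] xyt.
have x0 : 0 < x by exact: lt_le_trans tx.
have y0 : 0 < y by lra.
(* At this angle the term [2 * (x * y) * a ^+ 2] is at most [t ^+ 2], so it does not spoil the
   denominator. *)
pose a := t / (2 * x).
have a0 : 0 < a by rewrite divr_gt0// mulr_gt0.
have a1 : a <= 2^-1 by rewrite ler_pdivrMr ?mulr_gt0// mulKf.
have A0 := sqdist_gt0 x y t0.
have B0 : 0 <= 2 * (x * y) by rewrite !mulr_ge0// ltW.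
have D9 : sqdist t x y + 2 * (x * y) * a ^+ 2 <= 9 * t ^+ 2.
  have : (x - y) ^+ 2 <= 4 * t ^+ 2.
    by rewrite -real_normK ?num_real// (_ : 4 * t ^+ 2 = (2 * t) ^+ 2) ?ler_sqr ?nnegrE ?mulr_ge0 ?(ltW t0)//; ring.
  have : 2 * (x * y) * a ^+ 2 <= t ^+ 2.
    have -> : 2 * (x * y) * a ^+ 2 = (y / (2 * x)) * t ^+ 2.
      by rewrite /a; field; rewrite gt_eqF.
    by rewrite ler_piMl ?sqr_ge0// ler_pdivrMr ?mulr_gt0// mul1r.
  have := sqr_ge0 t; rewrite /sqdist; lra.
have D0 : 0 < sqdist t x y + 2 * (x * y) * a ^+ 2 by rewrite ltr_pwDl// mulr_ge0// sqr_ge0.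
have l10 : 0 <= lam + 1 by rewrite addr_ge0// ltW.
rewrite poissonE.
apply: (@le_trans _ _ (2 * lam / pi * (x ^+ 2 * 2^-1) `^ lam * t *
   (low_cst / 2 * a `^ (2 * lam) / (9 * t ^+ 2) `^ (lam + 1)))); last first.
  have c0 : 0 <= 2 * lam / pi by rewrite divr_ge0 ?pi_ge0// mulr_ge0// ltW.
  apply: ler_pM.
  - by rewrite mulr_ge0 ?(ltW t0)// mulr_ge0// powR_ge0.
  - rewrite divr_ge0 ?powR_ge0// mulr_ge0 ?powR_ge0// divr_ge0//.
    exact: ltW.
  - rewrite ler_wpM2r ?(ltW t0)// ler_wpM2l// ler_powR_base ?(ltW lam_gt0)//.
      by rewrite mulr_ge0// sqr_ge0.
    by rewrite expr2 -mulrA ler_pM2l.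
  - apply: le_trans (angular_int_ge A0 B0 a0 a1).
    rewrite ler_wpM2l//.
      by rewrite mulr_ge0 ?powR_ge0// divr_ge0// ltW.
    by rewrite lef_pV2 ?posrE ?powR_gt0 ?mulr_gt0 ?exprn_gt0// ler_powR_base// ltW.
have -> : a `^ (2 * lam) = (t `^ (2 * lam)) * (2^-1) `^ (2 * lam) / x `^ (2 * lam).
  have -> : a = t * 2^-1 / x by rewrite /a; field; rewrite gt_eqF.
  by rewrite powR_div ?powRM// ?(ltW t0)// ?(ltW x0)// mulr_ge0// ltW.
have -> : (x ^+ 2 * 2^-1) `^ lam = x `^ (2 * lam) * 2^-1 `^ lam.
  by rewrite powRM ?sqr_ge0// powRrM powR_mulrn// ltW.
have -> : (9 * t ^+ 2) `^ (lam + 1) = 9 `^ (lam + 1) * (t `^ (2 * lam) * t ^+ 2).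
  rewrite powRM ?sqr_ge0//; congr (_ * _).
  by rewrite powRD_gt0 ?exprn_gt0// powRr1 ?sqr_ge0// powRrM powR_mulrn// ltW.
rewrite /poisson_low_cst.
have -> : 2^-1 `^ (3 * lam) = 2^-1 `^ lam * 2^-1 `^ (2 * lam) :> R.
  by rewrite -powRD_gt0//; congr (_ `^ _); ring.
have /lt0r_neq0 n1 := powR_gt0 (2 * lam) x0.
have /lt0r_neq0 n2 := powR_gt0 (2 * lam) t0.
have /lt0r_neq0 n3 := powR_gt0 (lam + 1) (ltr0n R 9).
have /lt0r_neq0 H := pi_gt0 R; have /lt0r_neq0 n4 := t0.
move: (2^-1 `^ lam) (2^-1 `^ (2 * lam)) low_cst => u w l.
move: n3 n2 n1; move: (9 `^ _) (t `^ _) (x `^ _) => b1 b2 b3 n3 n2 n1.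
move: (@pi R) H => q qn0; rewrite le_eqVlt; apply/orP; left; apply/eqP; field.
by rewrite ?n1 ?n2 ?n3 ?n4 ?qn0.
Qed.

End poisson_lower_bound.

Section measurability.
Context {R : realType} (lam : R) (lam_gt0 : 0 < lam).
Local Notation leb := (@lebesgue_measure R).
Local Notation T3 := ((measurableTypeR R * (measurableTypeR R * measurableTypeR R))%type).

(* coordinates [(x, (y, t))] *)
Let A (z : T3) : R := sqdist z.2.2 z.1 z.2.1.
Let B (z : T3) : R := 2 * (z.1 * z.2.1).

Lemma measurable_poisson :
  measurable_fun [set: T3] (fun z : T3 => poisson lam z.2.2 z.1 z.2.1).
Proof.
have mx : measurable_fun [set: T3] (fun z : T3 => z.1) by exact: measurable_fst.
have my : measurable_fun [set: T3] (fun z : T3 => z.2.1).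
  exact: (measurableT_comp measurable_fst measurable_snd).
have mt : measurable_fun [set: T3] (fun z : T3 => z.2.2).
  exact: (measurableT_comp measurable_snd measurable_snd).
have mxy : measurable_fun [set: T3] (fun z : T3 => z.1 * z.2.1) by exact: measurable_funM.
have mA : measurable_fun [set: T3] A.
  apply: measurable_funD; last exact: measurable_funX.
  by apply: measurable_funX; exact: measurable_funB.
have mB : measurable_fun [set: T3] B.
  by apply: measurable_funM => //; exact: measurable_cst.
pose g (z : T3 * measurableTypeR R) : \bar R :=
  ((fun w : T3 * measurableTypeR R => (angular lam (A w.1) (B w.1) w.2)%:E) \_ (setT `*` `]0%R, pi[%classic))%E z.
have mg : measurable_fun setT g.
  apply: measurable_patch.
    by apply: measurableX => //; exact: measurable_itv.
  apply/measurable_EFinP; apply: measurable_funM.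
    apply: (measurableT_comp (measurable_powR _)).
    apply: (@measurableT_comp _ _ _ _ _ _ (@sin R)); last exact: measurable_snd.
    by apply: continuous_measurable_fun; exact: continuous_sin.
  under eq_fun do rewrite -powRN.
  apply: (measurableT_comp (measurable_powR _)).
  apply: measurable_funD; first exact: (measurableT_comp mA measurable_fst).
  apply: measurable_funM; first exact: (measurableT_comp mB measurable_fst).
  apply: measurable_funB; first exact: measurable_cst.
  apply: (@measurableT_comp _ _ _ _ _ _ (@cos R)); last exact: measurable_snd.
  by apply: continuous_measurable_fun; exact: continuous_cos.
have g0 z : (0 <= g z)%E.
  by apply: erestrict_ge0 => y _; rewrite lee_fin angular_ge0.
have mG : measurable_fun [set: T3] (fubini_F leb g).
  by apply: measurable_fun_fubini_tonelli_F.
have mI : measurable_fun [set: T3] (fun z => angular_int lam (A z) (B z)).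
  rewrite (_ : (fun z => _) = fine \o (fubini_F leb g)).
    by apply: (measurableT_comp _ mG); exact: fine_measurable.
  apply/funext => z; rewrite /angular_int /Rintegral /=; congr fine.
  rewrite integral_mkcond; apply: eq_integral => th _.
  rewrite /g /patch /=.
  suff -> : ((z, th) \in [set: T3] `*` `]0%R, pi[%classic) = (th \in `]0, pi[%classic) by [].
  by apply/idP/idP; rewrite !inE/=; [case|].
rewrite (_ : (fun z => _) = fun z => 2 * lam / pi * (z.1 * z.2.1) `^ lam * z.2.2 * angular_int lam (A z) (B z))//.
apply: measurable_funM => //; apply: measurable_funM => //.
apply: measurable_funM; first exact: measurable_cst.
exact: (measurableT_comp (measurable_powR _) mxy).
Qed.

End measurability.

(** * Balayage of a Carleson measure *)

Section bounded_intervals.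
Context {R : realType}.
Local Notation leb := (@lebesgue_measure R).

Lemma itv_length_itv (a b : R) (ba bb : bool) : a <= b ->
  itv_length [set` Interval (BSide ba a) (BSide bb b)] = b - a.
Proof.
move=> ab; rewrite /itv_length lebesgue_measure_itv/= lte_fin.
by case: ltP => //= ba'; apply/esym/eqP; rewrite subr_eq0 eq_le ab ba'.
Qed.

Lemma bounded_interval_itv (a b : R) (ba bb : bool) : 0 <= a -> a < b ->
  (a = 0 -> ba = false) ->
  bounded_interval [set` Interval (BSide ba a) (BSide bb b)].
Proof.
move=> a0 ab aba; split.
- exact: interval_is_interval.
- by rewrite itv_length_itv ?subr_gt0// ltW.
- exists b => x /=; rewrite !in_itv/= => /andP[xa xb]; apply/andP; split.
    case: ba aba xa => /= aba; last exact: le_lt_trans.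
    move=> ax; rewrite (lt_le_trans _ ax)// lt_neqAle a0 andbT; apply/eqP => a0'.
    by have := aba (esym a0').
  by move: xb; case: bb => //= /ltW.
Qed.

(** Supplies real endpoints without deciding which of them belong to [I]. *)
Lemma bounded_intervalP (I : set R) : bounded_interval I ->
  exists a b : R, [/\ 0 <= a, a < b, itv_length I = b - a, (I `<=` `[a, b]%classic)
    & (`]a, b[%classic `<=` I /\ measurable (I : set (measurableTypeR R)))].
Proof.
move=> [iI l0 [M IM]].
have [x0 Ix0] : I !=set0.
  apply/set0P/eqP => I0; move: l0; rewrite I0 /itv_length measure0.
  by rewrite ltxx.
have lbI : has_inf I.
  split; first by exists x0.
  by exists 0 => x /IM; rewrite /= in_itv/= => /andP[/ltW].
have ubI : has_sup I.
  split; first by exists x0.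
  by exists M => x /IM; rewrite /= in_itv/= => /andP[].
have Iab : I `<=` `[inf I, sup I]%classic.
  move=> x Ix; rewrite /= in_itv/=; apply/andP; split.
    by apply: ge_inf => //; exact: lbI.2.
  by apply: ub_le_sup => //; exact: ubI.2.
have abI : `]inf I, sup I[%classic `<=` I.
  move=> x; rewrite /= in_itv/= => /andP[ix xs].
  have [y Iy yx] := inf_lt lbI.1 ix.
  have [z Iz xz] := sup_gt ubI.1 xs.
  by apply: (iI y z) => //; rewrite !ltW.
have mI : measurable (I : set (measurableTypeR R)).
  exact: is_interval_measurable.
have ab : inf I <= sup I.
  by have := Iab _ Ix0; rewrite /= in_itv/= => /andP[]; exact: le_trans.
have IE : itv_length I = sup I - inf I.
  rewrite /itv_length; suff -> : leb I = (sup I - inf I)%:E by [].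
  apply/eqP; rewrite eq_le; apply/andP; split.
    apply: (@le_trans _ _ (leb `[inf I, sup I]%classic)).
      by apply: le_measure => //; rewrite inE//; exact: measurable_itv.
    rewrite lebesgue_measure_itv/= lte_fin; case: ifP => // _.
    by rewrite lee_fin subr_ge0.
  apply: (@le_trans _ _ (leb `]inf I, sup I[%classic)); last first.
    by apply: le_measure => //; rewrite inE//; exact: measurable_itv.
  rewrite lebesgue_measure_itv/= lte_fin; case: ltP => // h.
  by rewrite lee_fin subr_le0.
exists (inf I), (sup I); split => //.
- by apply: lb_le_inf => [|x /IM]; [exists x0|rewrite /= in_itv/= => /andP[/ltW]].
- by rewrite -subr_gt0 -IE.
Qed.

Lemma integrable_cst_itv (I : set R) (k : R) :
  measurable (I : set (measurableTypeR R)) -> (leb I < +oo)%E ->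
  leb.-integrable I (cst k%:E).
Proof.
move=> mI muI; apply/integrableP; split; first exact: measurable_cst.
by rewrite integral_cst// lte_mul_pinfty.
Qed.

(** Allows any convenient constant in place of the mean: the distance from the mean to [c] is itself
    at most the average of |f - c|. *)
Lemma mean_oscillation_le (f : R -> R) (I : set R) (c : R) :
  measurable (I : set (measurableTypeR R)) -> 0 < itv_length I ->
  leb.-integrable I (EFin \o f) ->
  \int[leb]_(y in I) `|f y - mean f I| <= 2 * \int[leb]_(y in I) `|f y - c|.
Proof.
move=> mI l0 fI.
have muI : (leb I < +oo)%E.
  by rewrite ltey; apply/eqP => muI; move: l0; rewrite /itv_length muI ltxx.
have muIf : leb I \is a fin_num by rewrite ge0_fin_numE.
have ic (k : R) : leb.-integrable I (EFin \o (fun y => f y - k)).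
  rewrite (_ : _ \o _ = (EFin \o f) \- cst k%:E)%E//.
  by apply: integrableB => //; exact: integrable_cst_itv.
have ia (k : R) : leb.-integrable I (EFin \o (fun y => `|f y - k|)).
  by rewrite (_ : _ \o _ = abse \o (EFin \o (fun y => f y - k)))//; exact: integrable_abse.
have ick (k : R) : leb.-integrable I (EFin \o (fun=> k)) by exact: integrable_cst_itv.
have mc : `|mean f I - c| * itv_length I <= \int[leb]_(y in I) `|f y - c|.
  apply: le_trans (le_normr_Rintegral _ (ic c)) => //.
  rewrite RintegralB// Rintegral_cst// /mean -/(itv_length I).
  rewrite -{2}(gtr0_norm l0) -normrM mulrBl mulrAC mulVf ?gt_eqF// mul1r.
  by [].
apply: (@le_trans _ _ (\int[leb]_(y in I) (`|f y - c| + `|mean f I - c|))).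
  apply: le_Rintegral => //.
    rewrite (_ : _ \o _ = (EFin \o (fun y => `|f y - c|%R)) \+ cst (`|mean f I - c|%R)%:E)%E//.
    by apply: integrableD => //; exact: integrable_cst_itv.
  move=> y _; have -> : f y - mean f I = (f y - c) - (mean f I - c) by ring.
  exact: ler_normB.
by rewrite RintegralD// Rintegral_cst// -/(itv_length I) mulr_natl mulr2n lerD2l.
Qed.

End bounded_intervals.

Lemma measurable_inv {R : realType} : measurable_fun [set: R] (@GRing.inv R).
Proof.
rewrite -(setvU [set 0]); apply/measurable_funU => //; first exact: measurableC.
split; last exact: measurable_fun_set1.
apply: open_continuous_measurable_fun.
  by apply: closed_openC; exact: closed_eq.
by move=> x; rewrite inE/= => /eqP x0; exact: inv_continuous.
Qed.

Lemma nneseries_geometric {R : realType} (c q : R) : 0 <= c -> 0 <= q < 1 ->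
  (\sum_(n <oo) (c * q ^+ n)%:E = (c / (1 - q))%:E)%E.
Proof.
move=> c0 /andP[q0 q1]; apply/cvg_lim => //.
rewrite (_ : (fun n => _) = EFin \o series (geometric c q)).
  apply: cvg_EFin; first exact: nearW.
  by apply: cvg_geometric_series; rewrite ger0_norm.
by apply/funext => n; rewrite /= /series/= -sumEFin.
Qed.

Lemma exists_dyadic_floor {R : realType} (x : R) : 1 <= x ->
  exists n : nat, 2 ^+ n <= x < 2 ^+ n.+1.
Proof.
move=> x1; have x0 : 0 <= x by rewrite (le_trans ler01).
have k0 : (0 < Num.truncn x)%N by rewrite truncn_gt0.
have /andP[h1 h2] := trunc_log_bounds (isT : (1 < 2)%N) k0.
exists (trunc_log 2 (Num.truncn x)); apply/andP; split.
  by rewrite (le_trans _ (andP (truncn_itv x0)).1)// -natrX ler_nat.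
by rewrite (lt_le_trans (truncnS_gt _))// -natrX ler_nat.
Qed.

(** * Carleson measures of balls and weighted tails *)

Section carleson_balls.
Context {R : realType}.
Local Notation leb := (@lebesgue_measure R).
Local Notation T2 := ((measurableTypeR R * measurableTypeR R)%type).

(** Phrased for a set function and a real constant, so that it applies to |mu| and to both parts of
    mu with the same [N]. *)
Definition carleson_bound (m : set T2 -> \bar R) (N : R) : Prop :=
  m (~` quadrant) = 0%E /\
  forall I : set R, bounded_interval I -> (m (tent I) <= (N * itv_length I)%:E)%E.

Definition reach_ball (a r : R) : set T2 :=
  [set z | quadrant z /\ reach z.2 a z.1 < r].

Lemma measurable_quadrant : measurable (quadrant : set T2).
Proof. by apply: measurableX; exact: measurable_itv. Qed.

Lemma measurable_tent (I : set R) : measurable (I : set (measurableTypeR R)) ->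
  measurable (tent I : set T2).
Proof. by move=> mI; apply: measurableX => //; exact: measurable_itv. Qed.

Lemma measurable_reach (a : R) : measurable_fun [set: T2] (fun z : T2 => reach z.2 a z.1).
Proof.
apply: measurable_funD; last exact: measurable_snd.
apply: measurableT_comp => //; apply: measurable_funB; first exact: measurable_cst.
exact: measurable_fst.
Qed.

Lemma measurable_reach_ball (a r : R) : measurable (reach_ball a r).
Proof.
rewrite (_ : reach_ball a r = quadrant `&` ((fun z : T2 => reach z.2 a z.1) @^-1` `]-oo, r[)).
  apply: measurableI; first exact: measurable_quadrant.
  by rewrite -[X in measurable X]setTI; apply: measurable_reach => //; exact: measurable_itv.
by apply/seteqP; split => z [q h]; split => //; move: h; rewrite /= in_itv.
Qed.

(** The interval of radius [r] about [a], cut at 0, keeps a length of at least [r] because [a >= 0],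
    so its tent is as high as the ball. *)
Lemma reach_ball_tent (a r : R) : 0 <= a -> 0 < r ->
  exists I : set R, [/\ bounded_interval I, itv_length I <= 2 * r & reach_ball a r `<=` tent I].
Proof.
move=> a0 r0; pose b := Num.max 0 (a - r).
have b0 : 0 <= b by rewrite le_max lexx.
have ba : b <= a by rewrite ge_max a0 gerBl ltW.
have bl : a - r <= b by rewrite le_max lexx orbT.
have bar : b < a + r by rewrite (le_lt_trans ba)// ltrDl.
have IE : itv_length `]b, a + r[ = a + r - b by apply: itv_length_itv; exact: ltW.
exists `]b, a + r[%classic; split.
- exact: bounded_interval_itv.
- by rewrite IE; lra.
move=> [y t] [[/= y0 t0] h]; move: y0 t0; rewrite !in_itv/= !andbT => y0 t0.
have h1 : `|a - y| < r by move: h; rewrite /reach/=; lra.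
have ha : 0 <= `|a - y| by [].
move: h1; rewrite ltr_norml => /andP[h1 h2].
split => /=; rewrite in_itv/=.
  by rewrite gt_max y0/=; apply/andP; split; lra.
by rewrite t0 IE/=; move: h; rewrite /reach/=; lra.
Qed.

Lemma carleson_reach_ball (m : {measure set T2 -> \bar R}) (N a r : R) :
  carleson_bound m N -> 0 <= N -> 0 <= a -> 0 < r ->
  (m (reach_ball a r) <= (2 * N * r)%:E)%E.
Proof.
move=> [_ mN] N0 a0 r0; have [I [bI lI rI]] := reach_ball_tent a0 r0.
have [_ [_ [_ _ _ _ [_ mI]]]] := bounded_intervalP bI.
apply: (@le_trans _ _ (m (tent I))).
  apply: le_measure => //; rewrite inE; first exact: measurable_reach_ball.
  exact: measurable_tent.
apply: le_trans (mN _ bI) _; rewrite lee_fin.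
by rewrite (_ : 2 * N * r = N * (2 * r)) ?ler_wpM2l//; ring.
Qed.

(** Makes Tonelli's theorem available. The measure lives on the whole plane, so the null complement
    of the quadrant is joined to every set of the cover. *)
Lemma carleson_sigma_finite (m : {measure set T2 -> \bar R}) (N : R) :
  carleson_bound m N -> 0 <= N -> sigma_finite setT m.
Proof.
move=> mN N0; exists (fun n => ~` quadrant `|` reach_ball 0 n.+1%:R).
  apply/seteqP; split => // -[y t] _.
  have [q|nq] := pselect (quadrant (y, t)); last by exists 0%N => //; left.
  exists (Num.truncn (reach t 0 y)) => //; right; split => //=.
  exact: truncnS_gt.
move=> n; have mq : measurable (~` quadrant : set T2).
  by apply: measurableC; exact: measurable_quadrant.
have mr := measurable_reach_ball 0 n.+1%:R.
split; first exact: measurableU.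
apply: le_lt_trans (measureU2 _ mq mr) _.
rewrite [X in (X + _)%E]mN.1 add0e.
by apply: le_lt_trans (carleson_reach_ball mN N0 _ _) _ => //; exact: ltry.
Qed.

End carleson_balls.

Section reach_tail.
Context {R : realType}.
Local Notation T2 := ((measurableTypeR R * measurableTypeR R)%type).
Variables (m : {measure set T2 -> \bar R}) (N : R).
Hypotheses (mN : carleson_bound m N) (N0 : 0 <= N).
Variables (d a l : R).
Hypotheses (d0 : 0 < d) (a0 : 0 <= a) (l0 : 0 < l).

Definition tail_set : set T2 := quadrant `\` reach_ball a l.

Lemma measurable_tail_set : measurable tail_set.
Proof.
by apply: measurableD; [exact: measurable_quadrant|exact: measurable_reach_ball].
Qed.

Lemma tail_set_reach z : tail_set z -> [/\ 0 < z.1, 0 < z.2 & l <= reach z.2 a z.1].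
Proof.
case: z => y t [q nb]; have [/= + +] := q; rewrite !in_itv/= !andbT => y0 t0.
by split => //=; rewrite leNgt; apply/negP => h; apply: nb.
Qed.

Definition tail_fun (z : T2) : R := (l / reach z.2 a z.1) `^ d / reach z.2 a z.1.

(** A ball of radius r has mass at most 2 N r, and the ball covering a dyadic ring has twice its
    inner radius: together 4. The ratio of the geometric series is 2^-d. *)
Definition tail_cst : R := 4 / (1 - 2^-1 `^ d).

Let q_lt1 : 2^-1 `^ d < 1 :> R.
Proof.
have : 2^-1 `^ d < 1 `^ d :> R.
  by apply: gt0_ltr_powR; rewrite ?nnegrE// ?invr_ge0// invf_lt1// ltr1n.
by rewrite powR1.
Qed.

Lemma tail_cst_gt0 : 0 < tail_cst.
Proof. by rewrite divr_gt0// subr_gt0. Qed.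

Lemma measurable_tail_fun : measurable_fun [set: T2] tail_fun.
Proof.
have mr := measurable_reach a.
have mrV : measurable_fun [set: T2] (fun z : T2 => (reach z.2 a z.1)^-1).
  exact: (measurableT_comp measurable_inv mr).
apply: measurable_funM => //; apply: (measurableT_comp (measurable_powR _)).
by apply: measurable_funM => //; exact: measurable_cst.
Qed.

(* Sum over the dyadic rings [2 ^ n l <= reach < 2 ^ (n + 1) l]. *)
Lemma integral_tail_fun : (\int[m]_(z in tail_set) (tail_fun z)%:E <= (tail_cst * N)%:E)%E.
Proof.
pose c n : R := (2^-1 `^ d) ^+ n * (2^-1 ^+ n / l).
have c0 n : 0 <= c n by rewrite mulr_ge0 ?exprn_ge0 ?powR_ge0// divr_ge0 ?exprn_ge0// ltW.
pose g n (z : T2) : \bar R := ((c n)%:E * (\1_(reach_ball a (2 ^+ n.+1 * l)) z)%:E)%E.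
have mg n : measurable_fun [set: T2] (g n).
  apply: emeasurable_funM; first exact: measurable_cst.
  by apply/measurable_EFinP; apply: measurable_indic; exact: measurable_reach_ball.
have g0 n z : (0 <= g n z)%E by rewrite mule_ge0// lee_fin.
apply: (@le_trans _ _ (\int[m]_(z in tail_set) \sum_(n <oo) g n z)%E).
  apply: ge0_le_integral => //.
  - exact: measurable_tail_set.
  - move=> z tz; have [_ _ rz] := tail_set_reach tz.
    by rewrite lee_fin divr_ge0 ?powR_ge0// (le_trans (ltW l0)).
  - apply/measurable_EFinP; apply: measurable_funTS.
    exact: measurable_tail_fun.
  - by apply: ge0_emeasurable_sum => // k _; exact: measurable_funTS.
  move=> z tz; have [z1 z2 rz] := tail_set_reach tz.
  have r0 : 0 < reach z.2 a z.1 by exact: lt_le_trans rz.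
  have [|n /andP[nr rn]] := @exists_dyadic_floor R (reach z.2 a z.1 / l).
    by rewrite ler_pdivlMr// mul1r.
  apply: (@le_trans _ _ (g n z)); last first.
    apply: le_trans (nneseries_lim_ge n.+1 _) => //.
    rewrite big_mkord big_ord_recr/= leeDr// sume_ge0//.
  rewrite /g indicE mem_set ?mule1; last first.
    by split; [exact: tz.1|rewrite -ltr_pdivrMr].
  rewrite lee_fin /tail_fun /c ler_pM ?powR_ge0 ?invr_ge0 ?(ltW r0)//.
    rewrite -powR_mulrn ?powR_ge0// powRAC powR_mulrn ?invr_ge0//.
    rewrite ler_powR_base ?(ltW d0) ?divr_ge0 ?(ltW l0) ?(ltW r0)//.
    rewrite -[l / _]invf_div exprVn lef_pV2 ?posrE ?exprn_gt0// divr_gt0//.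
  rewrite exprVn -invfM lef_pV2 ?posrE ?mulr_gt0 ?exprn_gt0//.
  by rewrite -ler_pdivlMr.
rewrite integral_nneseries//; last 2 first.
  exact: measurable_tail_set.
  by move=> n; exact: measurable_funTS.
apply: (@le_trans _ _ (\sum_(n <oo) ((4 * N) * (2^-1 `^ d) ^+ n)%:E)%E).
  apply: lee_nneseries => [n _ _|n _].
    by apply: integral_ge0 => z _.
  rewrite /g ge0_integralZl//; first last.
  - by rewrite lee_fin.
  - apply/measurable_EFinP; apply: measurable_funTS.
    by apply: measurable_indic; exact: measurable_reach_ball.
  - exact: measurable_tail_set.
  rewrite integral_indic//; [|exact: measurable_tail_set|exact: measurable_reach_ball].
  have n0 : 0 < 2 ^+ n.+1 * l by rewrite mulr_gt0// exprn_gt0.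
  apply: (@le_trans _ _ ((c n)%:E * (2 * N * (2 ^+ n.+1 * l))%:E)%E).
    apply: lee_wpmul2l; first by rewrite lee_fin.
    apply: le_trans (carleson_reach_ball mN N0 a0 n0).
    apply: le_measure; rewrite ?inE//.
    + apply: measurableI; [exact: measurable_reach_ball|exact: measurable_tail_set].
    + exact: measurable_reach_ball.
  rewrite -EFinM lee_fin /c le_eqVlt; apply/orP; left; apply/eqP.
  rewrite exprS exprVn; field.
  by rewrite gt_eqF// expf_neq0.
rewrite nneseries_geometric ?mulr_ge0 ?powR_ge0//.
by rewrite /tail_cst mulrAC.
Qed.

End reach_tail.

Section positive_balayage.
Context {R : realType} (lam : R) (lam_gt0 : 0 < lam).
Local Notation leb := (@lebesgue_measure R).
Local Notation T2 := ((measurableTypeR R * measurableTypeR R)%type).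
Local Notation del := (hoelder_exp lam).
Variables (m : {sigma_finite_measure set T2 -> \bar R}) (N : R).
Hypotheses (mN : carleson_bound m N) (N0 : 0 <= N).

Definition pos_balayage (D : set T2) (x : R) : \bar R :=
  (\int[m]_(z in D) (poisson lam z.2 x z.1)%:E)%E.

Lemma poisson_quadrant_ge0 (x : R) (z : T2) : quadrant z -> 0 <= poisson lam z.2 x z.1.
Proof.
by case=> _ /=; rewrite in_itv/= andbT => t0; rewrite poisson_ge0// ltW.
Qed.

Lemma measurable_poissonx (x : R) :
  measurable_fun [set: T2] (fun z : T2 => (poisson lam z.2 x z.1)%:E).
Proof.
apply/measurable_EFinP.
have mp : measurable_fun [set: T2] (fun z : T2 => (x : measurableTypeR R, z)).
  by apply: measurable_fun_pair => //; exact: measurable_cst.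
exact: (measurableT_comp (measurable_poisson lam) mp).
Qed.

Lemma pos_balayage_ge0 (D : set T2) (x : R) : D `<=` quadrant ->
  (0 <= pos_balayage D x)%E.
Proof.
by move=> DQ; apply: integral_ge0 => z Dz; rewrite lee_fin poisson_quadrant_ge0//; exact: DQ.
Qed.

Let kern (I : set R) (D : set T2) (w : measurableTypeR R * T2) : \bar R :=
  ((fun w : measurableTypeR R * T2 => (poisson lam w.2.2 w.1 w.2.1)%:E) \_ (I `*` D))%E w.

Let kern_ge0 I D w : D `<=` quadrant -> (0 <= kern I D w)%E.
Proof.
move=> DQ; apply: erestrict_ge0 => -[x z] [/= _ Dz].
by rewrite lee_fin poisson_quadrant_ge0//; exact: DQ.
Qed.

Let measurable_kern (I : set R) (D : set T2) : measurable (I : set (measurableTypeR R)) ->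
  measurable D -> measurable_fun [set: measurableTypeR R * T2] (kern I D).
Proof.
move=> mI mD; apply: measurable_patch; first exact: measurableX.
by apply/measurable_EFinP; exact: measurable_poisson.
Qed.

Let kern1 (I : set R) D x : I x ->
  (\int[m]_z kern I D (x, z) = pos_balayage D x)%E.
Proof.
move=> Ix; rewrite /pos_balayage [RHS]integral_mkcond; apply: eq_integral => z _.
rewrite /kern /patch/=; suff -> : ((x, z) \in I `*` D) = (z \in D) by [].
by apply/idP/idP; rewrite !inE/=; [case|].
Qed.

Let kern0 (I : set R) D x : ~ I x -> (\int[m]_z kern I D (x, z) = 0)%E.
Proof.
move=> Ix; rewrite integral0_eq// => z _.
by rewrite /kern /patch/= memNset// => -[].
Qed.

Lemma measurable_pos_balayage (D : set T2) : measurable D -> D `<=` quadrant ->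
  measurable_fun [set: R] (pos_balayage D).
Proof.
move=> mD DQ.
rewrite (_ : pos_balayage D = fubini_F m (kern setT D)); last first.
  by apply/funext => x; rewrite /fubini_F kern1.
apply: measurable_fun_fubini_tonelli_F; first exact: measurable_kern.
by move=> w; exact: kern_ge0.
Qed.

Lemma integral_poisson_le (t y a b : R) : 0 < t -> 0 < y -> 0 <= a ->
  (\int[leb]_(x in `[a, b]) (poisson lam t x y)%:E <= (poisson_cst lam * pi)%:E)%E.
Proof.
move=> t0 y0 a0.
have K0 := poisson_cst_gt0 lam_gt0.
have mc : measurable_fun [set: R] (fun x => cauchy t (x - y)).
  apply: (measurableT_comp (measurable_cauchy t0)).
  by apply: measurable_funB => //; exact: measurable_cst.
apply: (@le_trans _ _ (\int[leb]_(x in `[a, b]) ((poisson_cst lam)%:E * (cauchy t (x - y))%:E))%E).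
  apply: ge0_le_integral => //.
  - by move=> x _; rewrite lee_fin poisson_ge0// ltW.
  - apply/measurable_EFinP; apply: measurable_funTS.
    have mp : measurable_fun [set: measurableTypeR R] (fun x : measurableTypeR R => (x, (y, t) : T2)).
      by apply: measurable_fun_pair => //; exact: measurable_cst.
    exact: (measurableT_comp (measurable_poisson lam) mp).
  - apply: emeasurable_funM; first exact: measurable_cst.
    by apply/measurable_EFinP; exact: measurable_funTS.
  move=> x; rewrite /= in_itv/= => /andP[ax _]; rewrite -EFinM lee_fin.
  have := poisson_le_cauchy lam_gt0 t0 (le_trans a0 ax) (ltW y0).
  by rewrite /sqdist /cauchy addrC.
rewrite ge0_integralZl_EFin ?(ltW K0)//; last 2 first.
  by move=> x _; rewrite lee_fin cauchy_ge0// ltW.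
  by apply/measurable_EFinP; exact: measurable_funTS.
rewrite [leRHS]EFinM; apply: lee_wpmul2l; first by rewrite lee_fin ltW.
rewrite -(integral_cauchy_shift y t0); apply: ge0_subset_integral => //.
  exact/measurable_EFinP.
by move=> x _; rewrite lee_fin cauchy_ge0// ltW.
Qed.

(** After exchanging the integrals, each point (y, t) contributes at most [poisson_cst lam * pi]
    whatever its height, and the ball of radius 2 l has mass at most 4 N l. *)
Lemma integral_pos_balayage_near (a l : R) : 0 <= a -> 0 < l ->
  (\int[leb]_(x in `[a, (a + l)%R]) pos_balayage (reach_ball a (2 * l)%R) x <=
   (poisson_cst lam * pi * (4 * N * l))%:E)%E.
Proof.
move=> a0 l0; set I := `[a, (a + l)%R]%classic; set E := reach_ball a (2 * l).
have EQ : E `<=` quadrant by move=> z [].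
have mE : measurable E by exact: measurable_reach_ball.
have mI : measurable (I : set (measurableTypeR R)) by exact: measurable_itv.
have K0 : 0 <= poisson_cst lam * pi by rewrite mulr_ge0 ?pi_ge0// ltW// poisson_cst_gt0.
have -> : (\int[leb]_(x in I) pos_balayage E x = \int[leb]_x \int[m]_z kern I E (x, z))%E.
  rewrite integral_mkcond; apply: eq_integral => x _; rewrite /patch.
  by case: ifPn; rewrite ?inE ?notin_setE => Ix; [rewrite kern1|rewrite kern0].
rewrite fubini_tonelli//; [|exact: measurable_kern|by move=> w; exact: kern_ge0].
apply: (@le_trans _ _ (\int[m]_(z in E) (poisson_cst lam * pi)%:E)%E).
  rewrite [leRHS]integral_mkcond; apply: ge0_le_integral => //.
  - by move=> z _; apply: integral_ge0 => x _; exact: kern_ge0.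
  - have mG : measurable_fun [set: T2] (fubini_G leb (kern I E)).
      apply: measurable_fun_fubini_tonelli_G; first exact: measurable_kern.
      by move=> w; exact: kern_ge0.
    exact: mG.
  - by apply: measurable_patch => //; exact: measurable_cst.
  move=> z _; rewrite /patch; case: ifPn; rewrite ?inE ?notin_setE => Ez.
    have [[/= + +] _] := Ez; rewrite !in_itv/= !andbT => y0 t0.
    have -> : (\int[leb]_x kern I E (x, z) = \int[leb]_(x in I) (poisson lam z.2 x z.1)%:E)%E.
      rewrite [RHS]integral_mkcond; apply: eq_integral => x _.
      rewrite /kern /patch/=; suff -> : ((x, z) \in I `*` E) = (x \in I) by [].
      by apply/idP/idP; rewrite !inE/=; [case|].
    exact: integral_poisson_le.
  rewrite integral0_eq// => x _; rewrite /kern /patch memNset// => -[_ /=] //.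
rewrite integral_cst// [leRHS]EFinM; apply: lee_wpmul2l; first by rewrite lee_fin.
apply: le_trans (carleson_reach_ball mN N0 a0 _) _; first by rewrite mulr_gt0.
by rewrite lee_fin le_eqVlt; apply/orP; left; apply/eqP; ring.
Qed.

Section far.
Variables (a l : R).
Hypotheses (a0 : 0 <= a) (l0 : 0 < l).
(** The threshold [2 * l] is what [poisson_hoelder] demands for [x - a <= l]. *)
Let F : set T2 := tail_set a (2 * l).
Let l2 : 0 < 2 * l. Proof. by rewrite mulr_gt0. Qed.
Let d0 : 0 < del. Proof. exact: hoelder_exp_gt0. Qed.
Let mF : measurable F. Proof. exact: measurable_tail_set. Qed.
Let tail_ge0 z : F z -> 0 <= tail_fun del a (2 * l) z.
Proof.
by move=> /(tail_set_reach)[_ _ h]; rewrite divr_ge0 ?powR_ge0// (le_trans (ltW l2)).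
Qed.

Let mtail : measurable_fun F (fun z => (tail_fun del a (2 * l) z)%:E).
Proof. by apply/measurable_EFinP; apply: measurable_funTS; exact: measurable_tail_fun. Qed.

Let tail_le (k : R) (f : T2 -> R) : measurable_fun [set: T2] f -> 0 <= k ->
  (forall z, F z -> `|f z| <= k * tail_fun del a (2 * l) z) ->
  (\int[m]_(z in F) `|(f z)%:E| <= (k * (tail_cst del * N))%:E)%E.
Proof.
move=> mf k0 fk.
apply: (@le_trans _ _ (\int[m]_(z in F) (k%:E * (tail_fun del a (2 * l) z)%:E))%E).
  apply: ge0_le_integral => //.
  - by apply: measurableT_comp => //; apply/measurable_EFinP; exact: measurable_funTS.
  - by apply: emeasurable_funM => //; exact: measurable_cst.
rewrite ge0_integralZl_EFin//.
rewrite EFinM; apply: lee_wpmul2l; first by rewrite lee_fin.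
exact: integral_tail_fun.
Qed.

(** The plain bound 2 / reach would give each dyadic ring the same contribution and hence a
    divergent sum; the factor (a / reach)^del makes the kernel at [a] a multiple of [tail_fun]. *)
Let integrable_base : m.-integrable F (fun z => (poisson lam z.2 a z.1)%:E).
Proof.
apply/integrableP; split; first by apply: measurable_funTS; exact: measurable_poissonx.
have k0 : 0 <= 8 * poisson_cst lam * (a / (2 * l)) `^ del.
  by rewrite mulr_ge0 ?powR_ge0// mulr_ge0// ltW// poisson_cst_gt0.
apply: le_lt_trans (tail_le _ k0 _) (ltry _).
  by apply/measurable_EFinP; exact: measurable_poissonx.
move=> z Fz; have [y0 t0 h] := tail_set_reach Fz.
rewrite ger0_norm ?poisson_ge0 ?(ltW t0)//.
have r0 : 0 < reach z.2 a z.1 by exact: lt_le_trans h.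
apply: le_trans (poisson_le_reach lam_gt0 t0 a0 (ltW y0)) _.
rewrite /tail_fun mulrA -[X in _ <= X / _]mulrA -powRM ?divr_ge0 ?(ltW r0) ?(ltW l2)//.
by rewrite mulrA divfK// gt_eqF.
Qed.

Let integrable_diff x : a <= x <= a + l ->
  (\int[m]_(z in F) `|(poisson lam z.2 x z.1 - poisson lam z.2 a z.1)%:E| <=
    (poisson_hoelder_cst lam * (tail_cst del * N))%:E)%E.
Proof.
move=> /andP[ax xal]; apply: tail_le.
- by apply: measurable_funB; apply/measurable_EFinP; exact: measurable_poissonx.
- by rewrite ltW// poisson_hoelder_cst_gt0.
move=> z Fz; have [y0 t0 h] := tail_set_reach Fz.
have r0 : 0 < reach z.2 a z.1 by exact: lt_le_trans h.
have xl : x - a <= l by lra.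
apply: le_trans (poisson_hoelder lam_gt0 t0 y0 a0 ax _) _; first by lra.
rewrite /tail_fun -mulrA ler_pM2l ?poisson_hoelder_cst_gt0//.
rewrite ler_pM2r ?invr_gt0// ler_powR_base ?(ltW d0)//.
  by rewrite divr_ge0 ?subr_ge0// ltW.
by rewrite ler_pM2r ?invr_gt0//; lra.
Qed.

Definition far_value : R := fine (pos_balayage F a).

Lemma far_value0 : a = 0 -> far_value = 0.
Proof.
move=> aE; rewrite /far_value /pos_balayage integral0_eq// => z _.
by rewrite aE poisson0x.
Qed.

Lemma pos_balayage_far x : a <= x <= a + l ->
  pos_balayage F x \is a fin_num /\
  `|fine (pos_balayage F x) - far_value| <= poisson_hoelder_cst lam * (tail_cst del * N).
Proof.
move=> xal; have id := integrable_diff xal.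
have iD : m.-integrable F (fun z => (poisson lam z.2 x z.1 - poisson lam z.2 a z.1)%:E).
  apply/integrableP; split; last by apply: le_lt_trans id (ltry _).
  apply: measurable_funTS; apply/measurable_EFinP.
  by apply: measurable_funB; apply/measurable_EFinP; exact: measurable_poissonx.
have ix : m.-integrable F (fun z => (poisson lam z.2 x z.1)%:E).
  have -> : (fun z : T2 => (poisson lam z.2 x z.1)%:E) =
     (fun z => (poisson lam z.2 a z.1)%:E) \+
     (fun z => (poisson lam z.2 x z.1 - poisson lam z.2 a z.1)%:E)%E.
    apply/funext => z /=; move: (poisson lam _ x _) (poisson lam _ a _) => u v.
    by rewrite -EFinD addrC subrK.
  exact: integrableD.
split; first exact: integrable_fin_num.
rewrite -lee_fin; apply: le_trans id.
have -> : fine (pos_balayage F x) - far_value =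
  \int[m]_(z in F) (poisson lam z.2 x z.1 - poisson lam z.2 a z.1).
  exact: (esym (@RintegralB _ _ _ m F (fun z => poisson lam z.2 x z.1) (fun z => poisson lam z.2 a z.1) mF ix integrable_base)).
have -> := @EFin_normr_Rintegral _ _ _ m F _ mF iD.
by apply: le_abse_integral => //; case/integrableP: iD.
Qed.

Lemma pos_balayage_split x :
  (pos_balayage quadrant x = pos_balayage (reach_ball a (2 * l)) x + pos_balayage F x)%E.
Proof.
have mE := measurable_reach_ball a (2 * l).
rewrite /pos_balayage -ge0_integral_setU//.
- congr (integral _ _ _); apply/seteqP; split => z.
    by move=> Qz; have [h|h] := pselect (reach_ball a (2 * l) z); [left|right; split].
  by case => [[]|[]].
- by apply: measurable_funTS; exact: measurable_poissonx.
- by move=> z [[Qz _]|[Qz _]]; rewrite lee_fin poisson_quadrant_ge0.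
- by rewrite disj_set2E; apply/eqP/seteqP; split => // z [h []].
Qed.

Lemma pos_balayage_oscillation x : a <= x <= a + l ->
  ((`|fine (pos_balayage quadrant x) - far_value|%R)%:E <=
    pos_balayage (reach_ball a (2 * l)) x +
    (poisson_hoelder_cst lam * (tail_cst del * N))%:E)%E.
Proof.
move=> xal; have [fF osc] := pos_balayage_far xal.
have E0 : (0 <= pos_balayage (reach_ball a (2 * l)) x)%E.
  by apply: pos_balayage_ge0 => z [].
rewrite pos_balayage_split -(fineK fF); move: E0.
(* Where the near part is infinite the right-hand side is infinite too, whatever default [fine]
   returns on the left. *)
case: (pos_balayage (reach_ball a (2 * l)) x) => [u|_|//]; last by rewrite addye// leey.
rewrite !lee_fin /= => u0; rewrite -addrA.
by apply: le_trans (ler_normD _ _) _; rewrite (ger0_norm u0) lerD2l.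
Qed.

End far.

Definition balayage_cst : R :=
  4 * poisson_cst lam * pi + poisson_hoelder_cst lam * tail_cst del.

Lemma balayage_cst_gt0 : 0 < balayage_cst.
Proof.
apply: addr_gt0; first by rewrite mulr_gt0 ?pi_gt0// mulr_gt0// poisson_cst_gt0.
by rewrite mulr_gt0 ?poisson_hoelder_cst_gt0// tail_cst_gt0 ?hoelder_exp_gt0.
Qed.

Let integral_near_cst (a l : R) : 0 <= a -> 0 < l ->
  (\int[leb]_(x in `[a, (a + l)%R]) (pos_balayage (reach_ball a (2 * l)) x +
    (poisson_hoelder_cst lam * (tail_cst del * N))%:E) <=
   (balayage_cst * N * l)%:E)%E.
Proof.
move=> a0 l0; have d0 := hoelder_exp_gt0 lam_gt0.
have h0 : 0 <= poisson_hoelder_cst lam * (tail_cst del * N).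
  by rewrite mulr_ge0 ?(ltW (poisson_hoelder_cst_gt0 _))// mulr_ge0 ?(ltW (tail_cst_gt0 _)).
have EQ : reach_ball a (2 * l) `<=` quadrant by move=> z [].
rewrite ge0_integralD//; last 2 first.
- by move=> x _; exact: pos_balayage_ge0.
- by apply: measurable_funTS; apply: measurable_pos_balayage => //; exact: measurable_reach_ball.
rewrite integral_cst//= lebesgue_measure_itv/= lte_fin ltrDl l0 -EFinD.
apply: (@le_trans _ _ ((poisson_cst lam * pi * (4 * N * l))%:E + (poisson_hoelder_cst lam * (tail_cst del * N))%:E * (a + l - a)%:E)%E).
  by apply: leeD => //; exact: integral_pos_balayage_near.
rewrite -EFinM -EFinD lee_fin le_eqVlt; apply/orP; left; apply/eqP.
by rewrite /balayage_cst; move: (@pi R) (poisson_cst _) (poisson_hoelder_cst _) => *; ring.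
Qed.

Lemma integral_pos_balayage_oscillation (a l : R) : 0 <= a -> 0 < l ->
  (\int[leb]_(x in `[a, (a + l)%R])
     (`|fine (pos_balayage quadrant x) - far_value a l|%R)%:E <=
   (balayage_cst * N * l)%:E)%E.
Proof.
move=> a0 l0; apply: le_trans (integral_near_cst a0 l0).
have h0 : 0 <= poisson_hoelder_cst lam * (tail_cst del * N).
  have d0 := hoelder_exp_gt0 lam_gt0.
  by rewrite mulr_ge0 ?(ltW (poisson_hoelder_cst_gt0 _))// mulr_ge0 ?(ltW (tail_cst_gt0 _)).
apply: ge0_le_integral => //.
- apply/measurable_EFinP; apply: measurableT_comp => //.
  apply: measurable_funB; last exact: measurable_cst.
  apply: measurable_funTS; apply: measurableT_comp; first exact: fine_measurable.
  by apply: measurable_pos_balayage => //; exact: measurable_quadrant.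
- apply: emeasurable_funD; last exact: measurable_cst.
  apply: measurable_funTS; apply: measurable_pos_balayage; first exact: measurable_reach_ball.
  by move=> z [].
- by move=> x; rewrite /= in_itv/=; exact: pos_balayage_oscillation.
Qed.

Lemma integral_pos_balayage_origin (l : R) : 0 < l ->
  (\int[leb]_(x in `[0%R, l]) pos_balayage quadrant x <= (balayage_cst * N * l)%:E)%E.
Proof.
move=> l0; have := integral_near_cst (lexx 0) l0; rewrite add0r; apply: le_trans.
apply: ge0_le_integral => //.
- by move=> x _; exact: pos_balayage_ge0.
- apply: measurable_funTS; apply: measurable_pos_balayage => //.
  exact: measurable_quadrant.
- apply: emeasurable_funD; last exact: measurable_cst.
  apply: measurable_funTS; apply: measurable_pos_balayage; first exact: measurable_reach_ball.
  by move=> z [].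
move=> x; rewrite /= in_itv/= => xl; rewrite (pos_balayage_split 0 l).
apply: leeD => //; have [|fF] := @pos_balayage_far 0 l (lexx 0) l0 x.
  by rewrite add0r.
rewrite far_value0// subr0 => h; rewrite -(fineK fF) lee_fin.
exact: le_trans (ler_norm _) h.
Qed.

End positive_balayage.

Section carleson_balayage.
Context {R : realType} (lam : R) (lam_gt0 : 0 < lam).
Local Notation leb := (@lebesgue_measure R).
Local Notation T2 := ((measurableTypeR R * measurableTypeR R)%type).

Lemma sigma_finite_measure_of d (T : measurableType d) (m : {measure set T -> \bar R}) :
  sigma_finite setT m ->
  exists m' : {sigma_finite_measure set T -> \bar R}, (m' : set T -> \bar R) = m.
Proof.
move=> sf.
pose H2 := isSFinite.Build _ _ _ _ (sfinite_measure_sigma_finite sf).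
pose H3 := isSigmaFinite.Build _ _ _ _ sf.
pose m' := HB.pack_for (SigmaFiniteMeasure.type T R) (Measure.sort m) H2 H3.
by exists m'.
Qed.

Variable mu : @borel_measure R.
Hypothesis cmu : carleson mu.

Let N : R := fine (carleson_norm mu).

Lemma carleson_norm_ge0 : (0 <= carleson_norm mu)%E.
Proof.
have b01 : bounded_interval (`]0, 1[%classic : set R) by apply: bounded_interval_itv.
apply: le_trans (ereal_sup_ubound _); last by exists `]0, 1[%classic.
rewrite mule_ge0// lee_fin invr_ge0.
by rewrite (@itv_length_itv _ 0 1)// subr0.
Qed.

Lemma carleson_norm_fine : carleson_norm mu = N%:E.
Proof.
by rewrite /N fineK// ge0_fin_numE ?carleson_norm_ge0//; case: cmu.
Qed.

Lemma carleson_bound_variation : carleson_bound (variation_measure mu) N.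
Proof.
split; first by case: cmu.
move=> I bI; have [_ l0 _] := bI.
have : ((itv_length I)^-1%:E * variation_measure mu (tent I) <= N%:E)%E.
  by rewrite -carleson_norm_fine; apply: ereal_sup_ubound; exists I.
by rewrite lee_pdivrMl// -EFinM mulrC.
Qed.

Let N0 : 0 <= N.
Proof. by rewrite -lee_fin -carleson_norm_fine carleson_norm_ge0. Qed.

Lemma carleson_bound_pos : carleson_bound (pos_part mu) N.
Proof.
have [V0 VI] := carleson_bound_variation; split.
  by apply/eqP; rewrite -measure_le0 -V0 variation_measureE leeDl.
by move=> I bI; apply: le_trans (VI _ bI); rewrite variation_measureE leeDl.
Qed.

Lemma carleson_bound_neg : carleson_bound (neg_part mu) N.
Proof.
have [V0 VI] := carleson_bound_variation; split.
  by apply/eqP; rewrite -measure_le0 -V0 variation_measureE leeDr.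
by move=> I bI; apply: le_trans (VI _ bI); rewrite variation_measureE leeDr.
Qed.

Let Up (x : R) : \bar R := (\int[pos_part mu]_(z in quadrant) (poisson lam z.2 x z.1)%:E)%E.
Let Un (x : R) : \bar R := (\int[neg_part mu]_(z in quadrant) (poisson lam z.2 x z.1)%:E)%E.

(** Collects the estimates for a positive measure without its sigma-finite structure, so that they
    apply to [pos_part mu] and [neg_part mu] alike. *)
Let pos_facts (m : {measure set T2 -> \bar R}) : carleson_bound m N ->
  let U x := (\int[m]_(z in quadrant) (poisson lam z.2 x z.1)%:E)%E in
  [/\ measurable_fun [set: R] U,
      (forall a l, 0 <= a -> 0 < l -> exists c : R, (a = 0 -> c = 0) /\
        (\int[leb]_(x in `[a, (a + l)%R]) (`|fine (U x) - c|%R)%:E <=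
          (balayage_cst lam * N * l)%:E)%E) &
      (forall l, 0 < l -> (\int[leb]_(x in `[0%R, l]) U x <= (balayage_cst lam * N * l)%:E)%E)].
Proof.
move=> mN U; have [m' mE] := sigma_finite_measure_of (carleson_sigma_finite mN N0).
have mN' : carleson_bound m' N by rewrite /carleson_bound mE.
have UE : U = pos_balayage lam m' quadrant.
  apply/funext => x; rewrite /U /pos_balayage.
  by apply: eq_measure_integral => A mA _; rewrite -mE.
rewrite UE; split.
- by apply: measurable_pos_balayage => //; exact: measurable_quadrant.
- move=> a l a0 l0; exists (far_value lam m' a l); split; first by move=> ->; exact: far_value0.
  exact: integral_pos_balayage_oscillation.
- by move=> l l0; exact: integral_pos_balayage_origin.
Qed.

Let balayageE x : balayage lam mu x = fine (Up x) - fine (Un x).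
Proof. by []. Qed.

Lemma measurable_balayage : measurable_fun [set: R] (balayage lam mu).
Proof.
have [mp _ _] := pos_facts carleson_bound_pos.
have [mn _ _] := pos_facts carleson_bound_neg.
by apply: measurable_funB; apply: measurableT_comp => //; exact: fine_measurable.
Qed.

Lemma balayage_oscillation (a l : R) : 0 <= a -> 0 < l -> exists c : R, (a = 0 -> c = 0) /\
  (\int[leb]_(x in `[a, (a + l)%R]) (`|balayage lam mu x - c|%R)%:E <=
     (2 * balayage_cst lam * N * l)%:E)%E.
Proof.
move=> a0 l0.
have [mp /(_ a l a0 l0)[cp [cp0 hp]] _] := pos_facts carleson_bound_pos.
have [mn /(_ a l a0 l0)[cn [cn0 hn]] _] := pos_facts carleson_bound_neg.
exists (cp - cn); split; first by move=> aE; rewrite cp0// cn0// subr0.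
have mfp : measurable_fun `[a, a + l] (fun x => (`|fine (Up x) - cp|%R)%:E).
  apply/measurable_EFinP; apply: measurableT_comp => //.
  apply: measurable_funB; last exact: measurable_cst.
  by apply: measurable_funTS; apply: measurableT_comp => //; exact: fine_measurable.
have mfn : measurable_fun `[a, a + l] (fun x => (`|fine (Un x) - cn|%R)%:E).
  apply/measurable_EFinP; apply: measurableT_comp => //.
  apply: measurable_funB; last exact: measurable_cst.
  by apply: measurable_funTS; apply: measurableT_comp => //; exact: fine_measurable.
apply: (@le_trans _ _ (\int[leb]_(x in `[a, (a + l)%R]) ((`|fine (Up x) - cp|%R)%:E + (`|fine (Un x) - cn|%R)%:E))%E).
  apply: ge0_le_integral => //.
  - apply/measurable_EFinP; apply: measurableT_comp => //.
    apply: measurable_funB; last exact: measurable_cst.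
    by apply: measurable_funTS; exact: measurable_balayage.
  - exact: emeasurable_funD.
  - move=> x _; rewrite -EFinD lee_fin balayageE.
    have -> : fine (Up x) - fine (Un x) - (cp - cn) = (fine (Up x) - cp) - (fine (Un x) - cn) by ring.
    exact: ler_normB.
rewrite ge0_integralD//.
have -> : 2 * balayage_cst lam * N * l = balayage_cst lam * N * l + balayage_cst lam * N * l by ring.
by rewrite EFinD; exact: leeD.
Qed.

(** The balayages of the two parts are integrable on each [0, n + 1], hence finite almost everywhere
    there; countably many null sets are discarded. *)
Lemma balayage_converges_ae :
  {ae leb, forall x, 0 < x -> balayage_converges lam mu x}.
Proof.
have [mp _ hp] := pos_facts carleson_bound_pos.
have [mn _ hn] := pos_facts carleson_bound_neg.
have Up0 x : (0 <= Up x)%E.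
  by apply: integral_ge0 => z Qz; rewrite lee_fin; exact: poisson_quadrant_ge0.
have Un0 x : (0 <= Un x)%E.
  by apply: integral_ge0 => z Qz; rewrite lee_fin; exact: poisson_quadrant_ge0.
have ip (n : nat) : leb.-integrable `[0, n.+1%:R] Up.
  apply/integrableP; split; first exact: measurable_funTS.
  under eq_integral do rewrite gee0_abs//.
  by apply: le_lt_trans (hp n.+1%:R _) _ => //; exact: ltry.
have iN (n : nat) : leb.-integrable `[0, n.+1%:R] Un.
  apply/integrableP; split; first exact: measurable_funTS.
  under eq_integral do rewrite gee0_abs//.
  by apply: le_lt_trans (hn n.+1%:R _) _ => //; exact: ltry.
have ap : {ae leb, forall x, forall n : nat, `[0, n.+1%:R]%classic x -> Up x \is a fin_num}.
  by apply/ae_foralln => n; apply: integrable_ae (ip n) => //; exact: measurable_itv.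
have an : {ae leb, forall x, forall n : nat, `[0, n.+1%:R]%classic x -> Un x \is a fin_num}.
  by apply/ae_foralln => n; apply: integrable_ae (iN n) => //; exact: measurable_itv.
apply: (@filterS2 _ _ (ae_filter_ringOfSetsType _) _ _ _ _ ap an) => x hUp hUn x0.
have xn : `[0, (Num.truncn x).+1%:R]%classic x.
  by rewrite /= in_itv/= (ltW x0)/= ltW// truncnS_gt.
have fp := hUp _ xn; have fn := hUn _ xn.
have mq : measurable (quadrant : set T2) by exact: measurable_quadrant.
have mP : measurable_fun quadrant (fun z : T2 => (poisson lam z.2 x z.1)%:E).
  by apply: measurable_funTS; exact: measurable_poissonx.
apply/integrableP; split => //.
rewrite (eq_integral (fun z : T2 => (poisson lam z.2 x z.1)%:E)); last first.
  move=> z; rewrite inE => Qz; rewrite gee0_abs// lee_fin.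
  exact: poisson_quadrant_ge0.
rewrite ge0_integral_measure_add//; last first.
  by move=> z Qz; rewrite lee_fin; exact: poisson_quadrant_ge0.
by rewrite lte_add_pinfty//; [rewrite -/(Up x)|rewrite -/(Un x)]; rewrite ltey_eq ?fp ?fn.
Qed.

Lemma integrable_le (f : R -> R) (D : set R) (M : R) :
  measurable (D : set (measurableTypeR R)) -> measurable_fun D f ->
  (\int[leb]_(x in D) (`|f x|%R)%:E <= M%:E)%E ->
  leb.-integrable D (EFin \o f) /\ \int[leb]_(x in D) `|f x| <= M.
Proof.
move=> mD mf fM.
have if_ : leb.-integrable D (EFin \o f).
  apply/integrableP; split; first exact/measurable_EFinP.
  by apply: le_lt_trans (ltry M).
split => //; rewrite -lee_fin /Rintegral fineK//.
rewrite ge0_fin_numE; last by apply: integral_ge0 => x _; rewrite lee_fin.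
by apply: le_lt_trans (ltry M).
Qed.

Lemma integrable_balayage (a : R) : 0 < a ->
  leb.-integrable `]0, a[ (EFin \o balayage lam mu) /\
  \int[leb]_(y in `]0, a[) `|balayage lam mu y| <= 2 * balayage_cst lam * N * a.
Proof.
move=> a0; apply: integrable_le; first exact: measurable_itv.
  by apply: measurable_funTS; exact: measurable_balayage.
have [c [/(_ erefl) -> h]] := balayage_oscillation (lexx 0) a0.
apply: le_trans h; rewrite add0r.
under [leRHS]eq_integral do rewrite subr0.
apply: ge0_subset_integral => //.
  apply/measurable_EFinP; apply: measurableT_comp => //.
  by apply: measurable_funTS; exact: measurable_balayage.
by apply: subset_itv; rewrite bnd_simp.
Qed.

(** In the factor 4, one 2 stems from the two parts of [mu], the other from passing from a free
    constant to the mean. *)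
Lemma bmo_bound_balayage (K : R) : 4 * balayage_cst lam * N <= K ->
  bmo_bound (balayage lam mu) K.
Proof.
move=> NK; have b0 := balayage_cst_gt0 lam_gt0; split; last first.
  move=> a a0; have [_ h] := integrable_balayage a0.
  rewrite mulrC ler_pdivrMr//; apply: le_trans h _.
  rewrite ler_wpM2r ?(ltW a0)//; apply: le_trans NK.
  by rewrite ler_wpM2r// ler_wpM2r ?(ltW b0)// ler_nat.
move=> I bI; have [_ l0 _] := bI.
have [a [b [a0 ab lE Iab [_ mI]]]] := bounded_intervalP bI.
have ba0 : 0 < b - a by rewrite subr_gt0.
have [c [_ h]] := balayage_oscillation a0 ba0.
have mf : measurable_fun I (fun x => balayage lam mu x - c).
  apply: measurable_funB; last exact: measurable_cst.
  by apply: measurable_funTS; exact: measurable_balayage.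
have [_ hI] : leb.-integrable I (EFin \o (fun x => balayage lam mu x - c)) /\
    \int[leb]_(x in I) `|balayage lam mu x - c| <= 2 * balayage_cst lam * N * (b - a).
  apply: integrable_le => //; apply: le_trans h.
  apply: ge0_subset_integral => //.
    apply/measurable_EFinP; apply: measurableT_comp => //.
    apply: measurable_funB; last exact: measurable_cst.
    by apply: measurable_funTS; exact: measurable_balayage.
  by rewrite addrC subrK.
have iI : leb.-integrable I (EFin \o balayage lam mu).
  have b1 : 0 < b + 1 by rewrite (le_lt_trans a0)// ltr_wpDr.
  have [ib _] := integrable_balayage b1.
  apply: integrableS ib => //.
  move=> x Ix; have [_ _ [M IM]] := bI; have := IM _ Ix; have := Iab _ Ix.
  by rewrite /= !in_itv/= => /andP[_ xb] /andP[-> _]/=; lra.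
rewrite mulrC ler_pdivrMr//.
apply: le_trans (mean_oscillation_le c mI l0 iI) _.
apply: (@le_trans _ _ (2 * (2 * balayage_cst lam * N * (b - a)))).
  by rewrite ler_pM2l.
rewrite lE; apply: (@le_trans _ _ (4 * balayage_cst lam * N * (b - a))).
  by rewrite le_eqVlt; apply/orP; left; apply/eqP; ring.
by rewrite ler_wpM2r// ltW.
Qed.

Lemma bmo_o_balayage : bmo_o (balayage lam mu).
Proof.
split; first by move=> a /integrable_balayage[].
exists (4 * balayage_cst lam * N + 1).
  by rewrite ltr_wpDl// !mulr_ge0// ltW// balayage_cst_gt0.
by apply: bmo_bound_balayage; rewrite lerDl.
Qed.

Lemma bmo_norm_balayage :
  (bmo_norm (balayage lam mu) <= (4 * balayage_cst lam)%:E * carleson_norm mu)%E.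
Proof.
(* The infimum defining the norm runs over positive constants only, and the bound itself may be 0;
   hence the additional [e]. *)
rewrite carleson_norm_fine -EFinM; apply/lee_addgt0Pr => e e0.
apply: ereal_inf_lbound; exists (4 * balayage_cst lam * N + e) => //; split.
  by rewrite ltr_wpDl// !mulr_ge0// ltW// balayage_cst_gt0.
by apply: bmo_bound_balayage; rewrite lerDl ltW.
Qed.

End carleson_balayage.

(** * Measures carried by countably many curves *)

Section weighted_measure.
Import HBNNSimple.
Context d (T : measurableType d) (R : realType) (m : {measure set T -> \bar R}).
Variable h : T -> R.
Hypothesis mh : measurable_fun [set: T] h.
Hypothesis h0 : forall x, 0 <= h x.

Let w (A : set T) : \bar R := (\int[m]_(x in A) (h x)%:E)%E.

Let w0 : w set0 = 0%E.
Proof. exact: integral_set0. Qed.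

Let w_ge0 A : (0 <= w A)%E.
Proof. by apply: integral_ge0 => x _; rewrite lee_fin. Qed.

Let w_sigma_additive : semi_sigma_additive w.
Proof.
move=> F mF tF mUF; rewrite /w ge0_integral_bigcup//.
- by apply: is_cvg_ereal_nneg_natsum_cond => n _ _; exact: w_ge0.
- by apply/measurable_EFinP; exact: measurable_funTS.
- by move=> x _; rewrite lee_fin.
Qed.

(** The measure with density [h]. The formula holds on indicators by definition and reaches
    nonnegative [f] through simple functions and monotone convergence on both sides. *)
Lemma weighted_measure_exists : exists m' : {measure set T -> \bar R},
  forall f : T -> \bar R, measurable_fun [set: T] f -> (forall x, 0 <= f x)%E ->
    (\int[m']_x f x = \int[m]_x (f x * (h x)%:E))%E.
Proof.
pose mx := isMeasure.Build _ _ _ w w0 w_ge0 w_sigma_additive.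
pose m' : {measure set T -> \bar R} := HB.pack w mx.
exists m' => f mf f0.
pose f_ := nnsfun_approx measurableT mf.
have hE : measurable_fun [set: T] (EFin \o h) by exact/measurable_EFinP.
have fE x : f x = limn (fun n => (f_ n x)%:E).
  by apply/esym/cvg_lim => //; apply: cvg_nnsfun_approx.
have nd x : {homo (fun n => (f_ n x)%:E) : i j / (i <= j)%N >-> (i <= j)%E}.
  by move=> i j ij; rewrite lee_fin; exact/lefP/nd_nnsfun_approx.
transitivity (limn (fun n => \int[m']_x (f_ n x)%:E))%E.
  rewrite -monotone_convergence//; last 2 first.
  - by move=> n; exact/measurable_EFinP.
  - by move=> n x _; rewrite lee_fin.
  by apply: eq_integral => x _; rewrite fE.
transitivity (limn (fun n => \int[m]_x ((f_ n x)%:E * (h x)%:E)))%E; last first.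
  rewrite -monotone_convergence//; last 3 first.
  - by move=> n; apply: emeasurable_funM => //; exact/measurable_EFinP.
  - by move=> n x _; rewrite mule_ge0// lee_fin.
  - by move=> x _ i j ij; apply: lee_wpmul2r; rewrite ?lee_fin//; exact/lefP/nd_nnsfun_approx.
  apply: eq_integral => x _; rewrite fE -limeMr//.
  by apply: ereal_nondecreasing_is_cvgn; exact: nd.
congr (limn _); apply/funext => n.
have mfn r : measurable (f_ n @^-1` [set r]) by [].
rewrite integralT_nnsfun sintegralE.
transitivity (\sum_(k \in range (f_ n)) \int[m]_x ((k * \1_(f_ n @^-1` [set k]) x)%:E * (h x)%:E))%E.
  apply: eq_fsbigr => r /[1!inE] -[x _ rE].
  have r0 : 0 <= r by rewrite -rE.
  pose S := f_ n @^-1` [set r].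
  have mS : measurable_fun [set: T] (patch (fun=> 0%E) S (EFin \o h)) by exact: (measurable_patch (mfn r) hE).
  have S0 y : [set: T] y -> (0 <= (patch (fun=> 0%E) S (EFin \o h)) y)%E.
    by move=> _; apply: erestrict_ge0 => z _; rewrite lee_fin.
  have -> : m' S = (\int[m]_x (patch (fun=> 0%E) S (EFin \o h)) x)%E by rewrite -integral_mkcond.
  rewrite -(ge0_integralZl m measurableT mS S0)//.
  apply: eq_integral => y _; rewrite /patch indicE.
  by case: (y \in _); rewrite ?mulr1 ?mulr0 ?mule0 ?mul0e.
rewrite -ge0_integral_fsum//; last 2 first.
- move=> r; apply: emeasurable_funM => //; apply/measurable_EFinP.
  exact: measurable_funM.
- by move=> r x _; apply: mule_ge0; rewrite ?lee_fin// -lee_fin EFinM; exact: nnfun_muleindic_ge0.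
apply: eq_integral => x _; rewrite fimfunE -fsumEFin// ge0_mule_fsuml//.
by move=> r; rewrite EFinM; exact: nnfun_muleindic_ge0.
Qed.

End weighted_measure.

Section curves.
Context d1 d2 (S : measurableType d1) (T : measurableType d2) (R : realType).
Variable m : {measure set S -> \bar R}.

Lemma curve_measure_exists (psi : S -> T) (h : S -> R) :
  measurable_fun [set: S] psi -> measurable_fun [set: S] h -> (forall u, 0 <= h u) ->
  exists m' : {measure set T -> \bar R},
  forall f : T -> \bar R, measurable_fun [set: T] f -> (forall x, 0 <= f x)%E ->
    (\int[m']_x f x = \int[m]_u (f (psi u) * (h u)%:E))%E.
Proof.
move=> mpsi mh h0; have [w wE] := weighted_measure_exists m mh h0.
exists (pushforward w psi) => f mf f0.
rewrite (ge0_integral_pushforward mpsi)//.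
rewrite preimage_setT wE//; last by move=> u; exact: f0.
by apply: measurableT_comp.
Unshelve. all: exact: mpsi. Qed.

Lemma double_series_measure_exists (mm : nat -> nat -> {measure set T -> \bar R}) :
  exists m' : {measure set T -> \bar R},
  forall f : T -> \bar R, measurable_fun [set: T] f -> (forall x, 0 <= f x)%E ->
    (\int[m']_x f x = \sum_(k <oo) \sum_(n <oo) \int[mm k n]_x f x)%E.
Proof.
pose m1 k : {measure set T -> \bar R} := mseries (mm k) 0.
exists (mseries m1 0) => f mf f0.
rewrite ge0_integral_measure_series//; apply: eq_eseriesr => k _.
by rewrite ge0_integral_measure_series.
Qed.

Lemma curves_measure_exists (psi : nat -> nat -> S -> T) (h : nat -> nat -> S -> R) :
  (forall k n, measurable_fun [set: S] (psi k n)) ->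
  (forall k n, measurable_fun [set: S] (h k n)) -> (forall k n u, 0 <= h k n u) ->
  exists m' : {measure set T -> \bar R},
  forall f : T -> \bar R, measurable_fun [set: T] f -> (forall x, 0 <= f x)%E ->
    (\int[m']_x f x =
     \sum_(k <oo) \sum_(n <oo) \int[m]_u (f (psi k n u) * (h k n u)%:E))%E.
Proof.
move=> mpsi mh h0.
pose mm k n := sval (cid (curve_measure_exists (mpsi k n) (mh k n) (h0 k n))).
have [m' m'E] := double_series_measure_exists mm; exists m' => f mf f0.
rewrite m'E//; apply: eq_eseriesr => k _; apply: eq_eseriesr => n _.
by rewrite /mm; case: cid => w /= ->.
Qed.

End curves.

(** * Neumann series for averaging operators *)

Section neumann.
Context {R : realType}.
Local Notation leb := (@lebesgue_measure R).
Implicit Types (C D c s a e u r : R) (q v Om : R -> R).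

Lemma Rintegral_norm_le (g G : R -> R) (M : R) : measurable_fun [set: R] g ->
  measurable_fun [set: R] G -> (forall r, `|g r| <= G r) ->
  (\int[leb]_r (G r)%:E <= M%:E)%E ->
  leb.-integrable [set: R] (EFin \o g) /\ `|\int[leb]_r g r| <= M.
Proof.
move=> mg mG gG GM.
have le : (\int[leb]_r `|(g r)%:E| <= M%:E)%E.
  apply: le_trans GM; apply: ge0_le_integral => //.
  - by apply/measurable_EFinP; exact: measurableT_comp.
  - by apply/measurable_EFinP.
  - by move=> r _; rewrite lee_fin.
have ig : leb.-integrable [set: R] (EFin \o g).
  apply/integrableP; split; first exact/measurable_EFinP.
  by apply: le_lt_trans (ltry M).
split => //; apply: le_trans (le_normr_Rintegral _ ig) _ => //.
rewrite -lee_fin /Rintegral fineK//.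
rewrite ge0_fin_numE; last by apply: integral_ge0 => r _; rewrite lee_fin.
by apply: le_lt_trans (ltry M).
Qed.

Lemma integral_lincomb_le (f g : R -> R) (a b A B : R) :
  measurable_fun [set: R] f -> measurable_fun [set: R] g ->
  (forall r, 0 <= f r) -> (forall r, 0 <= g r) -> 0 <= a -> 0 <= b ->
  (\int[leb]_r (f r)%:E <= A%:E)%E -> (\int[leb]_r (g r)%:E <= B%:E)%E ->
  (\int[leb]_r (a * f r + b * g r)%:E <= (a * A + b * B)%:E)%E.
Proof.
move=> mf mg f0 g0 a0 b0 fA gB.
under eq_integral do rewrite EFinD !EFinM.
have mh (h : R -> R) (k : R) : measurable_fun [set: R] h ->
    measurable_fun [set: R] (fun r => k%:E * (h r)%:E)%E.
  by move=> m; apply/measurable_EFinP; exact: measurable_funM.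
have h0 (h : R -> R) (k : R) r : 0 <= k -> (forall r, 0 <= h r) -> (0 <= k%:E * (h r)%:E)%E.
  by move=> k0 h0; rewrite mule_ge0 ?lee_fin.
rewrite ge0_integralD//; [|by move=> r _; exact: h0|exact: mh|by move=> r _; exact: h0|exact: mh].
rewrite !ge0_integralZl ?lee_fin//; [|exact/measurable_EFinP|by move=> r _; rewrite lee_fin|exact/measurable_EFinP|by move=> r _; rewrite lee_fin].
by rewrite EFinD !EFinM leeD// lee_wpmul2l ?lee_fin.
Qed.

Lemma integral_scale_le (f : R -> R) (a A : R) :
  measurable_fun [set: R] f -> (forall r, 0 <= f r) -> 0 <= a ->
  (\int[leb]_r (f r)%:E <= A%:E)%E -> (\int[leb]_r (a * f r)%:E <= (a * A)%:E)%E.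
Proof.
move=> mf f0 a0 fA; rewrite -[(a * A)%R]addr0 -(mul0r 0).
rewrite (_ : (fun r => (a * f r)%:E) = (fun r => (a * f r + 0 * cst 0 r)%:E)); last first.
  by apply/funext => r; rewrite mul0r addr0.
by apply: (@integral_lincomb_le f (cst 0)) => //; rewrite integral0.
Qed.

(** A weight that dominates its own Cauchy averages, in the spirit of the Muckenhoupt A1 condition,
    and varies slowly at unit distance. Bounds relative to such a weight survive averaging at the
    price of a constant. *)
Definition envelope C Om :=
  [/\ measurable_fun [set: R] Om, (forall u, 0 <= Om u),
      (forall u r, `|r| <= 1 -> Om (u + r) <= C * Om u) &
      (forall u, (\int[leb]_r (cauchy 1 r * Om (u + r)%R)%:E <= (C * Om u)%:E)%E)].

(** Size and slope are measured against [Om], so that the localization recorded in the weight is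
    kept through the iteration. *)
Definition rel_lipschitz Om a s v :=
  (forall u, `|v u| <= a * Om u) /\
  (forall u u', `|u - u'| <= s -> `|v u - v u'| <= a / s * `|u - u'| * Om u).

(** All that is used of the Poisson kernel on a ray. Its mass is bounded but not known, which is why
    [average] divides by it. *)
Definition cauchy_like D c s q :=
  [/\ measurable_fun [set: R] q, (forall r, 0 <= q r <= D * cauchy s r) &
      c <= \int[leb]_r q r].

Definition average q v u := (\int[leb]_r q r)^-1 * \int[leb]_r (q r * v (u + r)).

Lemma measurable_translate (h : R -> R) u : measurable_fun [set: R] h ->
  measurable_fun [set: R] (fun r => h (u + r)).
Proof.
move=> mh; apply: (measurableT_comp mh).
by apply: measurable_funD => //; exact: measurable_cst.
Qed.

Lemma rel_lipschitz_continuous Om a s v : 0 < s -> rel_lipschitz Om a s v ->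
  continuous v.
Proof.
move=> s0 [_ lv] u; apply/cvgrPdist_lt => eps eps0.
have [L0|L0] := leP (a / s * Om u) 0.
  near=> u'; apply: le_lt_trans (lv u u' _) _.
    by rewrite ltW//; near: u'; apply: cvgr_dist_lt.
  apply: le_lt_trans eps0; rewrite -mulrA [_ * Om u]mulrC mulrA.
  by rewrite mulr_le0_ge0.
near=> u'; apply: le_lt_trans (lv u u' _) _.
  by rewrite ltW//; near: u'; apply: cvgr_dist_lt.
rewrite mulrAC -ltr_pdivlMl//; near: u'; apply: cvgr_dist_lt => //.
by rewrite mulr_gt0// invr_gt0.
Unshelve. all: by end_near. Qed.

Section averaging.
Variables (C D c : R) (Om : R -> R).
Hypotheses (D0 : 0 <= D) (c0 : 0 < c) (eOm : envelope C Om).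

(** For |r| <= 1 the weight is nearly constant and the kernel has mass pi; for |r| > 1 the narrow
    kernel is at most twice the kernel of width 1. Hence pi + 2. *)
Lemma integral_cauchy_envelope s u : 0 < s -> s <= 1 ->
  (\int[leb]_r (cauchy s r * Om (u + r)%R)%:E <= ((pi + 2) * C * Om u)%:E)%E.
Proof.
move=> s0 s1; have [mOm Om0 sOm iOm] := eOm.
have CO : 0 <= C * Om u by apply: le_trans (sOm u 0 _); rewrite ?normr0.
have mc t : 0 < t -> measurable_fun [set: R] (cauchy t) by exact: measurable_cauchy.
have mcO t : 0 < t -> measurable_fun [set: R] (fun r => cauchy t r * Om (u + r)).
  by move=> t0; apply: measurable_funM; [exact: mc|exact: measurable_translate].
have cO0 t r : 0 < t -> 0 <= cauchy t r * Om (u + r).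
  by move=> t0; apply: mulr_ge0 => //; apply: cauchy_ge0; exact: ltW.
apply: (@le_trans _ _ (\int[leb]_r (C * Om u * cauchy s r +
    2 * (cauchy 1 r * Om (u + r)))%R%:E)%E).
  apply: ge0_le_integral => //.
  - by move=> r _; rewrite lee_fin cO0.
  - by apply/measurable_EFinP; exact: mcO.
  - apply/measurable_EFinP; apply: measurable_funD; apply: measurable_funM => //; [exact: mc|exact: mcO].
  - move=> r _; rewrite lee_fin.
    have [r1|r1] := leP `|r| 1.
      rewrite -[leLHS]addr0 lerD//.
        by rewrite mulrC ler_wpM2r ?sOm// cauchy_ge0// ltW.
      by apply: mulr_ge0 => //; apply: mulr_ge0 => //; exact: cauchy_ge0.
    rewrite -[leLHS]add0r; apply: lerD.
      by apply: mulr_ge0 => //; exact: cauchy_ge0 (ltW s0).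
    rewrite mulrA ler_wpM2r// /cauchy expr1n.
    have r2 : 1 <= r ^+ 2 by rewrite -[r ^+ 2]real_normK ?num_real// exprn_ege1// ltW.
    rewrite mul1r ler_pdivrMr; last by rewrite ltr_pwDl ?exprn_gt0// sqr_ge0.
    rewrite mulrAC ler_pdivlMr; last by rewrite ltr_pwDl// sqr_ge0.
    have s2 : 0 <= s ^+ 2 by exact: sqr_ge0.
    nra.
have -> : (pi + 2) * C * Om u = C * Om u * pi + 2 * (C * Om u) by ring.
apply: integral_lincomb_le => //; rewrite ?integral_cauchy//; [exact: mc|exact: mcO| |].
- by move=> r; rewrite cauchy_ge0// ltW.
- by move=> r; exact: cO0.
Qed.

Lemma average_integrand_bound s q v u a : 0 < s -> s <= 1 -> cauchy_like D c s q ->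
  measurable_fun [set: R] v -> 0 <= a -> (forall r, `|v r| <= a * Om r) ->
  leb.-integrable [set: R] (EFin \o (fun r => q r * v (u + r))) /\
  `|\int[leb]_r (q r * v (u + r))| <= D * a * ((pi + 2) * C * Om u).
Proof.
move=> s0 s1 [mq qb _] mv a0 va; have [mOm Om0 sOm iOm] := eOm.
apply: (@Rintegral_norm_le _ (fun r => D * a * (cauchy s r * Om (u + r)))).
- by apply: measurable_funM => //; exact: measurable_translate.
- apply: measurable_funM => //; apply: measurable_funM; first exact: measurable_cauchy.
  exact: measurable_translate.
- move=> r; have /andP[q0 qD] := qb r; rewrite normrM ger0_norm//.
  have -> : D * a * (cauchy s r * Om (u + r)) = (D * cauchy s r) * (a * Om (u + r)) by ring.
  by apply: ler_pM.
- apply: integral_scale_le; rewrite ?mulr_ge0//; last exact: integral_cauchy_envelope.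
    apply: measurable_funM; first exact: measurable_cauchy.
    exact: measurable_translate.
  by move=> r; apply: mulr_ge0 => //; apply: cauchy_ge0; exact: ltW.
Qed.

Lemma integrable_cauchy_like s q : 0 < s -> cauchy_like D c s q ->
  leb.-integrable [set: R] (EFin \o q).
Proof.
move=> s0 [mq qb _].
have [] // := @Rintegral_norm_le q (fun r => D * cauchy s r) (D * pi) mq.
- by apply: measurable_funM => //; exact: measurable_cauchy.
- by move=> r; have /andP[q0 qD] := qb r; rewrite ger0_norm.
under eq_integral do rewrite EFinM.
rewrite ge0_integralZl ?lee_fin//.
- by rewrite integral_cauchy// EFinM.
- by apply/measurable_EFinP; exact: measurable_cauchy.
- by move=> r _; rewrite lee_fin cauchy_ge0// ltW.
Qed.

(** The kernel width is e^2 s, and r is split at e s, the geometric mean of this width and the scale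
    s. Below e s the Lipschitz bound yields a factor e; above, the kernel is at most 2 e times the
    one of width e s. The split replaces the first moment, which is infinite for a Cauchy kernel. *)
Lemma average_diff_le s e q v a u : 0 < s -> s <= 1 -> 0 < e -> e <= 1 ->
  cauchy_like D c (e ^+ 2 * s) q -> 0 <= a -> rel_lipschitz Om a s v ->
  `|v u - average q v u| <=
    a * (e * (c^-1 * D * (3 * pi + 2 * ((pi + 2) * C)))) * Om u.
Proof.
move=> s0 s1 e0 e1 hq a0 hv; have [mOm Om0 sOm iOm] := eOm.
have [mq qb cM] := hq; have [va vl] := hv.
have mv : measurable_fun [set: R] v.
  by apply: continuous_measurable_fun; exact: rel_lipschitz_continuous hv.
have es0 : 0 < e * s by rewrite mulr_gt0.
have es1 : e * s <= 1 by rewrite mulr_ile1 // ltW.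
have ees0 : 0 < e ^+ 2 * s by rewrite mulr_gt0// exprn_gt0.
have ees1 : e ^+ 2 * s <= 1 by rewrite mulr_ile1// ?exprn_ile1// ltW// exprn_gt0.
have M0 := lt_le_trans c0 cM.
have [iqv _] := average_integrand_bound u ees0 ees1 hq mv a0 va.
have iq := integrable_cauchy_like ees0 hq.
have iqu : leb.-integrable [set: R] (EFin \o (fun r => v u * q r)).
  by rewrite (_ : EFin \o _ = (fun r => (v u)%:E * (q r)%:E)%E)//; exact: integrableZl.
have -> : v u - average q v u =
    (\int[leb]_r q r)^-1 * \int[leb]_r (v u * q r - q r * v (u + r)).
  rewrite RintegralB// RintegralZl// mulrBr mulrCA mulVf ?gt_eqF//.
  by rewrite mulr1.
have mct t : 0 < t -> measurable_fun [set: R] (cauchy t) by exact: measurable_cauchy.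
have c1 r : 0 <= cauchy (e ^+ 2 * s) r by rewrite cauchy_ge0// ltW.
have c2 r : 0 <= cauchy (e * s) r by rewrite cauchy_ge0// ltW.
pose G r := D * a * e * Om u * (cauchy (e ^+ 2 * s) r + 2 * cauchy (e * s) r) +
  D * a * e * 2 * (cauchy (e * s) r * Om (u + r)).
have GE : (\int[leb]_r (G r)%:E <=
    (D * a * e * Om u * (3 * pi) + D * a * e * 2 * ((pi + 2) * C * Om u))%:E)%E.
  apply: integral_lincomb_le.
  - by apply: measurable_funD; [exact: mct|apply: measurable_funM => //; exact: mct].
  - by apply: measurable_funM; [exact: mct|exact: measurable_translate].
  - by move=> r; apply: addr_ge0 => //; apply: mulr_ge0 => //; exact: c2.
  - by move=> r; apply: mulr_ge0 => //; exact: c2.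
  - by rewrite !mulr_ge0// ltW.
  - by rewrite !mulr_ge0// ltW.
  - apply: (@le_trans _ _ (1 * pi + 2 * pi)%:E); last by rewrite lee_fin; lra.
    under eq_integral do rewrite -[X in (X + _)%R%:E]mul1r.
    by apply: integral_lincomb_le => //; rewrite ?integral_cauchy//; exact: mct.
  - exact: integral_cauchy_envelope.
have [|||_ h] := @Rintegral_norm_le (fun r => v u * q r - q r * v (u + r)) G _ _ _ _ GE.
- apply: measurable_funB; apply: measurable_funM => //.
  exact: measurable_translate.
- rewrite /G; apply: measurable_funD; apply: measurable_funM => //.
    by apply: measurable_funD; [exact: mct|apply: measurable_funM => //; exact: mct].
  by apply: measurable_funM; [exact: mct|exact: measurable_translate].
- move=> r; have /andP[q0 qD] := qb r.
  rewrite mulrC -mulrBr normrM ger0_norm//.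
  have [r1|r1] := leP `|r| (e * s).
    have h : `|v u - v (u + r)| <= a * e * Om u.
      have := vl u (u + r); rewrite opprD addrA subrr sub0r normrN => /(_ _)/le_trans; apply.
        by apply: le_trans r1 _; rewrite ler_piMl// ltW.
      rewrite ler_wpM2r// -mulrA ler_wpM2l// mulrC ler_pdivrMr//.
    apply: (@le_trans _ _ (D * cauchy (e ^+ 2 * s) r * (a * e * Om u))); first exact: ler_pM.
    rewrite /G; apply: (@le_trans _ _ (D * a * e * Om u * cauchy (e ^+ 2 * s) r)).
      by rewrite le_eqVlt; apply/orP; left; apply/eqP; ring.
    rewrite -[leLHS]addr0 lerD//; last by apply: mulr_ge0; [rewrite !mulr_ge0// ltW|exact: mulr_ge0].
    apply: ler_wpM2l; first by rewrite !mulr_ge0// ltW.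
    by rewrite lerDl; exact: mulr_ge0.
  have h : `|v u - v (u + r)| <= a * (Om u + Om (u + r)).
    by apply: le_trans (ler_normB _ _) _; rewrite mulrDr lerD.
  have h2 : cauchy (e ^+ 2 * s) r <= 2 * e * cauchy (e * s) r.
    rewrite /cauchy; have r2 : (e * s) ^+ 2 <= r ^+ 2.
      by rewrite -[r ^+ 2]real_normK ?num_real// ler_pXn2r ?nnegrE// ltW.
    have d1 : 0 < (e ^+ 2 * s) ^+ 2 + r ^+ 2.
      by rewrite ltr_pwDl ?exprn_gt0// sqr_ge0.
    have d2 : 0 < (e * s) ^+ 2 + r ^+ 2 by rewrite ltr_pwDl ?exprn_gt0// sqr_ge0.
    have -> : 2 * e * (e * s / ((e * s) ^+ 2 + r ^+ 2)) =
        2 * (e ^+ 2 * s) / ((e * s) ^+ 2 + r ^+ 2) by rewrite mulrA; congr (_ / _); ring.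
    have d12 : (e * s) ^+ 2 + r ^+ 2 <= 2 * ((e ^+ 2 * s) ^+ 2 + r ^+ 2).
      by have := sqr_ge0 (e ^+ 2 * s); have := sqr_ge0 r; lra.
    move: ((e * s) ^+ 2 + _) ((e ^+ 2 * s) ^+ 2 + _) d1 d2 d12 => x y y0 x0 xy.
    rewrite ler_pdivrMr// (_ : 2 * _ / x * y = e ^+ 2 * s * (2 * y / x)); last first.
      by move: (x^-1) => z; ring.
    by rewrite ler_peMr ?ler_pdivlMr ?mul1r// ltW.
  apply: (@le_trans _ _ (D * (2 * e * cauchy (e * s) r) * (a * (Om u + Om (u + r))))).
    by apply: ler_pM => //; apply: le_trans qD _; rewrite ler_wpM2l.
  rewrite /G -subr_ge0.
  have -> : D * a * e * Om u * (cauchy (e ^+ 2 * s) r + 2 * cauchy (e * s) r) +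
    D * a * e * 2 * (cauchy (e * s) r * Om (u + r)) -
    D * (2 * e * cauchy (e * s) r) * (a * (Om u + Om (u + r))) =
    D * a * e * Om u * cauchy (e ^+ 2 * s) r by ring.
  by apply: mulr_ge0 => //; rewrite !mulr_ge0// ltW.
rewrite normrM gtr0_norm ?invr_gt0//.
apply: (@le_trans _ _ (c^-1 * (D * a * e * Om u * (3 * pi) + D * a * e * 2 * ((pi + 2) * C * Om u)))).
  by apply: ler_pM => //; [rewrite invr_ge0 ltW|rewrite lef_pV2 ?posrE].
by rewrite le_eqVlt; apply/orP; left; apply/eqP; move: (@pi R) (c^-1) => P k; ring.
Qed.

(** Averaging commutes with translations, so the slope of [v] is kept up to the constant by which
    the weight dominates its averages. *)
Lemma average_lipschitz s t q v a u u' : 0 < s -> 0 < t -> t <= 1 ->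
  cauchy_like D c t q -> 0 <= a -> rel_lipschitz Om a s v -> `|u - u'| <= s ->
  `|average q v u - average q v u'| <=
    c^-1 * (D * (a / s * `|u - u'|) * ((pi + 2) * C * Om u)).
Proof.
move=> s0 t0 t1 hq a0 hv uu'; have [mOm Om0 sOm iOm] := eOm.
have [mq qb cM] := hq; have [va vl] := hv.
have mv : measurable_fun [set: R] v.
  by apply: continuous_measurable_fun; exact: rel_lipschitz_continuous hv.
have [i1 _] := average_integrand_bound u t0 t1 hq mv a0 va.
have [i2 _] := average_integrand_bound u' t0 t1 hq mv a0 va.
have M0 := lt_le_trans c0 cM.
have s'0 : 0 <= s^-1 by rewrite invr_ge0 ltW.
have Q0 : 0 <= a / s * `|u - u'| by rewrite mulr_ge0// divr_ge0// ltW.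
have -> : average q v u - average q v u' =
    (\int[leb]_r q r)^-1 * \int[leb]_r (q r * v (u + r) - q r * v (u' + r)).
  by rewrite RintegralB// mulrBr.
have [||||_ h] := @Rintegral_norm_le (fun r => q r * v (u + r) - q r * v (u' + r))
   (fun r => D * (a / s * `|u - u'|) * (cauchy t r * Om (u + r)))
   (D * (a / s * `|u - u'|) * ((pi + 2) * C * Om u)) _ _ _ _.
- by apply: measurable_funB; apply: measurable_funM => //; exact: measurable_translate.
- apply: measurable_funM => //; apply: measurable_funM; first exact: measurable_cauchy.
  exact: measurable_translate.
- move=> r; have /andP[q0 qD] := qb r; rewrite -mulrBr normrM ger0_norm//.
  have -> : D * (a / s * `|u - u'|) * (cauchy t r * Om (u + r)) =
    (D * cauchy t r) * (a / s * `|u - u'| * Om (u + r)) by ring.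
  apply: ler_pM => //; have := vl (u + r) (u' + r).
  by rewrite (_ : u + r - (u' + r) = u - u'); [apply|ring].
- apply: integral_scale_le; rewrite ?mulr_ge0//; last exact: integral_cauchy_envelope.
    apply: measurable_funM; first exact: measurable_cauchy.
    exact: measurable_translate.
  by move=> r; apply: mulr_ge0 => //; apply: cauchy_ge0; exact: ltW.
rewrite normrM gtr0_norm ?invr_gt0//.
by apply: ler_pM => //; [rewrite invr_ge0 ltW|rewrite lef_pV2 ?posrE].
Qed.

End averaging.

(* Averaging against a kernel much narrower than the scale at which v is
   Lipschitz changes v only slightly, at the cost of a smaller scale. *)
Lemma neumann_step (C D c : R) : 1 <= C -> 0 < D -> 0 < c ->
  exists2 e : R, 0 < e <= 1 & exists2 b : nat, (0 < b)%N &
  forall Om a s q v, envelope C Om -> 0 < s -> s <= 1 -> 0 <= a ->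
    cauchy_like D c (e ^+ 2 * s) q -> rel_lipschitz Om a s v ->
    rel_lipschitz Om (a / 4) (s / (3 ^ b)%N%:R) (fun u => v u - average q v u).
Proof.
move=> C1 D0 c0; have C0 : 0 < C by lra.
have p0 : 0 < pi :> R := pi_gt0 R.
pose C4 := c^-1 * D * (3 * pi + 2 * ((pi + 2) * C)).
have pC0 : 0 < (pi + 2) * C by rewrite mulr_gt0// addr_gt0.
have C40 : 0 < C4.
  rewrite /C4; apply: mulr_gt0; first by rewrite mulr_gt0// invr_gt0.
  lra.
pose C3 := 1 + c^-1 * D * ((pi + 2) * C).
have C31 : 1 <= C3.
  rewrite /C3 lerDl mulr_ge0//; first by rewrite mulr_ge0 ?invr_ge0 ?ltW.
  exact: ltW.
(* Chosen so that [e * C4 <= 4^-1], which is the decay per Neumann step. *)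
pose e : R := (1 + 4 * C4)^-1.
have C40' : 0 <= 4 * C4 by rewrite mulr_ge0// ltW.
have C41 : 0 < 1 + 4 * C4 by rewrite ltr_pwDl.
have e0 : 0 < e by rewrite invr_gt0.
have e1 : e <= 1 by rewrite invf_le1// lerDl.
have eC4 : e * C4 <= 4^-1.
  rewrite /e mulrC ler_pdivrMr// mulrDr mulrA mulVf// mul1r mulr1.
  by rewrite lerDr invr_ge0.
(* In one step the slope may grow by [C3] while the size bound drops by 4; dividing the scale by at
   least [4 * C3] absorbs both. A power of 3 is taken to keep these scales apart from the powers of
   2 that index the levels. *)
have [b b0 Bb] : exists2 b : nat, (0 < b)%N & 4 * C3 <= (3 ^ b)%N%:R.
  exists (Num.truncn (4 * C3)).+1 => //.
  apply: (@le_trans _ _ (Num.truncn (4 * C3)).+1%:R); first by rewrite ltW// truncnS_gt.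
  by rewrite ler_nat ltnW// ltn_expl.
exists e; first by rewrite e0 e1.
exists b => // Om a s q v eOm s0 s1 a0 hq hv; have [mOm Om0 sOm iOm] := eOm.
have es0 : 0 < e ^+ 2 * s by rewrite mulr_gt0// exprn_gt0.
have es1 : e ^+ 2 * s <= 1 by rewrite mulr_ile1// ?exprn_ile1// ltW// exprn_gt0.
have B0 : 0 < (3 ^ b)%N%:R :> R by rewrite ltr0n expn_gt0.
split.
  move=> u; apply: le_trans (average_diff_le (ltW D0) c0 eOm u s0 s1 e0 e1 hq a0 hv) _.
  by rewrite ler_wpM2r// ler_wpM2l.
move=> u u' uu'.
have us : `|u - u'| <= s.
  apply: le_trans uu' _; rewrite ler_pdivrMr// ler_peMr// ?ltW//; first lra.
have [va vl] := hv.
have -> : v u - average q v u - (v u' - average q v u') =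
  (v u - v u') - (average q v u - average q v u') by ring.
apply: le_trans (ler_normB _ _) _.
apply: le_trans (lerD (vl _ _ us) (average_lipschitz (ltW D0) c0 eOm s0 es0 es1 hq a0 hv us)) _.
have -> : a / s * `|u - u'| * Om u + c^-1 * (D * (a / s * `|u - u'|) * ((pi + 2) * C * Om u)) =
   C3 * (a / s * `|u - u'| * Om u) by rewrite /C3; move: (c^-1) (s^-1) (@pi R) => x y z; ring.
have -> : a / 4 / (s / (3 ^ b)%:R) = (3 ^ b)%:R / 4 * (a / s).
  by rewrite invf_div; move: (s^-1) => x; field.
rewrite -!(mulrA (_ / 4)); apply: ler_wpM2r; last lra.
by rewrite mulr_ge0// mulr_ge0// divr_ge0// ltW.
Qed.

Fixpoint neumann (q : nat -> R -> R) v (n : nat) : R -> R :=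
  if n is n'.+1 then fun u => neumann q v n' u - average (q n') (neumann q v n') u
  else v.

Lemma neumann_rel_lipschitz (C D c : R) : 1 <= C -> 0 < D -> 0 < c ->
  exists2 e : R, 0 < e <= 1 & exists2 b : nat, (0 < b)%N &
  forall Om (q : nat -> R -> R) v, envelope C Om ->
    (forall n : nat, cauchy_like D c (e * (3 ^ (b * n))%N%:R^-1) (q n)) ->
    rel_lipschitz Om 1 1 v ->
    forall n : nat, rel_lipschitz Om (4^-1 ^+ n) (3 ^ (b * n))%N%:R^-1 (neumann q v n).
Proof.
move=> C1 D0 c0; have [e /andP[e0 e1] [b b0 H]] := neumann_step C1 D0 c0.
(* Kernel widths in [neumann_step] are [e ^+ 2 * s]; the square becomes the new [e]. *)
exists (e ^+ 2); first by rewrite exprn_gt0//= exprn_ile1// ltW.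
exists b => // Om q v eOm hq hv; elim=> [|n IH].
  by rewrite muln0 expn0 expr0 invr1.
have s0 : 0 < (3 ^ (b * n))%N%:R^-1 :> R by rewrite invr_gt0 ltr0n expn_gt0.
rewrite mulnS expnD natrM invfM exprSr.
have {}hq := hq n.
have := H Om _ _ _ _ eOm s0 _ _ hq IH; rewrite [X in rel_lipschitz _ _ X]mulrC.
apply; last by rewrite exprn_ge0// invr_ge0.
by rewrite invf_le1 ?ltr0n ?expn_gt0// ler1n expn_gt0.
Qed.

End neumann.

(** * The Poisson kernel along rays *)

Section log_kernel.
Context {R : realType} (lam : R) (lam_gt0 : 0 < lam).
Local Notation leb := (@lebesgue_measure R).
Local Notation K := (poisson_cst lam).

(* The Poisson kernel on the ray t = s y, in the coordinate r = ln (y / x). *)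
Definition log_poisson (s r : R) : R := poisson lam (s * expR r) 1 (expR r) * expR r.

Definition log_poisson_cst : R := K * (16 + 4 `^ (lam + 1) * 8 / lam ^+ 2).

Lemma log_poisson_cst_gt0 : 0 < log_poisson_cst.
Proof.
rewrite /log_poisson_cst mulr_gt0 ?poisson_cst_gt0// addr_gt0//.
by rewrite divr_gt0 ?exprn_gt0// mulr_gt0// powR_gt0.
Qed.

Lemma log_poisson_ge0 s r : 0 <= s -> 0 <= log_poisson s r.
Proof.
move=> s0; apply: mulr_ge0 (expR_ge0 _); apply: poisson_ge0 => //.
by rewrite mulr_ge0// expR_ge0.
Qed.

(** With E = e^r, dividing by E^2 turns the Cauchy bound into s / ((1/E - 1)^2 + s^2), and |e^-r -
    1| >= |r| / 4 for r <= 1; 16 is the square of 4. *)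
Lemma log_poisson_near s r : 0 < s -> r <= 1 ->
  log_poisson s r <= K * 16 * cauchy s r.
Proof.
move=> s0 r1; rewrite /log_poisson; set E := expR r.
have E0 : 0 < E by exact: expR_gt0.
have sE : 0 < s * E by rewrite mulr_gt0.
have h := poisson_le_cauchy lam_gt0 sE ler01 (ltW E0).
apply: le_trans (ler_wpM2r (ltW E0) h) _.
rewrite -mulrA -mulrA ler_pM2l ?poisson_cst_gt0//.
have e : `|r| / 4 <= `|E^-1 - 1|.
  rewrite /E -expRN; have [r0|r0] := leP r 0.
    have := expR_ge1Dx (- r) => h1; rewrite (ler0_norm r0) ger0_norm; lra.
  have h1 := expR_ge1Dx r.
  have h2 : 4^-1 <= expR (- r).
    have -> : - r = (- r / 2) + (- r / 2) by lra.
    rewrite expRD; have := expR_ge1Dx (- r / 2); nra.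
  have h3 : expR r * expR (- r) = 1 by rewrite -expRD subrr expR0.
  rewrite (gtr0_norm r0) ltr0_norm; last by rewrite subr_lt0 expR_lt1 oppr_lt0.
  nra.
have -> : s * E / sqdist (s * E) 1 E * E = s / ((E^-1 - 1) ^+ 2 + s ^+ 2).
  rewrite /sqdist; field; rewrite !gt_eqF// ?ltr_wpDl ?exprn_gt0 ?sqr_ge0//.
have d1 : 0 < (E^-1 - 1) ^+ 2 + s ^+ 2 by rewrite ltr_wpDl ?exprn_gt0 ?sqr_ge0.
have d2 : 0 < s ^+ 2 + r ^+ 2 by exact: cauchy_denom_gt0.
rewrite /cauchy mulrA ler_pdivrMr// mulrAC ler_pdivlMr// (mulrC 16) -mulrA ler_pM2l//.
have e2 : r ^+ 2 / 16 <= (E^-1 - 1) ^+ 2.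
  have -> : r ^+ 2 / 16 = (`|r| / 4) ^+ 2 by rewrite exprMn real_normK ?num_real//; field.
  by rewrite -[leRHS]real_normK ?num_real// ler_pXn2r// nnegrE divr_ge0.
have := sqr_ge0 s; lra.
Qed.

(** For large r the quantity 1/E - 1 tends to -1 and the Cauchy bound stops decaying. The bound
    [poisson_le_far] leaves e^(-lam r) instead, which is below a multiple of 1 / (s^2 + r^2). *)
Lemma log_poisson_far s r : 0 < s -> s <= 1 -> 1 < r ->
  log_poisson s r <= K * (4 `^ (lam + 1) * 8 / lam ^+ 2) * cauchy s r.
Proof.
move=> s0 s1 r1; rewrite /log_poisson.
have E0 : 0 < expR r by exact: expR_gt0.
have sE : 0 < s * expR r by rewrite mulr_gt0.
have h := poisson_le_far lam_gt0 sE ler01 (ltW E0).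
apply: le_trans (ler_wpM2r (ltW E0) h) _.
have k0 : 0 <= K := ltW (poisson_cst_gt0 lam_gt0).
have E2 : 2 <= expR r by apply: le_trans (expR_ge1Dx r); lra.
have l1 : 0 < lam + 1 by rewrite addr_gt0.
have d1 : expR (2 * r) / 4 <= sqdist (s * expR r) 1 (expR r).
  rewrite /sqdist (_ : 2 * r = r + r) ?expRD; last by lra.
  have := sqr_ge0 (s * expR r); nra.
have d2 : (expR (2 * r * (lam + 1))) / 4 `^ (lam + 1) <=
    sqdist (s * expR r) 1 (expR r) `^ (lam + 1).
  rewrite expRM -powR_div ?expR_ge0//.
  apply: ge0_ler_powR => //; rewrite ?nnegrE ?(ltW l1)// ?divr_ge0 ?expR_ge0//.
  by apply: le_trans d1; rewrite divr_ge0 ?expR_ge0.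
have p4 : 0 < 4 `^ (lam + 1) :> R by rewrite powR_gt0.
have e0 : 0 < expR (2 * r * (lam + 1)) / 4 `^ (lam + 1) by rewrite divr_gt0 ?expR_gt0.
have i1 : (sqdist (s * expR r) 1 (expR r) `^ (lam + 1))^-1 <=
   4 `^ (lam + 1) * expR (- (2 * r * (lam + 1))).
  have -> : 4 `^ (lam + 1) * expR (- (2 * r * (lam + 1))) =
      (expR (2 * r * (lam + 1)) / 4 `^ (lam + 1))^-1 by rewrite invf_div expRN.
  by rewrite lef_pV2// posrE// (lt_le_trans e0 d2).
rewrite mul1r -expRM.
apply: (@le_trans _ _ (K * (s * expR r) * expR (r * lam) * (4 `^ (lam + 1) * expR (- (2 * r * (lam + 1)))) * expR r)).
  rewrite ler_pM2r//; apply: ler_wpM2l => //.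
  by apply: mulr_ge0 (expR_ge0 _); apply: mulr_ge0 => //; exact: ltW.
have -> : K * (s * expR r) * expR (r * lam) * (4 `^ (lam + 1) * expR (- (2 * r * (lam + 1)))) * expR r
  = K * 4 `^ (lam + 1) * s * (expR r * expR (r * lam) * expR (- (2 * r * (lam + 1))) * expR r) by ring.
rewrite -!expRD.
have -> : r + r * lam + - (2 * r * (lam + 1)) + r = - (lam * r) by ring.
have e3 : expR (- (lam * r)) <= 8 / lam ^+ 2 / (s ^+ 2 + r ^+ 2).
  have x0 : 0 < lam * r by rewrite mulr_gt0//; lra.
  have h2 : (lam * r) ^+ 2 / 4 <= expR (lam * r).
    have -> : lam * r = lam * r / 2 + lam * r / 2 by lra.
    rewrite expRD; have := expR_ge1Dx (lam * r / 2); nra.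
  rewrite expRN -[leRHS]invrK lef_pV2 ?posrE ?expR_gt0//; last first.
    by rewrite invr_gt0 divr_gt0 ?divr_gt0 ?exprn_gt0 ?cauchy_denom_gt0.
  apply: le_trans h2; rewrite !invf_div exprMn.
  have s2 : s ^+ 2 <= r ^+ 2 by rewrite ler_pXn2r ?nnegrE ?ltW//; lra.
  have l2 := sqr_ge0 lam; have r2 := sqr_ge0 r.
  nra.
rewrite /cauchy.
have -> : K * (4 `^ (lam + 1) * 8 / lam ^+ 2) * (s / (s ^+ 2 + r ^+ 2)) =
  K * 4 `^ (lam + 1) * s * (8 / lam ^+ 2 / (s ^+ 2 + r ^+ 2)).
  by move: (lam ^- 2) ((s ^+ 2 + r ^+ 2)^-1) => x y; ring.
apply: ler_wpM2l => //; apply: mulr_ge0 (ltW s0).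
by apply: mulr_ge0 => //; exact: ltW.
Qed.

Lemma log_poisson_le s r : 0 < s -> s <= 1 ->
  log_poisson s r <= log_poisson_cst * cauchy s r.
Proof.
move=> s0 s1; rewrite /log_poisson_cst mulrDr mulrDl.
have c0 : 0 <= cauchy s r by exact: cauchy_ge0 (ltW s0).
have k0 : 0 <= K := ltW (poisson_cst_gt0 lam_gt0).
have [r1|r1] := leP r 1.
  apply: le_trans (log_poisson_near s0 r1) _; rewrite lerDl.
  by rewrite mulr_ge0// mulr_ge0// divr_ge0 ?sqr_ge0// mulr_ge0// powR_ge0.
apply: le_trans (log_poisson_far s0 s1 r1) _; rewrite lerDr.
by rewrite mulr_ge0// mulr_ge0.
Qed.

Lemma log_poisson_ge s r : 0 < s -> s <= 1 -> - (s / 2) <= r -> r <= 0 ->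
  poisson_low_cst lam / s <= log_poisson s r.
Proof.
move=> s0 s1 r1 r0; rewrite /log_poisson.
have E0 : 0 < expR r by exact: expR_gt0.
have E1 : expR r <= 1 by rewrite -expR0 ler_expR.
have h1 := expR_ge1Dx r.
have sE : 0 < s * expR r by rewrite mulr_gt0.
rewrite -ler_pdivrMr// -mulrA -invfM; apply: poisson_ge => //.
- by rewrite mulr_ile1// ltW.
- by apply/andP; split; lra.
- rewrite ger0_norm ?subr_ge0//; nra.
Qed.

Lemma measurable_log_poisson s : 0 < s -> measurable_fun [set: R] (log_poisson s).
Proof.
move=> s0; have mE : measurable_fun [set: R] (@expR R).
  by apply: continuous_measurable_fun; exact: continuous_expR.
apply: measurable_funM => //.
have mp : measurable_fun [set: R] (fun r : R => ((1 : R), (expR r, s * expR r))).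
  apply/measurable_fun_pairP; split => /=; first exact: measurable_cst.
  by apply/measurable_fun_pairP; split => //=; exact: measurable_funM.
exact: (measurableT_comp (measurable_poisson lam) mp).
Qed.

(* log_poisson at scale sig * w in the coordinate u = r / sig *)
Definition scaled_poisson (sig w u : R) : R := sig * log_poisson (sig * w) (sig * u).

(** In the rescaled coordinate the bounds no longer depend on [sig]. The lower bound on the mass is
    the contribution of [-w/2, 0] alone, whence the half. *)
Lemma cauchy_like_scaled_poisson (sig w : R) : 0 < sig -> 0 < w -> sig * w <= 1 ->
  cauchy_like log_poisson_cst (poisson_low_cst lam / 2) w (scaled_poisson sig w).
Proof.
move=> sig0 w0 sw1; have sw0 : 0 < sig * w by rewrite mulr_gt0.
have mq : measurable_fun [set: R] (scaled_poisson sig w).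
  apply: measurable_funM => //; apply: (measurableT_comp (measurable_log_poisson sw0)).
  exact: measurable_funM.
have qb r : 0 <= scaled_poisson sig w r <= log_poisson_cst * cauchy w r.
  rewrite mulr_ge0 ?log_poisson_ge0 ?(ltW sig0) ?(ltW sw0)//=.
  apply: le_trans (ler_wpM2l (ltW sig0) (log_poisson_le (sig * r) sw0 sw1)) _.
  rewrite mulrCA ler_wpM2l ?(ltW log_poisson_cst_gt0)// le_eqVlt; apply/orP; left.
  apply/eqP; rewrite /cauchy; field; rewrite !gt_eqF//.
  - by rewrite ltr_pwDl ?exprn_gt0// sqr_ge0.
  - by rewrite -?exprMn ltr_pwDl ?exprn_gt0 ?sqr_ge0.
split => //.
have iq := @integrable_cauchy_like _ log_poisson_cst 0 (ltW log_poisson_cst_gt0) w _ w0.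
have {}iq : leb.-integrable [set: R] (EFin \o scaled_poisson sig w).
  apply: iq; split => //; apply: Rintegral_ge0 => // r _.
  by have /andP[] := qb r.
rewrite -lee_fin /Rintegral fineK; last exact: integrable_fin_num.
apply: (@le_trans _ _ (\int[leb]_(r in `[(- (w / 2))%R, 0%R]) (scaled_poisson sig w r)%:E)%E); last first.
  apply: ge0_subset_integral => //; first exact/measurable_EFinP.
  by move=> r _; rewrite lee_fin; have /andP[] := qb r.
apply: (@le_trans _ _ (\int[leb]_(r in `[(- (w / 2))%R, 0%R]) (poisson_low_cst lam / w)%:E)%E).
  rewrite integral_cst//= lebesgue_measure_itv/= lte_fin oppr_lt0 divr_gt0// -EFinD -EFinM lee_fin.
  rewrite sub0r opprK le_eqVlt; apply/orP; left; apply/eqP.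
  by move: (poisson_low_cst lam) => p; field; rewrite gt_eqF.
apply: ge0_le_integral => //.
- by move=> r _; rewrite lee_fin divr_ge0 ?ltW// poisson_low_cst_gt0.
- by apply/measurable_EFinP; exact: measurable_funTS.
move=> r; rewrite /= in_itv/= => /andP[r1 r2]; rewrite lee_fin /scaled_poisson.
have -> : poisson_low_cst lam / w = sig * (poisson_low_cst lam / (sig * w)).
  by move: (poisson_low_cst lam) => p; field; rewrite !gt_eqF.
rewrite ler_pM2l//; apply: log_poisson_ge => //; last by rewrite mulr_ge0_le0// ltW.
by rewrite -mulrA -mulrN ler_pM2l.
Qed.

End log_kernel.

(** * Piecewise linear functions and their envelopes *)

Section smoothing.
Context {R : realType}.
Local Notation leb := (@lebesgue_measure R).
Implicit Types (W : R -> R) (u r : R).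

Definition smoothing W u : \bar R := (\int[leb]_r (cauchy 1 r * W (u + r))%:E)%E.

Lemma measurable_smoothing_kernel W u : measurable_fun [set: R] W ->
  measurable_fun [set: R] (fun r => cauchy 1 r * W (u + r)).
Proof.
move=> mW; apply: measurable_funM; first exact: measurable_cauchy.
exact: measurable_translate.
Qed.

Section nonnegative.
Variable W : R -> R.
Hypotheses (mW : measurable_fun [set: R] W) (W0 : forall u, 0 <= W u).

Let c0 r : 0 <= cauchy 1 r := cauchy_ge0 r ler01.

Let cW0 r s : 0 <= cauchy 1 r * W s := mulr_ge0 (c0 r) (W0 s).

Lemma smoothing_ge0 u : (0 <= smoothing W u)%E.
Proof. by apply: integral_ge0 => r _; rewrite lee_fin. Qed.

Lemma smoothing_shift u r :
  smoothing W (u + r) = (\int[leb]_t (cauchy 1 (t - r) * W (u + t))%:E)%E.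
Proof.
rewrite /smoothing -(@ge0_integral_shift R (- r)).
- by apply: eq_integral => t _; congr (_ * W _)%:E; ring.
- by apply/measurable_EFinP; exact: measurable_smoothing_kernel.
- by move=> t; rewrite lee_fin.
Qed.

Lemma measurable_smoothing : measurable_fun [set: R] (smoothing W).
Proof.
pose F (z : measurableTypeR R * measurableTypeR R) := (cauchy 1 z.2 * W (z.1 + z.2))%:E.
have mF : measurable_fun setT F.
  apply/measurable_EFinP; apply: measurable_funM.
    exact: (measurableT_comp (measurable_cauchy ltr01) measurable_snd).
  apply: (measurableT_comp mW).
  by apply: measurable_funD; [exact: measurable_fst|exact: measurable_snd].
have F0 z : (0 <= F z)%E by rewrite lee_fin.
exact: (@measurable_fun_fubini_tonelli_F _ _ _ _ R leb F mF F0).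
Qed.

Lemma smoothing_le M u : (forall u, W u <= M) -> (smoothing W u <= (pi * M)%:E)%E.
Proof.
move=> WM; have M0 : 0 <= M by apply: le_trans (WM 0).
have h : (\int[leb]_r (M * cauchy 1 r)%:E <= (M * pi)%:E)%E.
  apply: integral_scale_le => //; first exact: measurable_cauchy.
  by rewrite integral_cauchy.
rewrite mulrC; apply: le_trans h; apply: ge0_le_integral => //.
- by move=> r _; rewrite lee_fin.
- by apply/measurable_EFinP; exact: measurable_smoothing_kernel.
- by apply/measurable_EFinP; apply: measurable_funM => //; exact: measurable_cauchy.
- by move=> r _; rewrite lee_fin mulrC; apply: ler_wpM2r.
Qed.

(** Translating the kernel by at most 1 costs at most the factor 3, since t^2 <= 2 (t - r)^2 + 2
    r^2; the difference of the two sides is (t - 2 r)^2. *)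
Lemma smoothing_slow u r : `|r| <= 1 -> (smoothing W (u + r) <= 3%:E * smoothing W u)%E.
Proof.
move=> r1; rewrite smoothing_shift /smoothing.
have mk := measurable_smoothing_kernel u mW.
rewrite -ge0_integralZl//; last 2 first.
- exact/measurable_EFinP.
- by move=> t _; rewrite lee_fin.
apply: ge0_le_integral => //.
- by move=> t _; rewrite lee_fin.
- apply/measurable_EFinP; apply: measurable_funM; last exact: measurable_translate.
  apply: (measurableT_comp (measurable_cauchy ltr01)).
  by apply: measurable_funB => //; exact: measurable_cst.
- by apply/measurable_EFinP; exact: measurable_funM.
move=> t _; rewrite -EFinM lee_fin mulrA ler_wpM2r// /cauchy expr1n !mul1r.
have d1 : 0 < 1 + (t - r) ^+ 2 by rewrite ltr_pwDl// sqr_ge0.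
have d2 : 0 < 1 + t ^+ 2 by rewrite ltr_pwDl// sqr_ge0.
rewrite -[X in X <= _]mul1r ler_pdivrMr// mulrAC ler_pdivlMr//.
have r2 : r ^+ 2 <= 1 by rewrite -real_normK ?num_real// exprn_ile1.
have := sqr_ge0 (t - 2 * r); nra.
Qed.

Lemma integral_smoothing :
  (\int[leb]_u smoothing W u = pi%:E * \int[leb]_u (W u)%:E)%E.
Proof.
pose F (z : measurableTypeR R * measurableTypeR R) := (cauchy 1 z.2 * W (z.1 + z.2))%:E.
have mF : measurable_fun setT F.
  apply/measurable_EFinP; apply: measurable_funM.
    exact: (measurableT_comp (measurable_cauchy ltr01) measurable_snd).
  apply: (measurableT_comp mW).
  by apply: measurable_funD; [exact: measurable_fst|exact: measurable_snd].
have F0 z : (0 <= F z)%E by rewrite lee_fin.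
have := @fubini_tonelli _ _ _ _ R leb leb F mF F0; rewrite /F /=.
rewrite /smoothing => ->.
have I0 : (0 <= \int[leb]_u (W u)%:E)%E by apply: integral_ge0 => u _; rewrite lee_fin.
transitivity (\int[leb]_y ((cauchy 1 y)%:E * \int[leb]_u (W u)%:E))%E.
  apply: eq_integral => y _; under eq_integral do rewrite EFinM.
  rewrite ge0_integralZl ?lee_fin//; last 2 first.
  - apply/measurable_EFinP; apply: (measurableT_comp mW).
    by apply: measurable_funD => //; exact: measurable_cst.
  - by move=> u _; rewrite lee_fin.
  congr (_ * _)%E; apply: (@ge0_integral_shift R y (fun u => (W u)%:E)).
    exact/measurable_EFinP.
  by move=> u; rewrite lee_fin.
by rewrite ge0_integralZr// ?integral_cauchy//; [apply/measurable_EFinP; exact: measurable_cauchy|move=> y _; rewrite lee_fin].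
Qed.

(** Pointwise version of the fact that the convolution of two Cauchy kernels is again of Cauchy
    type: 1 + t^2 is at most twice the sum of the other two denominators. Integrated in r it gives
    the 4 pi of [smoothing_smoothing_le]. *)
Let cauchy_conv t r : cauchy 1 r * cauchy 1 (t - r) <=
  2 * cauchy 1 t * cauchy 1 r + 2 * cauchy 1 t * cauchy 1 (r - t).
Proof.
rewrite -[X in _ <= _ + _ * X]cauchyN opprB /cauchy expr1n !mul1r.
have d1 : 0 < 1 + (t - r) ^+ 2 by rewrite ltr_pwDl// sqr_ge0.
have d2 : 0 < 1 + t ^+ 2 by rewrite ltr_pwDl// sqr_ge0.
have d3 : 0 < 1 + r ^+ 2 by rewrite ltr_pwDl// sqr_ge0.
have h : 1 + t ^+ 2 <= 2 * ((1 + (t - r) ^+ 2) + (1 + r ^+ 2)).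
  have := sqr_ge0 (t - 2 * r); nra.
move: (1 + (t - r) ^+ 2) (1 + t ^+ 2) (1 + r ^+ 2) d1 d2 d3 h => x y z x0 y0 z0 h.
have -> : 2 * y^-1 * z^-1 + 2 * y^-1 * x^-1 = (2 * (x + z) / y) * (z^-1 * x^-1).
  by field; rewrite !gt_eqF.
apply: ler_peMl; first by rewrite mulr_ge0// invr_ge0 ltW.
by rewrite ler_pdivlMr// mul1r.
Qed.

Lemma smoothing_smoothing_le u :
  (\int[leb]_r ((cauchy 1 r)%:E * smoothing W (u + r)%R) <= (4 * pi)%:E * smoothing W u)%E.
Proof.
pose F (z : measurableTypeR R * measurableTypeR R) :=
  (cauchy 1 z.1 * (cauchy 1 (z.2 - z.1) * W (u + z.2)))%:E.
have mF : measurable_fun setT F.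
  apply/measurable_EFinP; apply: measurable_funM.
    exact: (measurableT_comp (measurable_cauchy ltr01) measurable_fst).
  apply: measurable_funM.
    apply: (measurableT_comp (measurable_cauchy ltr01)).
    by apply: measurable_funB; [exact: measurable_snd|exact: measurable_fst].
  apply: (measurableT_comp mW).
  by apply: measurable_funD; [exact: measurable_cst|exact: measurable_snd].
have F0 z : (0 <= F z)%E by rewrite lee_fin mulr_ge0.
have mcs r : measurable_fun [set: R] (fun t => cauchy 1 (t - r)).
  apply: (measurableT_comp (measurable_cauchy ltr01)).
  by apply: measurable_funB => //; exact: measurable_cst.
have -> : (\int[leb]_r ((cauchy 1 r)%:E * smoothing W (u + r)%R) =
    \int[leb]_r \int[leb]_t F (r, t))%E.
  apply: eq_integral => r _; rewrite smoothing_shift -ge0_integralZl//.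
  - apply/measurable_EFinP; apply: measurable_funM; [exact: mcs|exact: measurable_translate].
  - by move=> t _; rewrite lee_fin.
  - by rewrite lee_fin.
rewrite (@fubini_tonelli _ _ _ _ R leb leb F mF F0).
have mk := measurable_smoothing_kernel u mW.
have p0 : 0 <= 4 * pi :> R by rewrite mulr_ge0// pi_ge0.
rewrite /smoothing -ge0_integralZl//; last 2 first.
- exact/measurable_EFinP.
- by move=> t _; rewrite lee_fin.
apply: ge0_le_integral => //.
- by move=> t _; apply: integral_ge0 => r _; exact: F0.
- exact: (@measurable_fun_fubini_tonelli_G _ _ _ _ R leb F mF F0).
- by apply/measurable_EFinP; exact: measurable_funM.
move=> t _.
pose k := 2 * cauchy 1 t * W (u + t).
have k0 : 0 <= k by apply: mulr_ge0 => //; exact: mulr_ge0.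
apply: (@le_trans _ _ (\int[leb]_r (k * cauchy 1 r + k * cauchy 1 (r - t))%:E)%E).
  apply: ge0_le_integral => //.
  - apply/measurable_EFinP; rewrite /=; apply: measurable_funM; first exact: measurable_cauchy.
    apply: measurable_funM; last exact: measurable_cst.
    apply: (measurableT_comp (measurable_cauchy ltr01)).
    by apply: measurable_funB => //; exact: measurable_cst.
  - apply/measurable_EFinP; apply: measurable_funD; apply: measurable_funM => //; first exact: measurable_cauchy.
    exact: mcs.
  - move=> r _; rewrite lee_fin /= mulrA.
    apply: le_trans (ler_wpM2r (W0 _) (cauchy_conv t r)) _.
    by rewrite le_eqVlt; apply/orP; left; apply/eqP; rewrite /k; move: (cauchy 1 _) (cauchy 1 _) (cauchy 1 _) => x y z; ring.
apply: (@le_trans _ _ (k * pi + k * pi)%:E).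
  apply: integral_lincomb_le => //; [exact: measurable_cauchy|by rewrite integral_cauchy|].
  by rewrite integral_cauchy_shift.
by rewrite -EFinM lee_fin le_eqVlt; apply/orP; left; apply/eqP; rewrite /k; move: (cauchy 1 _) (@pi R) => x y; ring.
Qed.

End nonnegative.

(* Mass of W at distance more than L from the interval reaches it only through
   the tail of the kernel, which the dilated kernel (2 / L) cauchy L dominates. *)
Lemma integral_smoothing_le W (M a L : R) : measurable_fun [set: R] W ->
  (forall u, 0 <= W u <= M) -> 0 < L ->
  (\int[leb]_(u in `[a, (a + L)%R[) smoothing W u <=
   pi%:E * \int[leb]_(u in `[(a - L)%R, (a + 2 * L)%R[) (W u)%:E + (2 * pi * M)%:E)%E.
Proof.
move=> mW WM L0; have W0 u : 0 <= W u by have /andP[] := WM u.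
pose J : set R := `[a - L, a + 2 * L[%classic.
have mJ : measurable (J : set (measurableTypeR R)) by exact: measurable_itv.
pose W1 u := W u * \1_J u.
have mW1 : measurable_fun [set: R] W1 by apply: measurable_funM.
have W10 u : 0 <= W1 u by rewrite mulr_ge0.
have M0 : 0 <= M by have /andP[h1 h2] := WM 0; exact: le_trans h1 h2.
have p0 : 0 <= pi :> R := pi_ge0 R.
have c0 s r : 0 < s -> 0 <= cauchy s r by move=> s0; apply: cauchy_ge0; exact: ltW.
apply: (@le_trans _ _ (\int[leb]_(u in `[a, (a + L)%R[) (smoothing W1 u + (2 / L * M * pi)%:E))%E).
  apply: ge0_le_integral => //.
  - by move=> u _; exact: smoothing_ge0.
  - by apply: measurable_funTS; exact: measurable_smoothing.
  - by apply: emeasurable_funD => //; apply: measurable_funTS; exact: measurable_smoothing.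
  move=> u; rewrite /= in_itv/= => /andP[u1 u2].
  apply: (@le_trans _ _ (\int[leb]_r (cauchy 1 r * W1 (u + r) + 2 / L * M * cauchy L r)%:E)%E).
    apply: ge0_le_integral => //.
    - by move=> r _; rewrite lee_fin mulr_ge0 ?c0.
    - by apply/measurable_EFinP; exact: measurable_smoothing_kernel.
    - apply/measurable_EFinP; apply: measurable_funD; first exact: measurable_smoothing_kernel.
      by apply: measurable_funM => //; exact: measurable_cauchy.
    move=> r _; rewrite lee_fin.
    have LM0 : 0 <= 2 / L * M by rewrite mulr_ge0// divr_ge0// ltW.
    have [rL|rL] := leP `|r| L.
      have Jur : J (u + r) by rewrite /J/= in_itv/=; move: rL; rewrite ler_norml => /andP[]; lra.
      by rewrite /W1 indicE mem_set// mulr1 lerDl mulr_ge0 ?c0.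
    rewrite -[leLHS]add0r lerD//; first by rewrite mulr_ge0 ?c0.
    have /andP[_ WMr] := WM (u + r).
    apply: (@le_trans _ _ (cauchy 1 r * M)); first by rewrite ler_wpM2l ?c0.
    have L2 : L ^+ 2 <= r ^+ 2.
      rewrite -[leRHS]real_normK ?num_real// ler_pXn2r ?nnegrE//; last exact: ltW.
      exact: ltW.
    have d0 := cauchy_denom_gt0 r L0.
    have d1 : 0 < 1 + r ^+ 2 by rewrite ltr_pwDl// sqr_ge0.
    have -> : 2 / L * M * cauchy L r = 2 / (L ^+ 2 + r ^+ 2) * M.
      by rewrite /cauchy; field; rewrite !gt_eqF.
    rewrite ler_wpM2r// /cauchy expr1n ler_pdivrMr// mulrAC ler_pdivlMr//; lra.
  under eq_integral do rewrite EFinD.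
  rewrite ge0_integralD//; last 4 first.
  - by move=> r _; rewrite lee_fin mulr_ge0 ?c0.
  - by apply/measurable_EFinP; exact: measurable_smoothing_kernel.
  - by move=> r _; rewrite lee_fin mulr_ge0 ?c0// mulr_ge0// divr_ge0// ltW.
  - by apply/measurable_EFinP; apply: measurable_funM => //; exact: measurable_cauchy.
  rewrite leeD2l//; apply: integral_scale_le.
  - exact: measurable_cauchy.
  - by move=> r; exact: c0.
  - by rewrite mulr_ge0// divr_ge0// ltW.
  - by rewrite integral_cauchy.
rewrite ge0_integralD//; last 3 first.
- by move=> u _; exact: smoothing_ge0.
- by apply: measurable_funTS; exact: measurable_smoothing.
- by move=> u _; rewrite lee_fin mulr_ge0// mulr_ge0// divr_ge0// ltW.
apply: leeD; last first.
  rewrite integral_cst//= lebesgue_measure_itv/= lte_fin ltrDl L0 -EFinD -EFinM lee_fin.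
  rewrite le_eqVlt; apply/orP; left; apply/eqP; move: (@pi R) => p; field.
  by rewrite gt_eqF.
apply: (@le_trans _ _ (\int[leb]_u smoothing W1 u)%E).
  apply: ge0_subset_integral => //; first exact: measurable_smoothing.
  by move=> u _; exact: smoothing_ge0.
rewrite integral_smoothing// [X in (_ <= _ * X)%E]integral_mkcond.
rewrite le_eqVlt; apply/orP; left; apply/eqP; congr (_ * _)%E.
apply: eq_integral => u _; rewrite /W1 /patch indicE.
by case: (u \in _); rewrite ?mulr1 ?mulr0.
Qed.

End smoothing.

Section piecewise.
Context {R : realType}.
Local Notation leb := (@lebesgue_measure R).
Implicit Types (V : int -> R) (u r : R) (l : int).

Lemma measurable_comp_floor V : measurable_fun [set: R] (fun u => V (Num.floor u)).
Proof.
move=> _ B mB; rewrite setTI.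
have mc (l : int) : measurable ([set u : R | Num.floor u = l] : set (measurableTypeR R)).
  rewrite (_ : [set u | _] = `[l%:~R, (l + 1)%:~R[%classic); first exact: measurable_itv.
  apply/seteqP; split => u /=; rewrite in_itv/= -floor_eq; first by move=> ->.
  by move/eqP.
have mb (l : int) : measurable ([set u : R | Num.floor u = l /\ B (V l)] : set (measurableTypeR R)).
  have [Bl|Bl] := pselect (B (V l)).
    rewrite (_ : [set u | _] = [set u : R | Num.floor u = l]); first exact: mc.
    by apply/seteqP; split => u /=; [case|].
  rewrite (_ : [set u | _] = set0); first exact: measurable0.
  by apply/seteqP; split => u //= -[].
rewrite (_ : _ @^-1` _ = \bigcup_n ([set u | Num.floor u = Posz n /\ B (V (Posz n))] `|`
    [set u | Num.floor u = Negz n /\ B (V (Negz n))])).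
  by apply: bigcup_measurable => n _; apply: measurableU; exact: mb.
apply/seteqP; split => [u Bu|u [n _ [] [/= -> ]]] //.
by case E : (Num.floor u) => [n|n]; exists n => //; [left|right]; split => //; rewrite -E.
Qed.

Lemma floor_near (u u' : R) : `|u - u'| <= 1 ->
  [\/ Num.floor u' = Num.floor u, Num.floor u' = Num.floor u + 1 |
      Num.floor u' = Num.floor u - 1].
Proof.
rewrite ler_norml => /andP[m1 m2].
have /andP[u1 u2] := floor_itv u; rewrite intrD mulr1z in u2.
have /andP[v1 v2] := floor_itv u'; rewrite intrD mulr1z in v2.
have a1 : (Num.floor u' < Num.floor u + 1 + 1)%R by rewrite -(ltr_int R) !intrD mulr1z; lra.
have a2 : (Num.floor u < Num.floor u' + 1 + 1)%R by rewrite -(ltr_int R) !intrD mulr1z; lra.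
move: (Num.floor u) (Num.floor u') a1 a2 => i j a1 a2.
have : j = i \/ j = i + 1 \/ j = i - 1 by lia.
by case=> [|[]]; [constructor 1|constructor 2|constructor 3].
Qed.

Definition step V u := `|V (Num.floor u)|.

Lemma measurable_step V : measurable_fun [set: R] (step V).
Proof. by apply: measurableT_comp => //; exact: measurable_comp_floor. Qed.

Definition interpolation V u :=
  V (Num.floor u) + (u - (Num.floor u)%:~R) * (V (Num.floor u + 1) - V (Num.floor u)).

(** 40 = 4 * 10: the kernel is at least 1/10 on |r| <= 3, and nearby coefficients are wanted below a
    quarter of the envelope, so that slopes stay below half of it. *)
Definition step_envelope V u : R := 40 * fine (smoothing (step V) u).

(** 3 accounts for the slow variation, 4 pi for smoothing twice. *)
Definition envelope_cst : R := 3 + 4 * pi.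

Section bounded.
Variables (V : int -> R) (M : R).
Hypothesis VM : forall l, `|V l| <= M.

Let step0 u : 0 <= step V u.
Proof. exact: normr_ge0. Qed.

Let M0 : 0 <= M.
Proof. exact: le_trans (normr_ge0 _) (VM 0). Qed.

Lemma fine_smoothing_step u : (fine (smoothing (step V) u))%:E = smoothing (step V) u.
Proof.
rewrite fineK// ge0_fin_numE; last by apply: smoothing_ge0 => //; exact: step0.
apply: le_lt_trans (ltry (pi * M)).
by apply: (smoothing_le (measurable_step V) step0) => s; exact: VM.
Qed.

Lemma step_envelopeE u : (step_envelope V u)%:E = (40%:E * smoothing (step V) u)%E.
Proof. by rewrite /step_envelope EFinM fine_smoothing_step. Qed.

Lemma step_envelope_ge0 u : 0 <= step_envelope V u.
Proof.
rewrite -lee_fin step_envelopeE mule_ge0 ?lee_fin//; exact: smoothing_ge0.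
Qed.

Lemma step_envelope_le u : step_envelope V u <= 40 * (pi * M).
Proof.
rewrite -lee_fin step_envelopeE [leRHS]EFinM lee_wpmul2l ?lee_fin//.
by apply: (smoothing_le (measurable_step V) step0) => s; exact: VM.
Qed.

Lemma measurable_step_envelope : measurable_fun [set: R] (step_envelope V).
Proof.
apply: measurable_funM => //; apply: (measurableT_comp (@fine_measurable R setT _)) => //.
by apply: measurable_smoothing => //; exact: measurable_step.
Qed.

Lemma envelope_step : envelope envelope_cst (step_envelope V).
Proof.
have p0 : 0 <= pi :> R := pi_ge0 R.
split.
- exact: measurable_step_envelope.
- exact: step_envelope_ge0.
- move=> u r r1; apply: (@le_trans _ _ (3 * step_envelope V u)); last first.
    by rewrite ler_wpM2r ?step_envelope_ge0// /envelope_cst lerDl mulr_ge0.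
  rewrite -lee_fin [leRHS]EFinM !step_envelopeE muleCA lee_wpmul2l ?lee_fin//.
  by apply: smoothing_slow => //; exact: measurable_step.
- move=> u; apply: (@le_trans _ _ ((4 * pi) * step_envelope V u)%:E); last first.
    by rewrite lee_fin ler_wpM2r ?step_envelope_ge0// /envelope_cst lerDr.
  under eq_integral do rewrite EFinM step_envelopeE muleCA.
  rewrite ge0_integralZl//; last 2 first.
  + apply: emeasurable_funM; first by apply/measurable_EFinP; exact: measurable_cauchy.
    apply: measurableT_comp; first by apply: measurable_smoothing => //; exact: measurable_step.
    by apply: measurable_funD => //; exact: measurable_cst.
  + by move=> r _; rewrite mule_ge0 ?lee_fin ?cauchy_ge0//; exact: smoothing_ge0.
  rewrite EFinM step_envelopeE muleCA lee_wpmul2l ?lee_fin//.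
  by apply: smoothing_smoothing_le => //; exact: measurable_step.
Qed.

(** The whole cell [l, l + 1[ lies within distance 3 of [u], where the kernel is at least 1/10. *)
Lemma step_envelope_ge l u : `|l%:~R - (Num.floor u)%:~R| <= 2 :> R ->
  `|V l| <= step_envelope V u / 4.
Proof.
move=> lu; rewrite ler_pdivlMr// -lee_fin step_envelopeE.
have Vl0 := normr_ge0 (V l).
have /andP[u1 u2] := floor_itv u; rewrite intrD mulr1z in u2.
suff h : ((`|V l| / 10)%:E <= smoothing (step V) u)%E.
  apply: (@le_trans _ _ (40%:E * (`|V l| / 10)%:E)%E).
    by rewrite -EFinM lee_fin; lra.
  by rewrite lee_wpmul2l ?lee_fin.
pose a : R := l%:~R - u.
apply: (@le_trans _ _ (\int[leb]_(r in `[a, (a + 1)%R[) (cauchy 1 r * step V (u + r)%R)%:E)%E); last first.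
  apply: ge0_subset_integral => //; last by move=> r _; rewrite lee_fin mulr_ge0 ?cauchy_ge0.
  by apply/measurable_EFinP; apply: measurable_smoothing_kernel; exact: measurable_step.
apply: (@le_trans _ _ (\int[leb]_(r in `[a, (a + 1)%R[) (`|V l| / 10)%:E)%E).
  rewrite integral_cst//= lebesgue_measure_itv/= lte_fin ltrDl ltr01 -EFinD -EFinM lee_fin.
  by rewrite addrAC subrr add0r mulr1.
apply: ge0_le_integral => //.
- apply/measurable_EFinP; apply: measurable_funTS; apply: measurable_smoothing_kernel.
  exact: measurable_step.
move=> r; rewrite /= in_itv/= /a => /andP[r1 r2]; rewrite lee_fin.
have -> : step V (u + r) = `|V l|.
  rewrite /step (_ : Num.floor (u + r) = l)//; apply: floor_def.
  by rewrite intrD; apply/andP; split; lra.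
rewrite mulrC ler_wpM2r// /cauchy expr1n mul1r lef_pV2 ?posrE//; last first.
  by rewrite ltr_pwDl// sqr_ge0.
have : `|r| <= 3.
  by move: lu; rewrite !ler_norml => /andP[l1 l2]; apply/andP; split; lra.
move=> r3; rewrite -[r ^+ 2]real_normK ?num_real//.
have := normr_ge0 r; nra.
Qed.

(** Points at distance at most 1 lie in the same cell or in adjacent ones, so only the coefficients
    with index between i - 1 and i + 2 enter. In adjacent cells the increment is split at the common
    node. *)
Lemma rel_lipschitz_interpolation :
  rel_lipschitz (step_envelope V) 1 1 (interpolation V).
Proof.
split=> [u|u u']; rewrite ?divr1 mul1r.
  have h0 : `|V (Num.floor u)| <= step_envelope V u / 4.
    by apply: step_envelope_ge; rewrite subrr normr0.
  have h1 : `|V (Num.floor u + 1)| <= step_envelope V u / 4.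
    by apply: step_envelope_ge; rewrite intrD mulr1z addrAC subrr add0r normr1; lra.
  have /andP[u1 u2] := floor_itv u; rewrite intrD mulr1z in u2.
  rewrite /interpolation; set d := u - _.
  have d01 : 0 <= d <= 1 by apply/andP; split; rewrite /d; lra.
  move: d01 => /andP[d0 d1].
  have -> : V (Num.floor u) + d * (V (Num.floor u + 1) - V (Num.floor u)) =
    (1 - d) * V (Num.floor u) + d * V (Num.floor u + 1) by ring.
  apply: le_trans (ler_normD _ _) _; rewrite !normrM (ger0_norm d0) ger0_norm ?subr_ge0//.
  apply: (@le_trans _ _ ((1 - d) * (step_envelope V u / 4) + d * (step_envelope V u / 4))).
    by rewrite lerD// ler_wpM2l ?subr_ge0.
  rewrite -mulrDl subrK mul1r; have := step_envelope_ge0 u; lra.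
move=> uu'; have /andP[u1 u2] := floor_itv u; rewrite intrD mulr1z in u2.
have /andP[u'1 u'2] := floor_itv u'; rewrite intrD mulr1z in u'2.
pose i := Num.floor u; pose i' := Num.floor u'.
have near l : `|l%:~R - i%:~R| <= 2 :> R -> `|V l| <= step_envelope V u / 4 by exact: step_envelope_ge.
have h0 : `|V i| <= step_envelope V u / 4 by apply: near; rewrite subrr normr0.
have h1 : `|V (i + 1)| <= step_envelope V u / 4.
  by apply: near; rewrite intrD mulr1z addrAC subrr add0r normr1; lra.
have h2 : `|V (i + 1 + 1)| <= step_envelope V u / 4.
  by apply: near; rewrite !intrD !mulr1z ger0_norm; lra.
have h3 : `|V (i - 1)| <= step_envelope V u / 4.
  by apply: near; rewrite intrB mulr1z addrAC subrr sub0r normrN normr1; lra.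
set O := step_envelope V u in h0 h1 h2 h3 *.
have O0 : 0 <= O by exact: step_envelope_ge0.
have cases := floor_near uu'; rewrite -/i -/i' in cases.
rewrite /interpolation -/i -/i'.
rewrite -/i -/i' in u1 u2 u'1 u'2.
have sl (x y : R) : `|x| <= O / 4 -> `|y| <= O / 4 -> `|y - x| <= O / 2.
  by move=> hx hy; apply: le_trans (ler_normB _ _) _; lra.
have comb (a b x y : R) : 0 <= a -> 0 <= b -> x <= O / 2 -> y <= O / 2 ->
    a * x + b * y <= (a + b) * O.
  move=> a0 b0 hx hy; apply: le_trans (lerD (ler_wpM2l a0 hx) (ler_wpM2l b0 hy)) _.
  rewrite -mulrDl ler_wpM2l ?addr_ge0//; lra.
have bound (D x : R) : `|D| <= O -> `|x * D| <= `|x| * O.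
  by move=> hD; rewrite normrM ler_wpM2l.
case: cases => E; rewrite E in u'1 u'2 *.
- have -> : V i + (u - i%:~R) * (V (i + 1) - V i) - (V i + (u' - i%:~R) * (V (i + 1) - V i)) =
    (u - u') * (V (i + 1) - V i) by ring.
  by apply: bound; apply: le_trans (sl _ _ h0 h1) _; lra.
- rewrite intrD mulr1z in u'1 u'2 *.
  have -> : V i + (u - i%:~R) * (V (i + 1) - V i) -
     (V (i + 1) + (u' - (i%:~R + 1)) * (V (i + 1 + 1) - V (i + 1))) =
    - ((i%:~R + 1 - u) * (V (i + 1) - V i) + (u' - (i%:~R + 1)) * (V (i + 1 + 1) - V (i + 1))).
    by ring.
  rewrite normrN; apply: le_trans (ler_normD _ _) _; rewrite !normrM.
  rewrite (@ger0_norm _ (i%:~R + 1 - u)); last by lra.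
  rewrite (@ger0_norm _ (u' - (i%:~R + 1))); last by lra.
  rewrite (distrC u) (@ger0_norm _ (u' - u)); last by lra.
  have k1 := sl _ _ h0 h1; have k2 := sl _ _ h1 h2.
  have -> : u' - u = (i%:~R + 1 - u) + (u' - (i%:~R + 1)) by ring.
  by apply: comb => //; lra.
- rewrite intrB mulr1z in u'1 u'2 *; rewrite subrK in u'2; rewrite (subrK 1 i).
  have -> : V i + (u - i%:~R) * (V (i + 1) - V i) -
     (V (i - 1) + (u' - (i%:~R - 1)) * (V i - V (i - 1))) =
    (u - i%:~R) * (V (i + 1) - V i) + (i%:~R - u') * (V i - V (i - 1)).
    by ring.
  apply: le_trans (ler_normD _ _) _; rewrite !normrM.
  rewrite (@ger0_norm _ (u - i%:~R)); last by lra.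
  rewrite (@ger0_norm _ (i%:~R - u')); last by lra.
  rewrite (@ger0_norm _ (u - u')); last by lra.
  have k1 := sl _ _ h0 h1; have k2 := sl _ _ h3 h0.
  have -> : u - u' = (u - i%:~R) + (i%:~R - u') by ring.
  by apply: comb => //; lra.
Qed.

Lemma integral_step_envelope_le a L : 0 < L ->
  (\int[leb]_(u in `[a, (a + L)%R[) (step_envelope V u)%:E <=
   (40 * pi)%:E * \int[leb]_(u in `[(a - L)%R, (a + 2 * L)%R[) (step V u)%:E +
   (80 * pi * M)%:E)%E.
Proof.
move=> L0; under eq_integral do rewrite step_envelopeE.
rewrite ge0_integralZl//; last 2 first.
- by apply: measurable_funTS; apply: measurable_smoothing => //; exact: measurable_step.
- by move=> u _; exact: smoothing_ge0.
have := @integral_smoothing_le R (step V) M a L (measurable_step V) _ L0.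
move=> /(_ _)/(lee_wpmul2l (_ : (0 <= 40%:E :> \bar R)%E)).
move=> /(_ _ _)/le_trans; apply => //; first by move=> u; rewrite step0 VM.
rewrite ge0_muleDr//; last 2 first.
- by rewrite mule_ge0 ?lee_fin ?pi_ge0//; apply: integral_ge0 => u _; rewrite lee_fin.
- by rewrite lee_fin !mulr_ge0 ?pi_ge0.
rewrite muleA -!EFinM leeD2l// lee_fin le_eqVlt; apply/orP; left; apply/eqP.
by move: (@pi R) => p; ring.
Qed.

End bounded.
End piecewise.

(** * Packing on the dyadic tree *)

Section dyadic_tree.
Context {R : realType}.
Local Notation leb := (@lebesgue_measure R).
Implicit Types (F : nat -> int -> R) (j l : int) (k m n : nat).

(* The cell (m, j) is [j 2^-m, (j + 1) 2^-m[; the sum is over its proper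
   subcells of depth at most n, weighted by their lengths. *)
Fixpoint tree_sum F n m j : R :=
  if n is n'.+1 then
    (2 ^+ m.+1)^-1 * (F m.+1 (2 * j) + F m.+1 (2 * j + 1)) +
    (tree_sum F n' m.+1 (2 * j) + tree_sum F n' m.+1 (2 * j + 1))
  else 0.

(* The cell (m, j) in the coordinate that gives the cells of level k length 1. *)
Definition rescaled_cell k m j : set R :=
  `[(2 ^+ k * (j%:~R / 2 ^+ m)), (2 ^+ k * (j%:~R / 2 ^+ m)) + 2 ^+ k / 2 ^+ m[%classic.

Lemma measurable_rescaled_cell k m j :
  measurable (rescaled_cell k m j : set (measurableTypeR R)).
Proof. exact: measurable_itv. Qed.

Lemma ge0_integral_itv_split (f : R -> \bar R) (a b c : R) : a <= b -> b <= c ->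
  measurable_fun [set: R] f -> (forall x, 0 <= f x)%E ->
  (\int[leb]_(u in `[a, c[) f u = \int[leb]_(u in `[a, b[) f u + \int[leb]_(u in `[b, c[) f u)%E.
Proof.
move=> ab bc mf f0; rewrite -ge0_integral_setU//.
- by rewrite -itv_bndbnd_setU// bnd_simp.
- exact: measurable_funTS.
- apply/disj_set2P; apply/seteqP; split => u //= []; rewrite !in_itv/=.
  by move=> /andP[_ ub] /andP[bu _]; move: (lt_le_trans ub bu); rewrite ltxx.
Qed.

Lemma integral_rescaled_cell_split k m j (f : R -> \bar R) :
  measurable_fun [set: R] f -> (forall x, 0 <= f x)%E ->
  (\int[leb]_(u in rescaled_cell k m j) f u =
   \int[leb]_(u in rescaled_cell k m.+1 (2 * j)) f u +
   \int[leb]_(u in rescaled_cell k m.+1 (2 * j + 1)) f u)%E.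
Proof.
move=> mf f0; rewrite /rescaled_cell.
have L0 : 0 <= 2 ^+ k / 2 ^+ m.+1 :> R by rewrite divr_ge0// exprn_ge0.
have p0 : 2 ^+ m != 0 :> R by rewrite gt_eqF// exprn_gt0.
have e1 : 2 ^+ k * ((2 * j)%:~R / 2 ^+ m.+1) = 2 ^+ k * (j%:~R / 2 ^+ m) :> R.
  by rewrite intrM exprS; field.
have e2 : 2 ^+ k * ((2 * j + 1)%:~R / 2 ^+ m.+1) =
    2 ^+ k * (j%:~R / 2 ^+ m) + 2 ^+ k / 2 ^+ m.+1 :> R.
  by rewrite intrD intrM exprS; field.
have e3 : 2 ^+ k / 2 ^+ m = 2 ^+ k / 2 ^+ m.+1 + 2 ^+ k / 2 ^+ m.+1 :> R.
  by rewrite exprS; field.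
by rewrite e1 e2 e3 addrA (@ge0_integral_itv_split _ _ (2 ^+ k * (j%:~R / 2 ^+ m) + 2 ^+ k / 2 ^+ m.+1))// lerDl.
Qed.

Section family.
Variable V : nat -> int -> R.

Let st0 k u : (0 <= (step (V k) u)%:E)%E.
Proof. by rewrite lee_fin; exact: normr_ge0. Qed.

Let I0 k (D : set R) : (0 <= \int[leb]_(u in D) (step (V k) u)%:E)%E.
Proof. by apply: integral_ge0 => u _; exact: st0. Qed.

(** The factor 2^-k undoes the dilation, so that integrals for different [k] refer to one and the
    same cell of the logarithmic line. *)
Definition cell_integral k m j : \bar R :=
  (((2 ^+ k)^-1)%:E * \int[leb]_(u in rescaled_cell k m j) (step (V k) u)%:E)%E.

Lemma cell_integral_ge0 k m j : (0 <= cell_integral k m j)%E.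
Proof.
by rewrite mule_ge0 ?lee_fin ?invr_ge0 ?exprn_ge0//; exact: I0.
Qed.

Lemma cell_integral_split k m j :
  cell_integral k m j =
  (cell_integral k m.+1 (2 * j) + cell_integral k m.+1 (2 * j + 1))%E.
Proof.
rewrite /cell_integral integral_rescaled_cell_split.
- by rewrite ge0_muleDr//; exact: I0.
- by apply/measurable_EFinP; exact: measurable_step.
- exact: st0.
Qed.

Lemma cell_integral_self k j : cell_integral k k j = ((2 ^+ k)^-1 * `|V k j|)%:E.
Proof.
rewrite /cell_integral EFinM; congr (_ * _)%E; rewrite /rescaled_cell.
have p0 : 2 ^+ k != 0 :> R by rewrite gt_eqF// exprn_gt0.
rewrite mulrCA divff// mulr1.
rewrite (eq_integral (fun=> (`|V k j|)%:E)); last first.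
  move=> u; rewrite inE /= in_itv/= => /andP[u1 u2]; rewrite /step.
  by rewrite (@floor_def _ u j)// intrD u1.
by rewrite integral_cst//= lebesgue_measure_itv/= lte_fin ltrDl ltr01 -EFinD addrAC subrr add0r mule1.
Qed.

(** At level k > m the integral adds 2^-k |V k l| over the descendants of the cell at depth k.
    Splitting every integral over the two children reproduces the recursion of [tree_sum]. *)
Lemma sum_cell_integral n m j :
  (\sum_(i < n) cell_integral (m.+1 + i) m j =
   (tree_sum (fun k l => `|V k l|) n m j)%:E)%E.
Proof.
elim: n m j => [|n IH] m j; first by rewrite big_ord0.
rewrite big_ord_recl/= addn0 cell_integral_split !cell_integral_self !EFinD -!IH.
rewrite mulrDr EFinD; congr (_ + _)%E.
rewrite -big_split/=; apply: eq_bigr => i _.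
by rewrite cell_integral_split /bump /= add1n addnS addSn.
Qed.

Variables (M P : R).
Hypothesis VM : forall k l, `|V k l| <= M.
Hypothesis VP : forall n m j,
  tree_sum (fun k l => `|V k l|) n m j <= P / 2 ^+ m.

Definition envelope_integral k m j : \bar R :=
  (((2 ^+ k)^-1)%:E * \int[leb]_(u in rescaled_cell k m j) (step_envelope (V k) u)%:E)%E.

Let P0 : 0 <= P.
Proof. by have := VP 0 0 0; rewrite /= expr0 divr1. Qed.

Let M0 : 0 <= M.
Proof. exact: le_trans (normr_ge0 _) (VM 0 0). Qed.

(** The smoothed mass over a cell comes from the cell and its two neighbours of equal size, up to a
    tail bounded independently of the size of the cell; after division by 2^k this tail is summable
    over the levels. *)
Lemma envelope_integral_le k m j :
  (envelope_integral k m j <= (40 * pi)%:E *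
     (cell_integral k m (j - 1) + cell_integral k m j + cell_integral k m (j + 1)) +
     (80 * pi * M / 2 ^+ k)%:E)%E.
Proof.
have L0 : 0 < 2 ^+ k / 2 ^+ m :> R by rewrite divr_gt0// exprn_gt0.
have p2 : 0 < (2 ^+ k)^-1 :> R by rewrite invr_gt0 exprn_gt0.
have pi0 : 0 <= pi :> R := pi_ge0 R.
rewrite /envelope_integral /rescaled_cell.
set a := 2 ^+ k * (j%:~R / 2 ^+ m); set L := 2 ^+ k / 2 ^+ m in L0 *.
have h := integral_step_envelope_le (VM k) a L0.
apply: le_trans (lee_wpmul2l _ h) _; first by rewrite lee_fin ltW.
have mst : measurable_fun [set: R] (fun u => (step (V k) u)%:E).
  by apply/measurable_EFinP; exact: measurable_step.
rewrite ge0_muleDr; last 2 first.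
- by apply: mule_ge0; [rewrite lee_fin mulr_ge0|exact: I0].
- by rewrite lee_fin !mulr_ge0.
apply: leeD; last by rewrite -EFinM lee_fin mulrC.
rewrite muleCA; apply: lee_wpmul2l; first by rewrite lee_fin mulr_ge0.
rewrite (@ge0_integral_itv_split _ _ a)//; [|lra|lra].
rewrite (@ge0_integral_itv_split _ a (a + L) (a + 2 * L))//; [|lra|lra].
have distr (c x y z : \bar R) : (0 <= x -> 0 <= y -> 0 <= z ->
    c * (x + (y + z)) = c * x + c * y + c * z)%E.
  by move=> x0 y0 z0; rewrite !ge0_muleDr ?adde_ge0// addeA.
rewrite distr; [|exact: I0|exact: I0|exact: I0].
have p0 : 2 ^+ m != 0 :> R by rewrite gt_eqF// exprn_gt0.
have e1 : 2 ^+ k * ((j - 1)%:~R / 2 ^+ m) = a - L.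
  by rewrite intrB /a /L; field.
have e2 : 2 ^+ k * ((j + 1)%:~R / 2 ^+ m) = a + L.
  by rewrite intrD /a /L; field.
rewrite /cell_integral /rescaled_cell e1 e2 -/a -/L subrK.
by rewrite -(addrA a L L) -mulr2n -[L *+ 2]mulr_natl.
Qed.

(** The cell and its two neighbours give 3 * 40 pi P; the tails, summed over the levels beyond m,
    give 80 pi M. *)
Definition envelope_packing_cst : R := 120 * pi * P + 80 * pi * M.

Lemma sum_envelope_integral n m j :
  (\sum_(i < n) envelope_integral (m.+1 + i) m j <=
   (envelope_packing_cst / 2 ^+ m)%:E)%E.
Proof.
have pi0 : 0 <= pi :> R := pi_ge0 R.
have C0 := cell_integral_ge0.
apply: (@le_trans _ _ (\sum_(i < n) ((40 * pi)%:E *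
     (cell_integral (m.+1 + i) m (j - 1) + cell_integral (m.+1 + i) m j +
      cell_integral (m.+1 + i) m (j + 1)) + (80 * pi * M / 2 ^+ (m.+1 + i))%:E))%E).
  by apply: lee_sum => i _; exact: envelope_integral_le.
rewrite big_split/= -ge0_sume_distrr; last by move=> i _; rewrite !adde_ge0.
rewrite !big_split/= !sum_cell_integral -!EFinD sumEFin -EFinM -EFinD lee_fin.
have gs : \sum_(i < n) 80 * pi * M / 2 ^+ (m.+1 + i) <= 80 * pi * M / 2 ^+ m.
  rewrite -mulr_sumr; apply: ler_wpM2l; first by rewrite !mulr_ge0.
  have -> : \sum_(i < n) (2 ^+ (m.+1 + i))^-1 = (2 ^+ m)^-1 - (2 ^+ (m + n))^-1 :> R.
    elim: n => [|n IH]; first by rewrite big_ord0 addn0 subrr.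
    rewrite big_ord_recr/= IH addSn addnS exprS invfM.
    by move: ((2 ^+ (m + n))^-1) ((2 ^+ m)^-1) => x y; field.
  by rewrite gerBl invr_ge0 exprn_ge0.
have := VP n m (j - 1); have := VP n m j; have := VP n m (j + 1).
move=> h1 h2 h3.
have h : 40 * pi * (tree_sum (fun k l => `|V k l|) n m (j - 1) +
   tree_sum (fun k l => `|V k l|) n m j + tree_sum (fun k l => `|V k l|) n m (j + 1)) <=
   40 * pi * (3 * (P / 2 ^+ m)).
  by apply: ler_wpM2l; [rewrite mulr_ge0|lra].
apply: le_trans (lerD h gs) _.
rewrite /envelope_packing_cst le_eqVlt; apply/orP; left; apply/eqP.
by move: (2 ^- m) (@pi R) => x y; ring.
Qed.

End family.
End dyadic_tree.

(** * Dyadic approximation in the logarithmic coordinate *)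

Section exponential_cells.
Context {R : realType}.
Local Notation leb := (@lebesgue_measure R).
Implicit Types (k m n : nat) (i j l : int).

Definition node k i : R := expR (i%:~R / 2 ^+ k).

Definition ratio k : R := expR ((2 ^+ k)^-1).

Definition cell k i : set R := `[node k i, node k (i + 1)[%classic.

Lemma node_gt0 k i : 0 < node k i.
Proof. exact: expR_gt0. Qed.

Lemma nodeS k i : node k (i + 1) = ratio k * node k i.
Proof. by rewrite /node /ratio -expRD intrD mulrDl mul1r addrC. Qed.

Lemma node_double k i : node k.+1 (2 * i) = node k i.
Proof.
have p0 : 2 ^+ k != 0 :> R by rewrite gt_eqF// exprn_gt0.
by rewrite /node intrM exprS; congr expR; field.
Qed.

Lemma ratio_sqr k : ratio k = ratio k.+1 ^+ 2.
Proof.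
have p0 : 2 ^+ k != 0 :> R by rewrite gt_eqF// exprn_gt0.
by rewrite /ratio expr2 -expRD exprS; congr expR; field.
Qed.

Lemma pow2V_le1 k : (2 ^+ k)^-1 <= 1 :> R.
Proof. by rewrite invf_le1 ?exprn_gt0// exprn_ege1// ler1n. Qed.

Lemma ratio_ge k : 1 + (2 ^+ k)^-1 <= ratio k.
Proof. exact: expR_ge1Dx. Qed.

Lemma ratio_gt1 k : 1 < ratio k.
Proof. by apply: lt_le_trans (ratio_ge k); rewrite ltrDl invr_gt0 exprn_gt0. Qed.

Lemma ratio_le k : ratio k <= 4.
Proof.
apply: (@le_trans _ _ (expR 1)); first by rewrite ler_expR pow2V_le1.
have -> : 1 = 2^-1 + 2^-1 :> R by field.
rewrite expRD; have h := expR_ge1Dx (- 2^-1 : R).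
have h1 : expR (- 2^-1) * expR 2^-1 = 1 :> R by rewrite -expRD addNr expR0.
have h2 := expR_gt0 (2^-1 : R).
have h3 : expR 2^-1 <= 2 :> R by nra.
nra.
Qed.

Lemma ratioB1_le k : ratio k - 1 <= 4 * (2 ^+ k)^-1.
Proof.
have h := expR_ge1Dx (- (2 ^+ k)^-1 : R).
have h1 : expR (- (2 ^+ k)^-1) * ratio k = 1 :> R by rewrite -expRD addNr expR0.
have h2 := ratio_le k; have h3 := ratio_gt1 k.
have h4 : 0 < (2 ^+ k)^-1 :> R by rewrite invr_gt0 exprn_gt0.
nra.
Qed.

Lemma node_lt k i : node k i < node k (i + 1).
Proof. by rewrite nodeS ltr_pMl ?node_gt0// ratio_gt1. Qed.

Lemma itv_length_cell k i : itv_length (cell k i) = node k (i + 1) - node k i.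
Proof. by rewrite /cell itv_length_itv// ltW// node_lt. Qed.

Lemma itv_length_cell_gt0 k i : 0 < itv_length (cell k i).
Proof. by rewrite itv_length_cell subr_gt0 node_lt. Qed.

Lemma itv_length_cell_le k i : itv_length (cell k i) <= 4 * node k i / 2 ^+ k.
Proof.
rewrite itv_length_cell nodeS; have := ratioB1_le k; have := node_gt0 k i.
have -> : 4 * node k i / 2 ^+ k = 4 * (2 ^+ k)^-1 * node k i by rewrite mulrAC.
move=> n0 r; have -> : ratio k * node k i - node k i = (ratio k - 1) * node k i by ring.
by rewrite ler_pM2r.
Qed.

Lemma itv_length_cell_ge k i : node k i / 2 ^+ k <= itv_length (cell k i).
Proof.
rewrite itv_length_cell nodeS; have := ratio_ge k; have := node_gt0 k i.
move=> n0 r; have -> : ratio k * node k i - node k i = node k i * (ratio k - 1) by ring.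
by rewrite ler_pM2l//; lra.
Qed.

Lemma bounded_interval_node k i j : node k i < node k j ->
  bounded_interval `[node k i, node k j[%classic.
Proof.
move=> ij; apply: bounded_interval_itv => //; first exact: ltW (node_gt0 _ _).
by move=> h; have := node_gt0 k i; rewrite h ltxx.
Qed.

Lemma measurable_cell k i : measurable (cell k i : set (measurableTypeR R)).
Proof. exact: measurable_itv. Qed.

Lemma bounded_interval_cell k i : bounded_interval (cell k i).
Proof. by apply: bounded_interval_node; exact: node_lt. Qed.

Lemma cell_split k i : cell k i = cell k.+1 (2 * i) `|` cell k.+1 (2 * i + 1).
Proof.
rewrite /cell -addrA (_ : 1 + 1 = 2 * 1 :> int)// -mulrDr !node_double.
rewrite -itv_bndbnd_setU// bnd_simp.
  by rewrite -[X in X <= _]node_double ltW// node_lt.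
rewrite -[X in _ <= X]node_double mulrDr mulr1 (_ : 2 * i + 2 = 2 * i + 1 + 1).
  by rewrite ltW// node_lt.
by rewrite -addrA.
Qed.

Lemma disjoint_children k i : [disjoint cell k.+1 (2 * i) & cell k.+1 (2 * i + 1)].
Proof.
apply/disj_set2P; apply/seteqP; split => x //= []; rewrite /cell/= !in_itv/=.
by move=> /andP[_ xb] /andP[bx _]; move: (lt_le_trans xb bx); rewrite ltxx.
Qed.

Lemma half_cases i : exists j, i = 2 * j \/ i = 2 * j + 1.
Proof.
exists (i %/ 2)%Z; have := divz_eq i 2; rewrite mulrC => e.
have h1 : (0 <= (i %% 2)%Z) by exact: modz_ge0.
have h2 : ((i %% 2)%Z < 2) by exact: ltz_mod.
have : (i %% 2)%Z = 0 \/ (i %% 2)%Z = 1 by lia.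
by case=> h; rewrite h ?addr0 in e; [left|right].
Qed.

Lemma half_even j : (2 * j %/ 2)%Z = j.
Proof. by rewrite mulKz. Qed.

Lemma half_odd j : ((2 * j + 1) %/ 2)%Z = j.
Proof. by rewrite mulrC divzMDl// addr0. Qed.

Lemma cell_child_subset k i : cell k.+1 i `<=` cell k (i %/ 2)%Z.
Proof.
have [j [->|->]] := half_cases i; rewrite ?half_even ?half_odd [X in _ `<=` X]cell_split.
  by move=> x; left.
by move=> x; right.
Qed.

(** With q = [ratio k.+1], the parent is q + 1 times as long as its left child and (q + 1) / q times
    as long as the right one; q <= 4 gives the 5. *)
Lemma itv_length_child k i : itv_length (cell k (i %/ 2)%Z) <= 5 * itv_length (cell k.+1 i).
Proof.
have q1 := ratio_gt1 k.+1; have q4 := ratio_le k.+1.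
have [j ij] := half_cases i; set q := ratio k.+1 in q1 q4 *.
have n0 := node_gt0 k j.
have e0 : node k (j + 1) = q ^+ 2 * node k j by rewrite nodeS ratio_sqr.
have e1 : node k.+1 (2 * j + 1) = q * node k j by rewrite nodeS node_double.
have e2 : node k.+1 (2 * j + 1 + 1) = q * (q * node k j) by rewrite nodeS e1.
have q10 : 0 <= q - 1 by rewrite subr_ge0 ltW.
have qn : 0 <= (q - 1) * node k j by apply: mulr_ge0 => //; exact: ltW.
have p1 : 0 <= (4 - q) * ((q - 1) * node k j) by rewrite mulr_ge0// subr_ge0.
have p2 : 0 <= (q - 1) * ((q - 1) * node k j) by rewrite mulr_ge0.
by case: ij => ->; rewrite ?half_even ?half_odd !itv_length_cell e0 ?e2 ?e1 ?node_double; nra.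
Qed.

Lemma cell_floor k (x : R) : 0 < x -> cell k (Num.floor (2 ^+ k * ln x)) x.
Proof.
move=> x0; rewrite /cell /node/= in_itv/=.
have p0 : 0 < 2 ^+ k :> R by rewrite exprn_gt0.
have /andP[u1 u2] := floor_itv (2 ^+ k * ln x).
rewrite -[x in X in _ <= X]lnK ?posrE// -[x in X in X < _]lnK ?posrE// ler_expR ltr_expR.
by rewrite ler_pdivrMr// ltr_pdivlMr// (mulrC (ln x)) u1 u2.
Qed.

End exponential_cells.

Section mean_estimates.
Context {R : realType}.
Local Notation leb := (@lebesgue_measure R).

Lemma mean_dist_le (f : R -> R) (I : set R) (c : R) :
  measurable (I : set (measurableTypeR R)) -> 0 < itv_length I ->
  leb.-integrable I (EFin \o f) ->
  `|mean f I - c| * itv_length I <= \int[leb]_(y in I) `|f y - c|.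
Proof.
move=> mI l0 fI.
have muI : (leb I < +oo)%E.
  by rewrite ltey; apply/eqP => muI; move: l0; rewrite /itv_length muI ltxx.
have ick (k : R) : leb.-integrable I (EFin \o (fun=> k)) by exact: integrable_cst_itv.
have ic : leb.-integrable I (EFin \o (fun y => f y - c)).
  rewrite (_ : _ \o _ = (EFin \o f) \- cst c%:E)%E//.
  by apply: integrableB => //; exact: integrable_cst_itv.
apply: le_trans (le_normr_Rintegral _ ic) => //.
rewrite RintegralB// Rintegral_cst// /mean -/(itv_length I).
by rewrite -{2}(gtr0_norm l0) -normrM mulrBl mulrAC mulVf ?gt_eqF// mul1r.
Qed.

Lemma integrable_dist (f : R -> R) (I : set R) (c : R) :
  measurable (I : set (measurableTypeR R)) -> (leb I < +oo)%E ->
  leb.-integrable I (EFin \o f) ->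
  leb.-integrable I (EFin \o (fun y => `|f y - c|)).
Proof.
move=> mI muI fI.
rewrite (_ : _ \o _ = abse \o (EFin \o (fun y => f y - c)))//; apply: integrable_abse => //.
rewrite (_ : _ \o _ = (EFin \o f) \- cst c%:E)%E//.
by apply: integrableB => //; exact: integrable_cst_itv.
Qed.

End mean_estimates.

Section cell_means.
Context {R : realType}.
Local Notation leb := (@lebesgue_measure R).
Implicit Types (k m n : nat) (i j l : int).
Variables (f : R -> R) (K : R).
Hypothesis K0 : 0 < K.
Hypothesis fint : forall a : R, 0 < a -> leb.-integrable `]0, a[ (EFin \o f).
Hypothesis fK : bmo_bound f K.

Lemma integrable_bounded_interval (I : set R) : bounded_interval I ->
  [/\ measurable (I : set (measurableTypeR R)), (leb I < +oo)%E &
      leb.-integrable I (EFin \o f)].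
Proof.
move=> bI; have [a [b [a0 ab lE Iab [_ mI]]]] := bounded_intervalP bI.
have [_ l0 [M IM]] := bI.
split => //.
  by rewrite ltey; apply/eqP => h; move: l0; rewrite /itv_length h ltxx.
have M1 : 0 < b + 1 by rewrite (le_lt_trans a0)// ltr_wpDr.
apply: integrableS (fint M1) => // x Ix.
have := IM _ Ix; have := Iab _ Ix; rewrite /= !in_itv/= => /andP[_ xb] /andP[-> _]/=.
by rewrite (le_lt_trans xb)// ltrDl.
Qed.

Lemma oscillation_le (I : set R) : bounded_interval I ->
  \int[leb]_(y in I) `|f y - mean f I| <= K * itv_length I.
Proof.
move=> bI; have [_ l0 _] := bI.
by have := fK.1 I bI; rewrite mulrC ler_pdivrMr.
Qed.

Lemma mean_close (c I : set R) (r : R) : bounded_interval c -> bounded_interval I ->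
  c `<=` I -> itv_length I <= r * itv_length c -> `|mean f c - mean f I| <= r * K.
Proof.
move=> bc bI cI lr; have [_ c0 _] := bc.
have [mc _ ic] := integrable_bounded_interval bc.
have [mI fI iI] := integrable_bounded_interval bI.
rewrite -(ler_pM2r c0); apply: le_trans (mean_dist_le (mean f I) mc c0 ic) _.
have : \int[leb]_(y in c) `|f y - mean f I| <= \int[leb]_(y in I) `|f y - mean f I|.
  have iD := integrable_dist (mean f I) mI fI iI.
  have iDc : leb.-integrable c (EFin \o (fun y => `|f y - mean f I|)) by exact: integrableS iD.
  rewrite -lee_fin /Rintegral !fineK ?integrable_fin_num//.
  by apply: ge0_subset_integral => //; move/integrableP : iD => [].
move=> /le_trans; apply; apply: le_trans (oscillation_le bI) _.
by rewrite (mulrC r) -mulrA ler_pM2l.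
Qed.

Definition cell_mean k i : R := mean f (cell k i).

(** This is condition (b) on the interval from 0 to the right end of the cell, of which the cell
    occupies at least half because [ratio 0 >= 2]. It is what allows the approximation to start from
    0. *)
Lemma cell_mean0 i : `|cell_mean 0 i| <= 2 * K.
Proof.
have bc := bounded_interval_cell (R := R) 0 i.
have [mc fc ic] := integrable_bounded_interval bc.
have l0 := itv_length_cell_gt0 (R := R) 0 i.
have n0 := node_gt0 (R := R) 0 i.
have := mean_dist_le 0 mc l0 ic; rewrite subr0 -/(cell_mean 0 i) => h.
rewrite -(ler_pM2r l0); apply: le_trans h _.
have b0 := node_gt0 (R := R) 0 (i + 1).
have := fK.2 _ b0; rewrite mulrC ler_pdivrMr// => h.
apply: (@le_trans _ _ (\int[leb]_(y in `]0, node 0 (i + 1)[) `|f y|)).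
  under eq_Rintegral do rewrite subr0.
  have iD : leb.-integrable `]0, node 0 (i + 1)[ (EFin \o (fun y => `|f y|)).
    by rewrite (_ : _ \o _ = abse \o (EFin \o f))//; apply: integrable_abse; exact: fint.
  have sub : (cell 0 i : set R) `<=` `]0, node 0 (i + 1)[%classic.
    by move=> x; rewrite /cell/= !in_itv/= => /andP[nx ->]; rewrite (lt_le_trans n0 nx).
  have iDc : leb.-integrable (cell 0 i) (EFin \o (fun y => `|f y|)) by exact: integrableS iD.
  rewrite -lee_fin /Rintegral !fineK ?integrable_fin_num//.
  by apply: ge0_subset_integral => //; move/integrableP : iD => [].
apply: le_trans h _; rewrite itv_length_cell nodeS.
have : 2 <= ratio 0 :> R by have := ratio_ge (R := R) 0; rewrite expr0 invr1; lra.
move: (node 0 i) (ratio 0) n0 => x q x0 q2.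
have h0 : 0 <= K * x * (q - 2) by rewrite mulr_ge0 ?subr_ge0// mulr_ge0// ltW.
nra.
Qed.

Lemma cell_mean_child k i : `|cell_mean k.+1 i - cell_mean k (i %/ 2)%Z| <= 5 * K.
Proof.
apply: mean_close; try exact: bounded_interval_cell.
  exact: cell_child_subset.
exact: itv_length_child.
Qed.

Lemma normr_dist_le2 (a b c r : R) : `|a - c| <= 5 * r -> `|b - c| <= 5 * r ->
  `|a - b| <= 10 * r.
Proof.
move=> ac bc; apply: le_trans (ler_distD c _ _) _; rewrite (distrC c).
by apply: le_trans (lerD ac bc) _; rewrite -mulrDl (_ : 5 + 5 = 10 :> R)//; ring.
Qed.

(** Both means are compared with the mean over the union of the two cells, at most 5 times as long
    as either. *)
Lemma cell_mean_next k i : `|cell_mean k i - cell_mean k (i + 1)| <= 10 * K.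
Proof.
pose I : set R := `[node k i, node k (i + 1 + 1)[%classic.
have l1 := node_lt (R := R) k i; have l2 := node_lt (R := R) k (i + 1).
have bI : bounded_interval I by apply: bounded_interval_node; exact: lt_trans l2.
have q1 := ratio_gt1 (R := R) k; have q4 := ratio_le (R := R) k.
have n0 := node_gt0 (R := R) k i.
have qn : 0 <= (ratio k - 1) * node k i :> R.
  by apply: mulr_ge0; [rewrite subr_ge0|]; exact: ltW.
have lI : itv_length I = (ratio k + 1) * ((ratio k - 1) * node k i).
  by rewrite /I itv_length_itv ?(ltW (lt_trans l1 l2))// !nodeS; ring.
have c1 : `|cell_mean k i - mean f I| <= 5 * K.
  apply: mean_close => //; first exact: bounded_interval_cell.
    by move=> x; rewrite /cell /I/= !in_itv/= => /andP[-> h]/=; exact: lt_trans l2.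
  rewrite lI itv_length_cell nodeS -[X in _ <= 5 * (_ - X)]mul1r -mulrBl ler_wpM2r//; lra.
have c2 : `|cell_mean k (i + 1) - mean f I| <= 5 * K.
  apply: mean_close => //; first exact: bounded_interval_cell.
    move=> x; rewrite /cell /I/= !in_itv/= => /andP[h ->]; rewrite andbT.
    by apply: le_trans h; exact: ltW.
  rewrite lI itv_length_cell !nodeS.
  have -> : 5 * (ratio k * (ratio k * node k i) - ratio k * node k i) =
    (5 * ratio k) * ((ratio k - 1) * node k i) :> R by ring.
  by rewrite ler_wpM2r//; lra.
exact: (normr_dist_le2 c1 c2).
Qed.

End cell_means.

(** * The stopped values and the packing of their increments *)

Section stopping.
Context {R : realType}.
Implicit Types (k m n : nat) (i j l : int).
Variables (X : nat -> int -> R) (K : R).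
Hypothesis K0 : 0 < K.
Hypothesis X_root : forall i, `|X 0 i| <= 2 * K.
Hypothesis X_child : forall k i, `|X k.+1 i - X k (i %/ 2)%Z| <= 5 * K.
Hypothesis X_next : forall k i, `|X k i - X k (i + 1)| <= 10 * K.

(** All values at level 0 are 0, within [2 * K] of [X] by [X_root], so that the telescoping sum of
    increments has no initial term. *)
Fixpoint stopped k i : R :=
  if k is k'.+1 then
    let p := stopped k' (i %/ 2)%Z in
    if `|X k i - p| <= 2 * K then p else X k i
  else 0.

Definition jump k i : R :=
  if k is k'.+1 then (2 * K < `|X k i - stopped k' (i %/ 2)%Z|)%R%:R else 0.

(** Increments see more than jumps: at the midpoint of a cell the coarse interpolation is a mean of
    two neighbouring values, which may differ without any jump at the next level. *)
Definition discrepancy k i : R := (stopped k i != stopped k (i + 1))%:R.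

(** The coefficient at node l of the difference of consecutive interpolations. For even l the two
    parents coincide; for odd l their mean is the coarse interpolation at the midpoint. *)
Definition increment k l : R :=
  if k is k'.+1 then
    stopped k l - (stopped k' (l %/ 2)%Z + stopped k' ((l + 1) %/ 2)%Z) / 2
  else 0.

Lemma jump_ge0 k i : 0 <= jump k i.
Proof. by case: k => //= k; exact: ler0n. Qed.

Lemma discrepancy_le1 k i : discrepancy k i <= 1.
Proof. by rewrite /discrepancy; case: (_ != _); rewrite ?ler01. Qed.

Lemma stopped_close k i : `|X k i - stopped k i| <= 2 * K.
Proof.
case: k => [|k] /=; first by rewrite subr0 X_root.
by case: ifPn => // _; rewrite subrr normr0 mulr_ge0// ltW.
Qed.

Lemma stopped_child k i :
  `|stopped k.+1 i - stopped k (i %/ 2)%Z| <= 7 * K * jump k.+1 i.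
Proof.
rewrite /=; case: leP => h; first by rewrite subrr normr0 mulr0.
rewrite mulr1; apply: le_trans (ler_distD (X k (i %/ 2)%Z) _ _) _.
rewrite (_ : 7 * K = 5 * K + 2 * K); last by ring.
exact: lerD (X_child k i) (stopped_close k _).
Qed.

Lemma stopped_eq k i : jump k.+1 i = 0 -> stopped k.+1 i = stopped k (i %/ 2)%Z.
Proof.
by move=> j0; have := stopped_child k i; rewrite j0 mulr0 normr_le0 subr_eq0 => /eqP.
Qed.

Lemma jump_cases k i : jump k.+1 i = 0 \/ jump k.+1 i = 1.
Proof. by rewrite /=; case: (_ < _); [right|left]. Qed.

Lemma stopped_next k i : `|stopped k i - stopped k (i + 1)| <= 14 * K * discrepancy k i.
Proof.
have [e|ne] := eqVneq (stopped k i) (stopped k (i + 1)).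
  rewrite e subrr normr0; apply: mulr_ge0; last exact: ler0n.
  by apply: mulr_ge0 => //; exact: ltW.
rewrite /discrepancy ne mulr1; apply: le_trans (ler_distD (X k i) _ _) _.
apply: le_trans (lerD (lexx _) (ler_distD (X k (i + 1)) _ _)) _.
rewrite (distrC (stopped k i) (X k i)).
rewrite (_ : 14 * K = 2 * K + (10 * K + 2 * K)); last by ring.
exact: lerD (stopped_close k i) (lerD (X_next k i) (stopped_close k _)).
Qed.

Lemma stopped_next_le k i : `|stopped k i - stopped k (i + 1)| <= 14 * K.
Proof.
apply: le_trans (stopped_next k i) _; rewrite ler_piMr ?discrepancy_le1//.
by rewrite mulr_ge0// ltW.
Qed.

Lemma incrementS k l : increment k.+1 l =
  stopped k.+1 l - (stopped k (l %/ 2)%Z + stopped k ((l + 1) %/ 2)%Z) / 2.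
Proof. by []. Qed.

Lemma increment_even k j : `|increment k.+1 (2 * j)| <= 7 * K * jump k.+1 (2 * j).
Proof.
rewrite incrementS half_even half_odd.
have -> : stopped k.+1 (2 * j) - (stopped k j + stopped k j) / 2 =
  stopped k.+1 (2 * j) - stopped k j.
  by move: (stopped k.+1 _) (stopped k j) => x y; field.
by have := stopped_child k (2 * j); rewrite half_even.
Qed.

Lemma half_succ_odd j : ((2 * j + 1 + 1) %/ 2)%Z = j + 1.
Proof. by rewrite -addrA (_ : 1 + 1 = 2 * 1 :> int)// -mulrDr half_even. Qed.

Lemma increment_odd k j : `|increment k.+1 (2 * j + 1)| <=
  7 * K * (jump k.+1 (2 * j + 1) + discrepancy k j).
Proof.
rewrite incrementS half_odd half_succ_odd.
have -> : stopped k.+1 (2 * j + 1) - (stopped k j + stopped k (j + 1)) / 2 =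
  (stopped k.+1 (2 * j + 1) - stopped k j) + (stopped k j - stopped k (j + 1)) / 2.
  by move: (stopped k.+1 _) (stopped k j) (stopped k (j + 1)) => x y z; field.
apply: le_trans (ler_normD _ _) _; rewrite mulrDr lerD//.
  by have := stopped_child k (2 * j + 1); rewrite half_odd.
rewrite normrM (@ger0_norm _ 2^-1)// ler_pdivrMr//.
by apply: le_trans (stopped_next k j) _; lra.
Qed.

Lemma increment_le k l : `|increment k l| <= 14 * K.
Proof.
have K1 := ltW K0; case: k => [|k]; first by rewrite normr0 mulr_ge0.
have j1 i : jump k.+1 i <= 1 by have [->|->] := jump_cases k i.
have d1 := discrepancy_le1 k.
have [j [->|->]] := half_cases l.
  by apply: le_trans (increment_even k j) _; have := j1 (2 * j); nra.
by apply: le_trans (increment_odd k j) _; have := j1 (2 * j + 1); have := d1 j; nra.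
Qed.

End stopping.

Section increments.
Context {R : realType}.
Implicit Types (k m n : nat) (i j l : int).
Variables (X : nat -> int -> R) (K : R).
Hypothesis K0 : 0 < K.
Hypothesis X_root : forall i, `|X 0 i| <= 2 * K.
Hypothesis X_child : forall k i, `|X k.+1 i - X k (i %/ 2)%Z| <= 5 * K.
Hypothesis X_next : forall k i, `|X k i - X k (i + 1)| <= 10 * K.

Local Notation stopped := (stopped X K).
Local Notation jump := (jump X K).
Local Notation discrepancy := (discrepancy X K).
Local Notation increment := (increment X K).

Lemma tree_sumS (F : nat -> int -> R) n m j : tree_sum F n.+1 m j =
  (2 ^+ m.+1)^-1 * (F m.+1 (2 * j) + F m.+1 (2 * j + 1)) +
  (tree_sum F n m.+1 (2 * j) + tree_sum F n m.+1 (2 * j + 1)).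
Proof. by []. Qed.

Lemma jump_le1 k i : jump k.+1 i <= 1.
Proof. by case: (jump_cases X K k i) => ->. Qed.

Lemma discrepancy_ge0 k i : 0 <= discrepancy k i.
Proof. exact: ler0n. Qed.

Lemma discrepancy_even k j :
  discrepancy k.+1 (2 * j) <= jump k.+1 (2 * j) + jump k.+1 (2 * j + 1).
Proof.
have := jump_ge0 X K k.+1 (2 * j); have := jump_ge0 X K k.+1 (2 * j + 1).
have [J0|->] := jump_cases X K k (2 * j); last first.
  by move=> h _; apply: le_trans (discrepancy_le1 _ _ _ _) _; rewrite lerDl.
have [J1|->] := jump_cases X K k (2 * j + 1); last first.
  by move=> _ h; apply: le_trans (discrepancy_le1 _ _ _ _) _; rewrite lerDr.
move=> h1 h2; rewrite /discrepancy (stopped_eq K0 X_root X_child J0) (stopped_eq K0 X_root X_child J1) half_even half_odd eqxx.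
exact: addr_ge0.
Qed.

(** The cells 2 j + 1 and 2 j + 2 have the different parents j and j + 1, so they may inherit a
    difference of the parents, whereas the pair 2 j, 2 j + 1 cannot. *)
Lemma discrepancy_odd k j : discrepancy k.+1 (2 * j + 1) <=
  discrepancy k j + (jump k.+1 (2 * j + 1) + jump k.+1 (2 * j + 1 + 1)).
Proof.
have := jump_ge0 X K k.+1 (2 * j + 1); have := jump_ge0 X K k.+1 (2 * j + 1 + 1).
have d0 := discrepancy_ge0 k j.
have [J0|->] := jump_cases X K k (2 * j + 1); last first.
  move=> h _; apply: le_trans (discrepancy_le1 _ _ _ _) _.
  by rewrite addrCA lerDl addr_ge0.
have [J1|->] := jump_cases X K k (2 * j + 1 + 1); last first.
  move=> _ h; apply: le_trans (discrepancy_le1 _ _ _ _) _.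
  by rewrite addrA lerDr addr_ge0.
move=> h1 h2; rewrite {1}/discrepancy (stopped_eq K0 X_root X_child J0) (stopped_eq K0 X_root X_child J1) half_odd half_succ_odd.
by rewrite lerDl addr_ge0.
Qed.

Fixpoint spine_sum n m j : R :=
  if n is n'.+1 then (2 ^+ m.+1)^-1 * jump m.+1 (2 * j) + spine_sum n' m.+1 (2 * j)
  else 0.

Lemma spine_sum_ge0 n m j : 0 <= spine_sum n m j.
Proof.
elim: n m j => //= n IH m j.
by rewrite addr_ge0// mulr_ge0 ?jump_ge0// invr_ge0 exprn_ge0.
Qed.

Lemma spine_sum_le n m j : spine_sum n m j <= (2 ^+ m)^-1.
Proof.
elim: n m j => [|n IH] m j /=; first by rewrite invr_ge0 exprn_ge0.
have p0 : 0 < (2 ^+ m.+1)^-1 :> R by rewrite invr_gt0 exprn_gt0.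
have -> : (2 ^+ m)^-1 = (2 ^+ m.+1)^-1 + (2 ^+ m.+1)^-1 :> R.
  by rewrite exprS invfM; move: ((2 ^+ m)^-1) => x; field.
rewrite lerD// -[leRHS]mulr1 ler_pM2l//.
exact: jump_le1.
Qed.

(** Shifting indices by one removes, in each generation, the leftmost descendant of cell j and adds
    the leftmost descendant of cell j + 1. These are the two spines; each sums to at most 2^-m by
    the geometric series. *)
Lemma tree_sum_shift n m j :
  tree_sum (fun k l => jump k (l + 1)) n m j + spine_sum n m j =
  tree_sum jump n m j + spine_sum n m (j + 1).
Proof.
elim: n m j => [|n IH] m j //=.
have h0 := IH m.+1 (2 * j); have h1 := IH m.+1 (2 * j + 1).
rewrite (_ : 2 * (j + 1) = 2 * j + 1 + 1); last by rewrite mulrDr mulr1 -addrA.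
move: h0 h1; set w := (2 ^+ m.+1)^-1.
move: (jump m.+1 (2 * j)) (jump m.+1 (2 * j + 1)) (jump m.+1 (2 * j + 1 + 1)) => a b c.
by lra.
Qed.

(** The discrepancy of the root cell acts as a potential with weight 2^-m: half of it pays for the
    increment at the odd child, the other half is handed down to the discrepancy of that child.
    Jumps in the adjacent cell enter through the shifted sum. *)
Lemma tree_sum_increment n m j :
  tree_sum (fun k l => `|increment k l|) n m j <=
  7 * K * (2 * tree_sum jump n m j + discrepancy m j / 2 ^+ m +
           tree_sum (fun k l => jump k (l + 1)) n m j).
Proof.
elim: n m j => [|n IH] m j.
  rewrite /= mulr0 add0r addr0 mulr_ge0 ?divr_ge0 ?discrepancy_ge0 ?exprn_ge0//.
  by rewrite mulr_ge0// ltW.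
have w0 : 0 < (2 ^+ m.+1)^-1 :> R by rewrite invr_gt0 exprn_gt0.
have wE : (2 ^+ m)^-1 = 2 * (2 ^+ m.+1)^-1 :> R.
  by rewrite exprS invfM; move: ((2 ^+ m)^-1) => x; field.
have := IH m.+1 (2 * j); have := IH m.+1 (2 * j + 1).
have := increment_even K0 X_root X_child m j.
have := increment_odd K0 X_root X_child X_next m j.
have := discrepancy_even m j; have := discrepancy_odd m j.
rewrite !tree_sumS wE.
set w := (2 ^+ m.+1)^-1 in w0 *.
move: (jump m.+1 (2 * j)) (jump m.+1 (2 * j + 1)) (jump m.+1 (2 * j + 1 + 1)) => a b c.
move: (discrepancy m j) (discrepancy m.+1 (2 * j)) (discrepancy m.+1 (2 * j + 1)) => d d0 d1.
move: (`|increment m.+1 (2 * j)|) (`|increment m.+1 (2 * j + 1)|) => v0 v1.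
move: (tree_sum (fun k l => `|_|) n m.+1 (2 * j)) (tree_sum (fun k l => `|_|) n m.+1 (2 * j + 1)) => t0 t1.
move: (tree_sum jump n m.+1 (2 * j)) (tree_sum jump n m.+1 (2 * j + 1)) => t2 t3.
move: (tree_sum _ n m.+1 (2 * j)) (tree_sum _ n m.+1 (2 * j + 1)) => t4 t5.
move=> h1 h2 h3 h4 h5 h6.
have K7 : 0 <= 7 * K by rewrite mulr_ge0// ltW.
apply: (@le_trans _ _ (w * (7 * K * a + 7 * K * (b + d)) +
  (7 * K * (2 * t2 + d0 * w + t4) + 7 * K * (2 * t3 + d1 * w + t5)))).
  by rewrite lerD//; [rewrite ler_pM2l// lerD|rewrite lerD].
have -> : w * (7 * K * a + 7 * K * (b + d)) +
  (7 * K * (2 * t2 + d0 * w + t4) + 7 * K * (2 * t3 + d1 * w + t5)) =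
  7 * K * (w * (a + b + d) + (2 * t2 + t4 + (2 * t3 + t5)) + w * (d0 + d1)) by ring.
apply: ler_wpM2l => //.
have : w * (d0 + d1) <= w * (d + a + 2 * b + c) by rewrite ler_pM2l//; lra.
by lra.
Qed.

Section packing.
(** To be read as follows: [osc k i c] is the integral of |f - c| over the cell, [len] its length
    and [nd] its left endpoint. *)
Variables (osc : nat -> int -> R -> R) (len nd : nat -> int -> R).
Hypothesis nd_gt0 : forall k i, 0 < nd k i.
Hypothesis nd_even : forall k j, nd k j <= nd k.+1 (2 * j).
Hypothesis nd_odd : forall k j, nd k j <= nd k.+1 (2 * j + 1).
Hypothesis len_ge : forall k i, nd k i / 2 ^+ k <= len k i.
Hypothesis len_le : forall k i, len k i <= 4 * nd k i / 2 ^+ k.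
Hypothesis osc_split : forall k j c,
  osc k j c = osc k.+1 (2 * j) c + osc k.+1 (2 * j + 1) c.
Hypothesis osc_ge0 : forall k i c, 0 <= osc k i c.
Hypothesis osc_X : forall k i, osc k i (X k i) <= K * len k i.
Hypothesis osc_ge : forall k i c, `|X k i - c| * len k i <= osc k i c.
Hypothesis osc_le : forall k i c, osc k i c <= osc k i (X k i) + `|X k i - c| * len k i.

(* A jump lowers the oscillation around the stopped value by at least K times
   the length of the cell. *)
Lemma osc_jump k i : K * jump k.+1 i * len k.+1 i + osc k.+1 i (stopped k.+1 i) <=
  osc k.+1 i (stopped k (i %/ 2)%Z).
Proof.
have [J0|J1] := jump_cases X K k i.
  by rewrite J0 mulr0 mul0r add0r (stopped_eq K0 X_root X_child J0).
have hX := osc_X k.+1 i; have hp := osc_ge k.+1 i (stopped k (i %/ 2)%Z).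
have J1' := J1; rewrite J1 mulr1; move: J1' => /=; case: leP => [_ /eqP|h _].
  by rewrite eq_sym oner_eq0.
have l0 : 0 < len k.+1 i.
  by apply: lt_le_trans (len_ge _ _); rewrite divr_gt0 ?nd_gt0 ?exprn_gt0.
apply: le_trans hp.
(* Around the parent value the oscillation is at least 2 K times the length, because the jump
   exceeds 2 K; around the new value [X] it is at most K times the length. *)
apply: (@le_trans _ _ (2 * K * len k.+1 i)); last by rewrite ler_pM2r// ltW.
move: (len k.+1 i) (osc k.+1 i (X k.+1 i)) hX l0 => x y hX l0; lra.
Qed.

(** Each jump is paid for by a loss of oscillation. Exponential cells of one generation have
    different lengths, so a common lower bound [w] of the left endpoints is fixed for the whole
    induction and replaces them. *)
Lemma tree_sum_jump_osc n m j w : 0 <= w -> w <= nd m j ->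
  K * w * tree_sum jump n m j <= osc m j (stopped m j).
Proof.
elim: n m j => [|n IH] m j w0 wm; first by rewrite /= mulr0.
have e0 := IH m.+1 (2 * j) w0 (le_trans wm (nd_even _ _)).
have e1 := IH m.+1 (2 * j + 1) w0 (le_trans wm (nd_odd _ _)).
have := osc_jump m (2 * j); have := osc_jump m (2 * j + 1).
rewrite half_even half_odd [osc m j _]osc_split.
have l0 : w / 2 ^+ m.+1 <= len m.+1 (2 * j).
  by apply: le_trans (len_ge _ _); rewrite ler_wpM2r ?invr_ge0 ?exprn_ge0// (le_trans wm).
have l1 : w / 2 ^+ m.+1 <= len m.+1 (2 * j + 1).
  by apply: le_trans (len_ge _ _); rewrite ler_wpM2r ?invr_ge0 ?exprn_ge0// (le_trans wm).
have J0 := jump_ge0 X K m.+1 (2 * j); have J1 := jump_ge0 X K m.+1 (2 * j + 1).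
rewrite tree_sumS.
move: J0 J1 l0 l1 e0 e1.
move: (tree_sum _ n m.+1 (2 * j)) (tree_sum _ n m.+1 (2 * j + 1)) (osc m.+1 (2 * j) (stopped m.+1 _)) (osc m.+1 (2 * j + 1) (stopped m.+1 _)) => t0 t1 o0 o1.
move: (osc m.+1 (2 * j) _) (osc m.+1 (2 * j + 1) _) (len m.+1 (2 * j)) (len m.+1 (2 * j + 1)) (jump m.+1 (2 * j)) (jump m.+1 (2 * j + 1)) => p0 p1 x0 x1 a b.
move: (2 ^- m.+1) => q a0 b0 l0 l1 e0 e1 h1 h0.
have k0 : K * a * (w * q) <= K * a * x0 by rewrite ler_wpM2l// mulr_ge0// ltW.
have k1 : K * b * (w * q) <= K * b * x1 by rewrite ler_wpM2l// mulr_ge0// ltW.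
have -> : K * w * (q * (a + b) + (t0 + t1)) = K * a * (w * q) + K * b * (w * q) + K * w * t0 + K * w * t1 by ring.
lra.
Qed.

(** 12 = 3 * 4: around the stopped value the oscillation on the root cell is at most (1 + 2) K times
    its length, and the length is at most 4 [nd] / 2^m. *)
Lemma tree_sum_jump n m j : tree_sum jump n m j <= 12 / 2 ^+ m.
Proof.
have n0 := nd_gt0 m j.
have h := tree_sum_jump_osc n (ltW n0) (lexx (nd m j)).
have Kn : 0 < K * nd m j by rewrite mulr_gt0.
rewrite -(ler_pM2l Kn); apply: le_trans h _.
apply: le_trans (osc_le _ _ _) _.
have l0 : 0 <= len m j.
  by apply: le_trans (len_ge _ _); rewrite divr_ge0 ?exprn_ge0// ltW.
have hs := ler_wpM2r l0 (stopped_close K0 X_root m j).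
have hl := len_le m j.
apply: le_trans (lerD (osc_X m j) hs) _.
have -> : K * nd m j * (12 / 2 ^+ m) = 3 * K * (4 * nd m j / 2 ^+ m).
  by move: (2 ^- m) => q; ring.
have -> : K * len m j + 2 * K * len m j = 3 * K * len m j by ring.
by rewrite ler_pM2l// mulr_gt0.
Qed.

(** 266 = 7 * 38, and 38 = 2 * 12 + 1 + 13: twice the jumps, the discrepancy of the root, and the
    shifted jumps with one spine. *)
Lemma tree_sum_increment_le n m j :
  tree_sum (fun k l => `|increment k l|) n m j <= 266 * K / 2 ^+ m.
Proof.
apply: le_trans (tree_sum_increment n m j) _.
have K7 : 0 < 7 * K by rewrite mulr_gt0.
have -> : 266 * K / 2 ^+ m = 7 * K * (38 / 2 ^+ m) by move: (2 ^- m) => q; ring.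
rewrite ler_pM2l//.
have h1 := tree_sum_jump n m j; have h2 := tree_sum_shift n m j.
have h3 := spine_sum_ge0 n m j; have h4 := spine_sum_le n m (j + 1).
have h5 : discrepancy m j / 2 ^+ m <= (2 ^+ m)^-1.
  by rewrite ler_piMl ?invr_ge0 ?exprn_ge0// discrepancy_le1.
move: h1 h2 h3 h4 h5; move: (discrepancy m j / _) (spine_sum _ _ _) (spine_sum _ _ _) => x y z.
move: (tree_sum jump n m j) (tree_sum _ n m j) (2 ^- m) => a b q; lra.
Qed.

End packing.
End increments.

Section dyadic_approximation.
Context {R : realType}.
Local Notation leb := (@lebesgue_measure R).
Implicit Types (k m n : nat) (i j l : int).

Lemma floor_double (u : R) : Num.floor (2 * u) = 2 * Num.floor u \/
  Num.floor (2 * u) = 2 * Num.floor u + 1.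
Proof.
have /andP[u1 u2] := floor_itv u; rewrite intrD mulr1z in u2.
have [h|h] := ltP (2 * u) ((2 * Num.floor u + 1)%:~R : R); [left|right].
  by apply: floor_def; rewrite h intrM mulrzl andbT; move: u1; move: (_%:~R) => x; lra.
apply: floor_def; rewrite h !intrD intrM /=.
by move: u2; move: (_%:~R) => x; lra.
Qed.

Section telescoping.
Variables (X : nat -> int -> R) (K : R).

Lemma interpolation_increment k (u : R) :
  interpolation (stopped X K k.+1) (2 * u) =
  interpolation (stopped X K k) u + interpolation (increment X K k.+1) (2 * u).
Proof.
rewrite /interpolation; set i := Num.floor u.
case: (floor_double u) => ->; rewrite -/i !incrementS ?half_succ_odd ?half_odd ?half_even.
  move: (stopped X K k.+1 (2 * i)) (stopped X K k.+1 (2 * i + 1)) => a b.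
  move: (stopped X K k i) (stopped X K k (i + 1)) => c d.
  by rewrite intrM; field.
have -> : 2 * i + 1 + 1 = 2 * (i + 1) by rewrite mulrDr mulr1 -addrA.
rewrite half_odd.
move: (stopped X K k.+1 (2 * i + 1)) (stopped X K k.+1 (2 * (i + 1))) => a b.
move: (stopped X K k i) (stopped X K k (i + 1)) => c d.
by rewrite intrD intrM; field.
Qed.

Lemma interpolation_stopped n (r : R) :
  interpolation (stopped X K n) (2 ^+ n * r) =
  \sum_(k < n) interpolation (increment X K k.+1) (2 ^+ k.+1 * r).
Proof.
elim: n => [|n IH].
  by rewrite big_ord0 /interpolation /= subrr mulr0 addr0.
by rewrite big_ord_recr/= -IH exprS -mulrA interpolation_increment.
Qed.

End telescoping.

Section bmo_function.
Variables (f : R -> R) (K : R).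
Hypothesis K0 : 0 < K.
Hypothesis fint : forall a : R, 0 < a -> leb.-integrable `]0, a[ (EFin \o f).
Hypothesis fK : bmo_bound f K.
Local Notation X := (cell_mean f).

Let root := cell_mean0 K0 fint fK.
Let child := cell_mean_child K0 fint fK.
Let next := cell_mean_next K0 fint fK.

Lemma increment_cell_mean_le k l : `|increment X K k l| <= 14 * K.
Proof. exact: increment_le. Qed.

Let osc k i c := \int[leb]_(y in cell k i) `|f y - c|.

Let facts k i := integrable_bounded_interval fint (bounded_interval_cell k i).

Let osc_int k i c : leb.-integrable (cell k i) (EFin \o (fun y => `|f y - c|)).
Proof. by have [mc fc ic] := facts k i; exact: integrable_dist. Qed.

Let osc_le k i c : osc k i c <= osc k i (X k i) + `|X k i - c| * itv_length (cell k i).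
Proof.
have [mc fc ic] := facts k i.
have muIf : leb (cell k i) \is a fin_num by rewrite ge0_fin_numE.
have ick (r : R) : leb.-integrable (cell k i) (EFin \o (fun=> r)) by exact: integrable_cst_itv.
apply: (@le_trans _ _ (\int[leb]_(y in cell k i) (`|f y - X k i| + `|X k i - c|))).
  apply: le_Rintegral => //.
    rewrite (_ : _ \o _ = (EFin \o (fun y => `|f y - X k i|%R)) \+ cst (`|X k i - c|%R)%:E)%E//.
    by apply: integrableD => //; exact: integrable_cst_itv.
  by move=> y _; exact: ler_distD.
by rewrite RintegralD ?Rintegral_cst//; exact: osc_int.
Qed.

Lemma tree_sum_increment_cell_mean n m j :
  tree_sum (fun k l => `|increment X K k l|) n m j <= 266 * K / 2 ^+ m.
Proof.
apply: (@tree_sum_increment_le R X K K0 root child next osc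
  (fun k i => itv_length (cell k i)) (@node R)).
- exact: node_gt0.
- by move=> k i; rewrite node_double.
- by move=> k i; rewrite -[leLHS]node_double ltW// node_lt.
- exact: itv_length_cell_ge.
- exact: itv_length_cell_le.
- move=> k i c; rewrite /osc cell_split Rintegral_setU//.
  + exact: measurable_cell.
  + exact: measurable_cell.
  + by rewrite -cell_split; exact: osc_int.
  + exact: disjoint_children.
- by move=> k i c; apply: Rintegral_ge0 => y _.
- by move=> k i; exact: oscillation_le (bounded_interval_cell k i).
- move=> k i c; have [mc fc ic] := facts k i.
  by apply: mean_dist_le => //; exact: itv_length_cell_gt0.
- exact: osc_le.
Qed.

(* Nice shrinking is required at every point of the line, hence the balls at
   nonpositive points, where no cell is available. *)
Let shrinking_set (y : R) n : set R :=
  if 0 < y then cell n (Num.floor (2 ^+ n * ln y)) else ball y (2 ^+ n)^-1.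

Let cvg_pow2V : (fun n : nat => (2 ^+ n)^-1 : R) @ \oo --> (0 : R).
Proof.
rewrite (_ : (fun n => _) = geometric 1 (2^-1 : R)); last first.
  by apply/funext => n; rewrite /geometric /= mul1r exprVn.
by apply: cvg_geometric; rewrite ger0_norm// invf_lt1// ltr1n.
Qed.

Let nicely_shrinking_cells y : nicely_shrinking y (shrinking_set y).
Proof.
have p2 n : 0 < (2 ^+ n)^-1 :> R by rewrite invr_gt0 exprn_gt0.
rewrite /shrinking_set; have [y0|y0] := ltP 0 y; last first.
  split; first by move=> n; exact: measurable_ball.
  exists (1, fun n => PosNum (p2 n)); split => //=.
    by move=> n.
  by move=> n; rewrite mul1e.
split; first by move=> n; exact: measurable_cell.
pose i n := Num.floor (2 ^+ n * ln y).
have l0 n : 0 < 2 * itv_length (cell n (i n)) :> R by rewrite mulr_gt0// itv_length_cell_gt0.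
(* The ball about [y] of radius twice the length of the cell contains the cell and is 4 times as
   long. *)
exists (4, fun n => PosNum (l0 n)); split => //=.
- apply: (@squeeze_cvgr _ _ _ _ (cst 0) (fun n => 8 * y * (2 ^+ n)^-1)).
  + near=> n; rewrite (ltW (l0 n))/=.
    apply: (@le_trans _ _ (2 * (4 * node n (i n) / 2 ^+ n))); first by rewrite ler_wpM2l// itv_length_cell_le.
    have : node n (i n) <= y by have := cell_floor n y0; rewrite /cell/= in_itv/= => /andP[].
    have := p2 n; move: (2 ^- n) (node n (i n)) => q x q0 xy.
    have -> : 2 * (4 * x * q) = 8 * x * q by ring.
    by rewrite ler_pM2r// ler_pM2l.
  + exact: cvg_cst.
  + by rewrite -(mulr0 (8 * y)); apply: cvgMr; exact: cvg_pow2V.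
- move=> n z; have := cell_floor n y0; rewrite -/(i n) => cy cz.
  rewrite /ball/= itv_length_cell; move: cy cz; rewrite /cell/= !in_itv/=.
  have := node_lt (R := R) n (i n).
  move: (node n (i n)) (node n (i n + 1)) => a b ab /andP[y1 y2] /andP[z1 z2].
  by rewrite ltr_norml; apply/andP; split; lra.
- move=> n; rewrite lebesgue_measure_ball ?(ltW (l0 n))//.
  rewrite -[leb _]fineK; last first.
    by have [mc fc ic] := facts n (i n); rewrite ge0_fin_numE.
  rewrite -EFinM lee_fin -/(itv_length _) -/(i n) mulr2n.
  by move: (itv_length _) => z; lra.
Unshelve. all: by end_near. Qed.

(** Lebesgue differentiation along the cells, applied to the truncations of [f] to ]0, A + 1[, which
    are locally integrable on the line, for all [A] simultaneously. *)
Lemma cell_mean_cvg_ae :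
  {ae leb, forall x, 0 < x ->
     (fun n => X n (Num.floor (2 ^+ n * ln x))) @ \oo --> f x}.
Proof.
have loc (A : nat) : locally_integrable [set: R] (fun x => f x * \1_(`]0, A%:R + 1[) x).
  have A0 : 0 < A%:R + 1 :> R by rewrite ltr_wpDl.
  have iA := fint A0.
  have mf : measurable_fun (`]0, A%:R + 1[ : set R) f.
    by move/integrableP : iA => [/measurable_EFinP].
  have E : (fun x => f x * \1_(`]0, A%:R + 1[) x) = f \_ `]0, A%:R + 1[.
    apply/funext => x; rewrite /patch indicE.
    by case: (x \in _); rewrite ?mulr1 ?mulr0.
  have mg : measurable_fun [set: R] (fun x => f x * \1_(`]0, A%:R + 1[) x).
    by rewrite E; apply/(measurable_restrictT _ _).1.
  split => //; first exact: openT.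
  move=> C _ cC.
  have mC : measurable (C : set (measurableTypeR R)) by exact: compact_measurable.
  move/integrableP : iA => [_]; apply: le_lt_trans.
  rewrite [leRHS]integral_mkcond; apply: (@le_trans _ _ (\int[leb]_x `|(f x * \1_(`]0, A%:R + 1[) x)%:E|)%E).
    by apply: ge0_subset_integral => //; apply/measurable_EFinP; apply: measurableT_comp.
  rewrite le_eqVlt; apply/orP; left; apply/eqP; apply: eq_integral => x _.
  rewrite /patch indicE; case: (x \in _); rewrite ?mulr1 ?mulr0//.
  by rewrite /= normr0.
have aeA : {ae leb, forall x, forall A : nat, lebesgue_pt (fun x => f x * \1_(`]0, A%:R + 1[) x) x}.
  by apply/ae_foralln => A; exact: lebesgue_differentiation.
apply: (@filterS _ _ (ae_filter_ringOfSetsType _)) aeA => x hx x0.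
(* Every cell containing [x] lies below 4 x, as [ratio] is at most 4; there the truncation does not
   alter [f]. *)
pose A := Num.truncn (4 * x).
have xA : 4 * x < A%:R + 1 by rewrite natr1 truncnS_gt.
have := nice_lebesgue_differentiation nicely_shrinking_cells (loc A) (hx A).
rewrite /shrinking_set x0.
have inA : `]0, A%:R + 1[%classic x by rewrite /= in_itv/= x0/= (lt_trans _ xA)// ltr_pMl// ltr1n.
rewrite indicE mem_set// mulr1.
move/fine_cvgP => [_]; apply: cvg_trans; apply: near_eq_cvg; near=> n => /=.
set i := Num.floor _.
have [mc fc ic] := facts n i; have l0 := itv_length_cell_gt0 (R := R) n i.
have sub : (cell n i : set R) `<=` `]0, A%:R + 1[%classic.
  have := cell_floor n x0; rewrite -/i /cell/= => cx z; move: cx; rewrite /= !in_itv/=.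
  move=> /andP[nx _] /andP[nz zn]; rewrite (lt_le_trans (node_gt0 n i) nz)/=.
  apply: lt_trans zn _; rewrite nodeS; apply: le_lt_trans xA.
  have := ratio_le (R := R) n; have := ratio_gt1 (R := R) n; have := node_gt0 (R := R) n i.
  by move: (node n i) (ratio n) nx => a q; nra.
rewrite /cell_mean /mean.
have -> : (\int[leb]_(y in cell n i) (f y * \1_(`]0, A%:R + 1[) y)%:E)%E =
    (\int[leb]_(y in cell n i) f y)%:E.
  rewrite /Rintegral fineK; last exact: integrable_fin_num.
  apply: eq_integral => y; rewrite inE => cy; rewrite indicE mem_set ?mulr1//.
  exact: sub.
rewrite -[leb _]fineK ?ge0_fin_numE// -/(itv_length _) inver gt_eqF//.
Unshelve. all: by end_near. Qed.

(** The cell mean is within 2 K of the stopped value, and the interpolation within 14 K of it.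
    Existence of the limit is left as a premise: it will come from the convergence of the
    balayage. *)
Lemma ae_dist_interpolation_limit :
  {ae leb, forall x, 0 < x -> forall L : R,
     (fun n => interpolation (stopped X K n) (2 ^+ n * ln x)) @ \oo --> L ->
     `|f x - L| <= 16 * K}.
Proof.
apply: (@filterS _ _ (ae_filter_ringOfSetsType _)) cell_mean_cvg_ae => x hx x0 L hL.
have h : (fun n => `|X n (Num.floor (2 ^+ n * ln x)) -
    interpolation (stopped X K n) (2 ^+ n * ln x)|) @ \oo --> `|f x - L|.
  by apply: cvg_norm; apply: cvgB => //; exact: hx.
apply: (cvgr_to_le h); near=> n => /=.
set u := 2 ^+ n * ln x; rewrite /interpolation; set i := Num.floor u.
have /andP[u1 u2] := floor_itv u; rewrite intrD mulr1z -/i in u1 u2.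
rewrite (_ : 16 * K = 2 * K + 14 * K); last by ring.
have s1 := stopped_close K0 root n i; have s2 := stopped_next_le K0 root next n i.
rewrite opprD addrA; apply: le_trans (ler_normB _ _) _; apply: lerD => //.
rewrite normrM distrC in s2 *.
apply: le_trans s2; rewrite ler_piMl// ger0_norm ?subr_ge0//; lra.
Unshelve. all: by end_near. Qed.

End bmo_function.
End dyadic_approximation.

(** * The measures carried by rays *)

Lemma nneseries_le_bound {R : realType} (a : nat -> \bar R) (B : \bar R) :
  (forall k, 0 <= a k)%E -> (forall N, \sum_(k < N) a k <= B)%E -> (\sum_(k <oo) a k <= B)%E.
Proof.
move=> a0 aB; apply: lime_le; first by apply: is_cvg_nneseries => k _ _.
by apply: nearW => N; rewrite big_mkord.
Qed.

Lemma count_levels (m d N : nat) : (\sum_(k < N) (m < k + d)%N <= N + d - m)%N.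
Proof.
elim: N => [|N IH]; first by rewrite big_ord0.
rewrite big_ord_recr/=; move: IH; set S := (\sum_(_ < N) _)%N; clearbody S.
by case: (ltnP m (N + d)) => h /=; lia.
Qed.

Lemma expn3_le (i : nat) : (3 ^ i <= 2 ^ (2 * i))%N.
Proof. by rewrite expnM; elim: i => // i IH; rewrite !expnS leq_mul. Qed.

Lemma level_split (k c a m : nat) : (k + (c + a).+1 <= m)%N ->
  m = (m - (k + (c + a).+1) + (k.+1 + c + a))%N.
Proof. lia. Qed.

(** Turns the linear number of coarse levels met by the n-th rays into a multiple of 2^n, which half
    of the decay 4^-n absorbs. *)
Lemma affine_le_expn (c a n : nat) : (c * n + a < (c + a).+1 * 2 ^ n)%N.
Proof.
have h : (n < 2 ^ n)%N by exact: ltn_expl.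
have h1 : (c * n <= c * 2 ^ n)%N by rewrite leq_mul2l ltnW// orbT.
have h2 : (a <= a * 2 ^ n)%N by rewrite leq_pmulr// expn_gt0.
rewrite mulSn mulnDl; move: h1 h2 h; move: (2 ^ n)%N (c * _)%N (a * _)%N (c * n)%N => z; lia.
Qed.

Section ray_measure.
Context {R : realType}.
Local Notation leb := (@lebesgue_measure R).
Local Notation T2 := ((measurableTypeR R * measurableTypeR R)%type).
Implicit Types (k m n : nat) (j l : int) (u : R).
Variables (V : nat -> int -> R) (M P : R) (e : R) (b a0 : nat).
Hypothesis VM : forall k l, `|V k l| <= M.
Hypothesis VP : forall n m j, tree_sum (fun k l => `|V k l|) n m j <= P / 2 ^+ m.
Hypotheses (e_gt0 : 0 < e) (e_ge : 1 <= e * 2 ^+ a0).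

(* Level k of the ray measures lives at the dyadic scale 2^-(k+1), in the
   coordinate u = 2^(k+1) ln y; its n-th piece is carried by the ray t = slope k n * y. *)
Definition scale k : R := (2 ^+ k.+1)^-1.

Definition width n : R := e * (3 ^ (b * n))%N%:R^-1.

Definition slope k n : R := scale k * width n.

Definition ray k n u : T2 := (expR (scale k * u), slope k n * expR (scale k * u)).

(** A common majorant, up to a constant, for the densities of both parts of the measure: the Neumann
    bound times dy/du for y = e^(scale u). *)
Definition ray_density k n u : R :=
  4^-1 ^+ n * step_envelope (V k.+1) u * (scale k * expR (scale k * u)).

Definition ray_mass k n (A : set T2) : \bar R :=
  (\int[leb]_u ((\1_A (ray k n u))%:E * (ray_density k n u)%:E))%E.

Lemma scale_gt0 k : 0 < scale k.
Proof. by rewrite invr_gt0 exprn_gt0. Qed.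

Lemma width_gt0 n : 0 < width n.
Proof. by rewrite mulr_gt0// invr_gt0 ltr0n expn_gt0. Qed.

Lemma slope_gt0 k n : 0 < slope k n.
Proof. by rewrite mulr_gt0 ?scale_gt0 ?width_gt0. Qed.

Lemma measurable_expR_scale k : measurable_fun [set: R] (fun u => expR (scale k * u)).
Proof.
apply: (@measurableT_comp _ _ _ _ _ _ (@expR R)).
  by apply: continuous_measurable_fun; exact: continuous_expR.
exact: measurable_funM.
Qed.

Lemma measurable_ray k n : measurable_fun [set: R] (ray k n).
Proof.
apply/measurable_fun_pairP; split => /=; first exact: measurable_expR_scale.
by apply: measurable_funM => //; exact: measurable_expR_scale.
Qed.

Lemma ray_density_ge0 k n u : 0 <= ray_density k n u.
Proof.
apply: mulr_ge0; apply: mulr_ge0.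
- by rewrite exprn_ge0// invr_ge0.
- exact: step_envelope_ge0.
- exact: ltW (scale_gt0 _).
- exact: expR_ge0.
Qed.

Lemma measurable_ray_density k n : measurable_fun [set: R] (ray_density k n).
Proof.
apply: measurable_funM.
  by apply: measurable_funM => //; exact: measurable_step_envelope.
by apply: measurable_funM => //; exact: measurable_expR_scale.
Qed.

Lemma measurable_indic_ray k n (A : set T2) : measurable A ->
  measurable_fun [set: R] (fun u => \1_A (ray k n u) : R).
Proof.
by move=> mA; apply: measurableT_comp => //; exact: measurable_ray.
Qed.

Lemma measurable_ray_integrand k n (A : set T2) : measurable A ->
  measurable_fun [set: R] (fun u => ((\1_A (ray k n u))%:E * (ray_density k n u)%:E)%E).
Proof.
move=> mA; apply: emeasurable_funM; apply/measurable_EFinP.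
  exact: measurable_indic_ray.
exact: measurable_ray_density.
Qed.

Let integrand_ge0 k n (A : set T2) u : (0 <= (\1_A (ray k n u))%:E * (ray_density k n u)%:E)%E.
Proof. by rewrite mule_ge0 ?lee_fin// ray_density_ge0. Qed.

Lemma ray_mass_ge0 k n A : (0 <= ray_mass k n A)%E.
Proof. by apply: integral_ge0 => u _. Qed.

Lemma ray_mass_le2 k n (A B C : set T2) : measurable A -> measurable B -> measurable C ->
  A `<=` B `|` C -> (ray_mass k n A <= ray_mass k n B + ray_mass k n C)%E.
Proof.
move=> mA mB mC ABC; rewrite /ray_mass -ge0_integralD//; last 2 first.
- exact: measurable_ray_integrand.
- exact: measurable_ray_integrand.
apply: ge0_le_integral => //.
- exact: measurable_ray_integrand.
- by apply: emeasurable_funD; exact: measurable_ray_integrand.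
move=> u _; rewrite -!EFinM -EFinD lee_fin -mulrDl ler_wpM2r ?ray_density_ge0//.
rewrite !indicE; have [Au|Au] := boolP (ray k n u \in A); last by rewrite addr_ge0.
have [Bu|Cu] := ABC _ (set_mem Au).
  by rewrite (mem_set Bu) lerDl.
by rewrite (mem_set Cu) lerDr.
Qed.

Definition column m j : set T2 := cell m j `*` [set: R].

Lemma measurable_column m j : measurable (column m j).
Proof. by apply: measurableX => //; exact: measurable_cell. Qed.

Lemma ray_mass_column k n m j :
  (ray_mass k n (column m j) <=
   (4^-1 ^+ n * node m (j + 1))%:E * envelope_integral V k.+1 m j)%E.
Proof.
have q0 : 0 <= 4^-1 ^+ n :> R by rewrite exprn_ge0// invr_ge0.
have n0 : 0 <= node m (j + 1) :> R by exact: ltW (node_gt0 _ _).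
have s0 := scale_gt0 k.
have mO : measurable_fun [set: R] (fun u => (step_envelope (V k.+1) u)%:E).
  by apply/measurable_EFinP; exact: measurable_step_envelope.
have O0 u : 0 <= step_envelope (V k.+1) u by exact: step_envelope_ge0.
rewrite /envelope_integral muleA -EFinM -/(scale k) -ge0_integralZl//; last 4 first.
- exact: measurable_rescaled_cell.
- exact: measurable_funTS.
- by move=> u _; rewrite lee_fin.
- by rewrite lee_fin !mulr_ge0// ltW.
rewrite [leRHS]integral_mkcond; apply: ge0_le_integral => //.
- by apply: measurable_ray_integrand; exact: measurable_column.
- apply/(measurable_restrictT _ _).1; first exact: measurable_rescaled_cell.
  by apply: measurable_funTS; apply: emeasurable_funM.
move=> u _; rewrite indicE; have [|_] := boolP (_ \in _); last first.
  rewrite mul0e /patch; case: ifP => // _.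
  by rewrite -EFinM lee_fin mulr_ge0// !mulr_ge0// ltW.
rewrite inE /column/ray => -[]/= + _; rewrite /cell/= in_itv/= => /andP[r1 r2].
have p1 : 0 < 2 ^+ k.+1 :> R by rewrite exprn_gt0.
have r1' : 2 ^+ k.+1 * (j%:~R / 2 ^+ m) <= u.
  by rewrite /node ler_expR /scale ler_pdivlMl in r1.
have r2' : u < 2 ^+ k.+1 * (j%:~R / 2 ^+ m) + 2 ^+ k.+1 / 2 ^+ m.
  move: r2; rewrite /node ltr_expR /scale ltr_pdivrMl// intrD mulrDl mul1r mulrDr.
  by [].
rewrite /patch mem_set; last by rewrite /rescaled_cell/= in_itv/= r1' r2'.
rewrite mul1e -EFinM lee_fin /ray_density.
have h := ltW r2; move: (O0 u) h.
move: (step_envelope _ _) (expR (scale k * u)) (node m (j + 1)) => O E N O1 h.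
move: (scale k) s0 => s s0.
have -> : 4^-1 ^+ n * N * s * O = 4^-1 ^+ n * O * (s * N) by ring.
by apply: ler_wpM2l; [exact: mulr_ge0|rewrite ler_pM2l].
Qed.

Local Notation Q := (envelope_packing_cst M P).

Let Q0 : 0 <= Q.
Proof.
have P0 : 0 <= P by have := VP 0 0 0; rewrite /= expr0 divr1.
have M0 : 0 <= M := le_trans (normr_ge0 _) (VM 0 0).
by rewrite addr_ge0// !mulr_ge0// pi_ge0.
Qed.

(** Packing controls the levels from [m] on, whose cells are shorter than the base of the column,
    since level k involves [V k.+1]. *)
Lemma sum_ray_mass_column N n m j :
  (\sum_(i < N) ray_mass (m + i) n (column m j) <=
   (4^-1 ^+ n * (node m (j + 1) * Q / 2 ^+ m))%:E)%E.
Proof.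
have q0 : 0 <= 4^-1 ^+ n * node m (j + 1) :> R.
  by apply: mulr_ge0; [rewrite exprn_ge0// invr_ge0|exact: ltW (node_gt0 _ _)].
apply: (@le_trans _ _ (\sum_(i < N) (4^-1 ^+ n * node m (j + 1))%:E *
    envelope_integral V (m.+1 + i) m j)%E).
  by apply: lee_sum => i _; exact: ray_mass_column.
rewrite -ge0_sume_distrr; last first.
  move=> i _; rewrite mule_ge0 ?lee_fin ?invr_ge0 ?exprn_ge0//.
  by apply: integral_ge0 => u _; rewrite lee_fin; exact: step_envelope_ge0.
have -> : 4^-1 ^+ n * (node m (j + 1) * Q / 2 ^+ m) =
    4^-1 ^+ n * node m (j + 1) * (Q / 2 ^+ m) :> R.
  by move: (node _ _) (2 ^- m) Q => x y z; ring.
rewrite [leRHS]EFinM; apply: lee_wpmul2l; first by rewrite lee_fin.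
exact: sum_envelope_integral.
Qed.

Let sum_quarter : (\sum_(n <oo) (4^-1 ^+ n : R)%:E <= 2%:E)%E.
Proof.
have := @nneseries_geometric R 1 4^-1 ler01 _.
under eq_eseriesr do rewrite mul1r.
move=> ->; last by apply/andP; split; lra.
by rewrite (_ : 1 / (1 - 4^-1) = 4 / 3 :> R) ?lee_fin; [lra|field].
Qed.

Let sum_half : (\sum_(n <oo) (2^-1 ^+ n : R)%:E = 2%:E)%E.
Proof.
have := @nneseries_geometric R 1 2^-1 ler01 _.
under eq_eseriesr do rewrite mul1r.
by move=> ->; [congr (_%:E); field|apply/andP; split; lra].
Qed.

Variable nu : {measure set T2 -> \bar R}.
Hypothesis nuE : forall A : set T2, measurable A ->
  nu A = (\sum_(k <oo) \sum_(n <oo) ray_mass k n A)%E.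

Lemma nu_interchange A : measurable A ->
  nu A = (\sum_(n <oo) \sum_(k <oo) ray_mass k n A)%E.
Proof.
move=> mA; rewrite (nuE mA).
by apply: nneseries_interchange => i j; exact: ray_mass_ge0.
Qed.

Lemma nu_column j : (nu (column 0 j) <= (2 * (node 0 (j + 1) * Q))%:E)%E.
Proof.
rewrite nu_interchange; last exact: measurable_column.
have nQ : 0 <= node 0 (j + 1) * Q by apply: mulr_ge0 => //; exact: ltW (node_gt0 _ _).
apply: (@le_trans _ _ (\sum_(n <oo) (node 0 (j + 1) * Q)%:E * (4^-1 ^+ n)%:E)%E).
  apply: lee_nneseries => [n _ _|n _]; first by apply: nneseries_ge0 => k _ _; exact: ray_mass_ge0.
  apply: nneseries_le_bound => [k|N]; first exact: ray_mass_ge0.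
  have := sum_ray_mass_column N n 0 j; rewrite expr0 divr1 -EFinM [(_ * 4^-1 ^+ n)%R]mulrC.
  by under eq_bigr do rewrite add0n.
rewrite nneseriesZl; last by move=> n _; rewrite lee_fin exprn_ge0// invr_ge0.
by rewrite [(2 * _)%R]mulrC [leRHS]EFinM; apply: lee_wpmul2l; rewrite ?lee_fin.
Qed.

(* Dyadic columns cover the strip {y <= x}. *)
Lemma nu_strip (A : set T2) (x : R) : 0 < x -> measurable A ->
  A `<=` `]0, x]%classic `*` [set: R] -> (nu A <= (16 * Q * x)%:E)%E.
Proof.
move=> x0 mA Ax.
pose J := Num.floor (ln x).
pose F (i : nat) := column 0 (J - i%:Z).
have cov : A `<=` \bigcup_i F i.
  move=> [y t] /Ax [/=]; rewrite in_itv/= => /andP[y0 yx] _.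
  have := cell_floor 0 y0; rewrite expr0 mul1r => cy.
  have fJ : Num.floor (ln y) <= J.
    by apply: le_floor; rewrite ler_ln ?posrE.
  exists (`|J - Num.floor (ln y)|%N) => //; rewrite /F /column; split => //=.
  by rewrite gez0_abs ?subr_ge0// opprB addrC subrK.
have mF i : measurable (F i) by exact: measurable_column.
have := @measure_sigma_subadditive _ _ _ nu A F mF mA cov.
move/le_trans; apply.
have nJ : node 0 (J + 1) <= 4 * x.
  rewrite nodeS; have := cell_floor 0 x0; rewrite expr0 mul1r -/J /cell/= in_itv/= => /andP[nx _].
  by apply: ler_pM => //; [exact: ltW (expR_gt0 _)|exact: ltW (node_gt0 _ _)|exact: ratio_le].
apply: (@le_trans _ _ (\sum_(i <oo) (2 * Q * (4 * x))%:E * (2^-1 ^+ i)%:E)%E).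
  apply: lee_nneseries => // i _; apply: le_trans (nu_column _) _.
  rewrite -EFinM lee_fin.
  have -> : 2 * (node 0 (J - i%:Z + 1) * Q) = 2 * Q * node 0 (J - i%:Z + 1).
    by rewrite (mulrC _ Q) mulrA.
  rewrite -(mulrA (2 * Q)); apply: ler_wpM2l; first by rewrite mulr_ge0.
  have -> : node 0 (J - i%:Z + 1) = node 0 (J + 1) * expR (- (i%:R : R)) :> R.
    rewrite /node expr0 !divr1 -expRD; congr expR.
    by rewrite !intrD mulrNz; ring.
  apply: ler_pM; [exact: ltW (node_gt0 _ _)|exact: expR_ge0|exact: nJ|].
  rewrite expRN exprVn lef_pV2 ?posrE ?expR_gt0 ?exprn_gt0//.
  rewrite -[i%:R]mulr1 expRM_natl; apply: lerXn2r; rewrite ?nnegrE ?expR_ge0//.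
  by apply: le_trans (expR_ge1Dx 1); lra.
rewrite nneseriesZl; last by move=> i _; rewrite lee_fin exprn_ge0// invr_ge0.
rewrite sum_half -EFinM lee_fin le_eqVlt; apply/orP; left; apply/eqP.
by move: Q => q; ring.
Qed.

(** A crude bound for a single ray, from the sup bound on the envelope and without packing. The
    range of u is enlarged by means of ln be <= ln al + (be - al) / al. *)
Lemma ray_mass_near (A : set T2) (al be : R) k n : measurable A -> 0 < al -> al < be ->
  A `<=` `[al, be]%classic `*` [set: R] ->
  (ray_mass k n A <= (4^-1 ^+ n * (40 * (pi * M)) * (be * ((be - al) / al)))%:E)%E.
Proof.
move=> mA al0 ab Aab.
have q0 : 0 <= 4^-1 ^+ n :> R by rewrite exprn_ge0// invr_ge0.
have M0 : 0 <= M := le_trans (normr_ge0 _) (VM 0 0).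
have N0 : 0 <= 40 * (pi * M) by rewrite mulr_ge0// mulr_ge0// pi_ge0.
have s0 := scale_gt0 k.
pose c : R := 4^-1 ^+ n * (40 * (pi * M)) * (scale k * be).
have be0 : 0 < be := lt_trans al0 ab.
have c0 : 0 <= c.
  by apply: mulr_ge0; apply: mulr_ge0 => //; exact: ltW.
pose x1 := ln al / scale k; pose x2 := (ln al + (be - al) / al) / scale k.
have d0 : 0 < (be - al) / al by rewrite divr_gt0// subr_gt0.
have x12 : x1 <= x2 by rewrite ler_pM2r ?invr_gt0// lerDl ltW.
apply: (@le_trans _ _ (\int[leb]_(u in `[x1, x2]) c%:E)%E); last first.
  rewrite integral_cst//= lebesgue_measure_itv/= lte_fin.
  have -> : x1 < x2 by rewrite ltr_pM2r ?invr_gt0// ltrDl.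
  rewrite -EFinD -EFinM lee_fin -mulrBl addrAC subrr add0r /c.
  move: (scale k) s0 => s s0; rewrite le_eqVlt; apply/orP; left; apply/eqP.
  by move: (@pi R) => p; field; rewrite !gt_eqF.
rewrite [leRHS]integral_mkcond; apply: ge0_le_integral => //.
- exact: measurable_ray_integrand.
- by apply/(measurable_restrictT _ _).1.
move=> u _; rewrite indicE; have [|_] := boolP (_ \in _); last first.
  by rewrite mul0e /patch; case: ifP; rewrite ?lee_fin.
rewrite inE => /Aab[/=]; rewrite in_itv/= => /andP[r1 r2] _.
have ux1 : x1 <= u by rewrite ler_pdivrMr// mulrC -ler_expR lnK ?posrE.
have ux2 : u <= x2.
  rewrite ler_pdivlMr// mulrC -ler_expR expRD lnK ?posrE//.
  apply: le_trans r2 _; apply: (@le_trans _ _ (al * (1 + (be - al) / al))).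
    by rewrite mulrDr mulr1 mulrCA divff ?gt_eqF// mulr1 addrC subrK.
  by rewrite ler_pM2l// expR_ge1Dx.
rewrite /patch mem_set; last by rewrite /= in_itv/= ux1 ux2.
rewrite mul1e lee_fin /ray_density /c.
have sE : scale k * expR (scale k * u) <= scale k * be by rewrite ler_pM2l.
apply: ler_pM => //.
- by apply: mulr_ge0 => //; exact: step_envelope_ge0.
- by rewrite mulr_ge0 ?expR_ge0// ltW.
- by apply: ler_wpM2l => //; exact: step_envelope_le.
Qed.

(* Only about n levels coarser than the interval meet its tent along the n-th rays. *)
Lemma ray_mass_coarse (A : set T2) (al be : R) k n m : measurable A -> 0 < al ->
  A `<=` `[al, be]%classic `*` `]0, (be - al)[%classic ->
  2 ^+ m * (be - al) <= al ->
  (k + (2 * b * n + a0).+1 <= m)%N -> ray_mass k n A = 0%E.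
Proof.
move=> mA al0 Aab ml km; apply: integral0_eq => u _.
rewrite indicE; have [|_] := boolP (_ \in _); last by rewrite mul0e.
rewrite inE => /Aab[/=]; rewrite !in_itv/= => /andP[r1 _] /andP[_ r2]; exfalso.
have s0 := slope_gt0 k n.
have h1 : slope k n * al < be - al by apply: le_lt_trans r2; rewrite ler_pM2l.
have p2 i : 0 < 2 ^+ i :> R by rewrite exprn_gt0.
(* As 3^(b n) <= 2^(2 b n) and [e_ge] holds, the slope is at least 2^-m; the ray then passes above
   the tent, whose height is at most 2^-m al. *)
have h2 : 1 <= 2 ^+ m * slope k n.
  have -> : m = ((m - (k + (2 * b * n + a0).+1)) + (k.+1 + 2 * b * n + a0))%N by exact: level_split.
  rewrite !exprD /slope /scale /width.
  have e1 : (3 ^ (b * n))%N%:R <= 2 ^+ (2 * b * n) :> R.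
    by rewrite -natrX ler_nat -mulnA expn3_le.
  have e0 : 0 < (3 ^ (b * n))%N%:R :> R by rewrite ltr0n expn_gt0.
  have one (i : nat) : 1 <= 2 ^+ i :> R by rewrite exprn_ege1// ler1n.
  have o1 := one (m - (k + (2 * b * n + a0).+1))%N.
  move: (one (m - (k + (2 * b * n + a0).+1))%N) e_ge e1 e0 (p2 k.+1) (p2 a0) (p2 (2 * b * n)%N).
  move: (2 ^+ (m - _)) (2 ^+ k.+1) (2 ^+ (2 * b * n)) (2 ^+ a0) (3 ^ _)%:R => x y z t w.
  move=> x1 et wz w0 y0 t0 z0.
  have -> : x * (y * z * t) * (y^-1 * (e * w^-1)) = x * ((e * t) * (z / w)).
    by field; rewrite !gt_eqF.
  have zw : 1 <= z / w by rewrite ler_pdivlMr// mul1r.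
  by rewrite mulr_ege1// mulr_ege1.
have l0 : 0 < be - al by apply: lt_trans h1; rewrite mulr_gt0.
have h3 : al <= 2 ^+ m * slope k n * al by rewrite ler_peMl// ltW.
have h4 : 2 ^+ m * (slope k n * al) < 2 ^+ m * (be - al) by rewrite ltr_pM2l.
rewrite mulrA in h4; have := le_lt_trans h3 (lt_le_trans h4 ml); by rewrite ltxx.
Qed.

(** The first term collects the coarse levels, bounded one by one; the second the finer, packed
    levels. Each contains a factor 2 for a geometric sum over n. *)
Definition ray_cst : R := (2 * b + a0).+1%:R * (160 * (pi * M)) + 80 * Q.

Lemma ray_cst_ge : 32 * Q <= ray_cst.
Proof.
have M0 : 0 <= M := le_trans (normr_ge0 _) (VM 0 0).
rewrite /ray_cst; apply: (@le_trans _ _ (80 * Q)); first by rewrite ler_wpM2r// ler_nat.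
by rewrite lerDr !mulr_ge0// pi_ge0.
Qed.

(** The level m is chosen so that its cells near [al] are about as long as the interval; two
    adjacent columns then cover the tent and pack the levels k >= m. Of the levels k < m, only those
    within 2 b n + a0 + 1 of m meet the tent along the n-th ray, and each is bounded by
    [ray_mass_near]. *)
Lemma nu_tent_far (A : set T2) (al be : R) : measurable A -> 0 < al -> 0 < be - al ->
  be - al <= al -> A `<=` `[al, be]%classic `*` `]0, (be - al)[%classic ->
  (nu A <= (ray_cst * (be - al))%:E)%E.
Proof.
move=> mA al0 l0 la Aab; rewrite nu_interchange//.
have M0 : 0 <= M := le_trans (normr_ge0 _) (VM 0 0).
have N0 : 0 <= 40 * (pi * M) by rewrite mulr_ge0// mulr_ge0// pi_ge0.
have [m /andP[m1 m2]] : exists m : nat, 2 ^+ m <= al / (be - al) < 2 ^+ m.+1.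
  by apply: exists_dyadic_floor; rewrite ler_pdivlMr// mul1r.
rewrite ler_pdivlMr// in m1; rewrite ltr_pdivrMr// in m2.
pose j := Num.floor (2 ^+ m * ln al).
have cA := cell_floor m al0; rewrite -/j in cA.
have [n1 n2] : node m j <= al /\ al < node m (j + 1).
  by move: cA; rewrite /cell/= in_itv/= => /andP[].
have q1 := ratio_ge (R := R) m; have q4 := ratio_le (R := R) m.
have n3 : be < node m (j + 1 + 1).
  rewrite nodeS; apply: (@le_lt_trans _ _ ((1 + (2 ^+ m)^-1) * al)).
    rewrite mulrDl mul1r -lerBlDl ler_pdivlMl ?exprn_gt0//.
  apply: (@le_lt_trans _ _ (ratio m * al)); first by rewrite ler_pM2r.
  by rewrite ltr_pM2l//; apply: lt_trans (ratio_gt1 m).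
have colA : A `<=` column m j `|` column m (j + 1).
  move=> [y t] /Aab[/=]; rewrite in_itv/= => /andP[y1 y2] _.
  have [h|h] := ltP y (node m (j + 1)); [left|right]; split => //=; rewrite /cell/= in_itv/=.
    by rewrite h andbT (le_trans n1).
  by rewrite h (le_lt_trans y2).
have n1' : node m (j + 1) <= 4 * al.
  by rewrite nodeS; apply: ler_pM => //; exact: ltW (expR_gt0 _).
have n2' : node m (j + 1 + 1) <= 16 * al.
  rewrite nodeS (_ : 16 = 4 * 4 :> R) -?mulrA; last by ring.
  by apply: ler_pM => //; exact: ltW (expR_gt0 _).
have fine_part n N : (\sum_(i < N) ray_mass (m + i) n A <=
    (4^-1 ^+ n * (40 * Q * (be - al)))%:E)%E.
  apply: (@le_trans _ _ (\sum_(i < N) (ray_mass (m + i) n (column m j) +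
     ray_mass (m + i) n (column m (j + 1))))%E).
    apply: lee_sum => i _; apply: ray_mass_le2 => //; exact: measurable_column.
  rewrite big_split/=; apply: le_trans (leeD (sum_ray_mass_column _ _ _ _) (sum_ray_mass_column _ _ _ _)) _.
  rewrite -EFinD lee_fin -mulrDr ler_wpM2l ?exprn_ge0 ?invr_ge0//.
  have am : al / 2 ^+ m <= 2 * (be - al).
    by rewrite ler_pdivrMr ?exprn_gt0// mulrAC -exprS ltW.
  have i0 : 0 <= (2 ^+ m)^-1 :> R by rewrite invr_ge0 exprn_ge0.
  apply: (@le_trans _ _ (20 * Q * (al / 2 ^+ m))); last first.
    rewrite (_ : 40 * Q * (be - al) = 20 * Q * (2 * (be - al))); last by ring.
    by rewrite ler_wpM2l// mulr_ge0.
  rewrite -mulrDl -mulrDl (_ : 20 * Q * (al / 2 ^+ m) = 20 * al * Q / 2 ^+ m); last first.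
    by move: (2 ^- m) => z; ring.
  rewrite ler_wpM2r// ler_wpM2r//; lra.
have ab : al < be by rewrite -subr_gt0.
have Aab' : A `<=` `[al, be]%classic `*` [set: R] by move=> z /Aab[].
have coarse n : (\sum_(k < m) ray_mass k n A <=
    ((2 * b + a0).+1%:R * (80 * (pi * M)) * (be - al) * 2^-1 ^+ n)%:E)%E.
  have p0 : 0 <= 4^-1 ^+ n * (80 * (pi * M) * (be - al)).
    by rewrite !mulr_ge0 ?exprn_ge0 ?invr_ge0 ?pi_ge0// ltW.
  apply: (@le_trans _ _ (\sum_(k < m) ((m < k + (2 * b * n + a0).+1)%N%:R *
      (4^-1 ^+ n * (80 * (pi * M) * (be - al))))%:E)%E).
    apply: lee_sum => k _; case: (ltnP m (k + (2 * b * n + a0).+1)) => [_|h]; last first.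
      by rewrite mul0r (ray_mass_coarse mA al0 Aab m1 h).
    rewrite mul1r; apply: (le_trans (ray_mass_near k n mA al0 ab Aab')).
    rewrite lee_fin -mulrA; apply: ler_wpM2l; first by rewrite exprn_ge0// invr_ge0.
    have : be * ((be - al) / al) <= 2 * (be - al).
      rewrite mulrCA mulrC ler_wpM2r ?(ltW l0)// ler_pdivrMr//; lra.
    move=> /(ler_wpM2l N0)/le_trans; apply.
    by rewrite le_eqVlt; apply/orP; left; apply/eqP; move: (@pi R) => p; ring.
  rewrite sumEFin lee_fin -mulr_suml -natr_sum.
  have cnt := count_levels m (2 * b * n + a0).+1 m; rewrite addKn in cnt.
  apply: (@le_trans _ _ (((2 * b + a0).+1 * 2 ^ n)%N%:R * (4^-1 ^+ n * (80 * (pi * M) * (be - al))))).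
    rewrite ler_wpM2r// ler_nat; apply: leq_trans cnt _.
    exact: affine_le_expn.
  have -> : 4^-1 ^+ n = 2^-1 ^+ n * 2^-1 ^+ n :> R.
    by rewrite -exprMn; congr (_ ^+ _); field.
  rewrite natrM natrX le_eqVlt; apply/orP; left; apply/eqP.
  have : 2 ^+ n * 2^-1 ^+ n = 1 :> R by rewrite -exprMn divff// expr1n.
  move: (2 ^+ n) (2^-1 ^+ n) (@pi R) ((2 * b + a0).+1%:R : R) => x y p w xy.
  have -> : w * x * (y * y * (80 * (p * M) * (be - al))) = (x * y) * (w * (80 * (p * M)) * (be - al) * y) by ring.
  by rewrite xy mul1r.
pose c1 : R := (2 * b + a0).+1%:R * (80 * (pi * M)) * (be - al).
pose c2 : R := 40 * Q * (be - al).
have c10 : 0 <= c1 by rewrite !mulr_ge0 ?pi_ge0// ltW.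
have c20 : 0 <= c2 by rewrite !mulr_ge0// ltW.
apply: (@le_trans _ _ (\sum_(n <oo) (c1%:E * (2^-1 ^+ n)%:E + c2%:E * (4^-1 ^+ n)%:E))%E).
  apply: lee_nneseries => [n _ _|n _]; first by apply: nneseries_ge0 => k _ _; exact: ray_mass_ge0.
  rewrite (nneseries_split 0 m); last by move=> k _; exact: ray_mass_ge0.
  rewrite add0n; apply: leeD.
    by rewrite big_mkord -EFinM; exact: coarse.
  rewrite -nneseries_addn; last by move=> k; exact: ray_mass_ge0.
  apply: nneseries_le_bound => [k|N]; first exact: ray_mass_ge0.
  by under eq_bigr do rewrite addnC; rewrite -EFinM mulrC; exact: fine_part.
rewrite nneseriesD; last 2 first.
- by move=> n _; rewrite mule_ge0 ?lee_fin ?exprn_ge0 ?invr_ge0.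
- by move=> n _; rewrite mule_ge0 ?lee_fin ?exprn_ge0 ?invr_ge0.
rewrite nneseriesZl; last by move=> n _; rewrite lee_fin exprn_ge0// invr_ge0.
rewrite nneseriesZl; last by move=> n _; rewrite lee_fin exprn_ge0// invr_ge0.
rewrite sum_half; apply: (@le_trans _ _ (c1%:E * 2%:E + c2%:E * 2%:E)%E).
  by rewrite leeD2l// lee_wpmul2l ?lee_fin.
rewrite -!EFinM -EFinD lee_fin le_eqVlt; apply/orP; left; apply/eqP.
by rewrite /c1 /c2 /ray_cst; move: (@pi R) Q ((2 * b + a0).+1%:R : R) => p q w; ring.
Qed.

Lemma nu_tent (I : set R) : bounded_interval I ->
  (nu (tent I) <= (ray_cst * itv_length I)%:E)%E.
Proof.
move=> bI; have [al [be [al0 ab lE Iab [_ mI]]]] := bounded_intervalP bI.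
have mT : measurable (tent I : set T2) by exact: measurable_tent.
have l0 : 0 < be - al by rewrite subr_gt0.
(* An interval no farther from 0 than its length is enlarged to ]0, be], which at most doubles it,
   and the strip bound applies. *)
rewrite lE; have [h|h] := leP al (be - al).
  have be0 : 0 < be by exact: le_lt_trans ab.
  apply: le_trans (nu_strip be0 mT _) _.
    move=> [y t] [/= Iy _]; have := Iab _ Iy; rewrite /= !in_itv/= => /andP[_ ->].
    by have [_ _ [z Iz]] := bI; have := Iz _ Iy; rewrite /= in_itv/= => /andP[->].
  rewrite lee_fin; apply: (@le_trans _ _ (32 * Q * (be - al))).
    have -> : 32 * Q * (be - al) = 16 * Q * (2 * (be - al)) by ring.
    by rewrite ler_wpM2l ?mulr_ge0//; lra.
  by rewrite ler_wpM2r ?(ltW l0)// ray_cst_ge.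
apply: nu_tent_far => //; [exact: lt_trans h|exact: ltW|].
by move=> [y t] [/= Iy It]; split; [exact: Iab|rewrite -lE].
Qed.

End ray_measure.

Lemma nneseries_fine_cvg {R : realType} (a : nat -> R) : (forall n, 0 <= a n) ->
  (\sum_(n <oo) (a n)%:E < +oo)%E ->
  (fun N => \sum_(n < N) a n) @ \oo --> fine (\sum_(n <oo) (a n)%:E)%E.
Proof.
move=> a0 afin.
have s0 : (0 <= \sum_(n <oo) (a n)%:E)%E by apply: nneseries_ge0 => n _ _; rewrite lee_fin.
have sE : (\sum_(n <oo) (a n)%:E)%E = (fine (\sum_(n <oo) (a n)%:E)%E)%:E.
  by rewrite fineK// ge0_fin_numE.
have h : (fun N => \sum_(0 <= n < N) (a n)%:E)%E @ \oo --> (\sum_(n <oo) (a n)%:E)%E.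
  by apply: is_cvg_nneseries => n _ _; rewrite lee_fin.
rewrite {1}sE in h.
have -> : (fun N => \sum_(n < N) a n) = fine \o (fun N => \sum_(0 <= n < N) (a n)%:E)%E.
  by apply/funext => N /=; rewrite sumEFin/= big_mkord.
exact: fine_cvg h.
Qed.

Lemma nneseries_term_lt {R : realType} (a : nat -> \bar R) (k : nat) : (forall n, 0 <= a n)%E ->
  (\sum_(n <oo) a n < +oo)%E -> (a k < +oo)%E.
Proof.
move=> a0; apply: le_lt_trans; apply: le_trans (@nneseries_lim_ge _ a xpredT 0 k.+1 _); last by [].
by rewrite big_mkord big_ord_recr/= leeDr// sume_ge0.
Qed.

(** The double series of [A] and [B] will be the integrals over the positive and the negative part,
    finite separately. Row k of the difference telescopes to [r k 0], and only then are the rows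
    added. *)
Lemma double_telescope {R : realType} (A B r : nat -> nat -> R) :
  (forall k n, 0 <= A k n) -> (forall k n, 0 <= B k n) ->
  (forall k n, A k n - B k n = r k n - r k n.+1) ->
  (forall k, r k @ \oo --> (0 : R)) ->
  (\sum_(k <oo) \sum_(n <oo) (A k n)%:E < +oo)%E ->
  (\sum_(k <oo) \sum_(n <oo) (B k n)%:E < +oo)%E ->
  (fun N => \sum_(k < N) r k 0%N) @ \oo -->
    fine (\sum_(k <oo) \sum_(n <oo) (A k n)%:E)%E -
    fine (\sum_(k <oo) \sum_(n <oo) (B k n)%:E)%E.
Proof.
move=> A0 B0 ABr r0 Afin Bfin.
have rows (C : nat -> nat -> R) : (forall k n, 0 <= C k n) ->
    (\sum_(k <oo) \sum_(n <oo) (C k n)%:E < +oo)%E ->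
    (forall k, (fun N => \sum_(n < N) C k n) @ \oo --> fine (\sum_(n <oo) (C k n)%:E)%E) /\
    (fun N => \sum_(k < N) fine (\sum_(n <oo) (C k n)%:E)%E) @ \oo -->
      fine (\sum_(k <oo) \sum_(n <oo) (C k n)%:E)%E.
  move=> C0 Cfin.
  have S0 k : (0 <= \sum_(n <oo) (C k n)%:E)%E.
    by apply: nneseries_ge0 => n _ _; rewrite lee_fin.
  have Sfin k : (\sum_(n <oo) (C k n)%:E < +oo)%E.
    exact: (nneseries_term_lt (a := fun k => (\sum_(n <oo) (C k n)%:E)%E) k S0 Cfin).
  split=> [k|]; first exact: nneseries_fine_cvg.
  have SE k : (\sum_(n <oo) (C k n)%:E)%E = (fine (\sum_(n <oo) (C k n)%:E)%E)%:E.
    by rewrite fineK// ge0_fin_numE.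
  move: Cfin; under [X in (X < _)%E]eq_eseriesr => k _ do rewrite SE.
  move=> /nneseries_fine_cvg h.
  have -> : (\sum_(k <oo) \sum_(n <oo) (C k n)%:E)%E =
      (\sum_(k <oo) (fine (\sum_(n <oo) (C k n)%:E)%E)%:E)%E.
    by apply: eq_eseriesr => k _; exact: SE.
  by apply: h => k; exact: fine_ge0.
have [A1 A2] := rows A A0 Afin; have [B1 B2] := rows B B0 Bfin.
have -> : (fun N => \sum_(k < N) r k 0%N) =
    (fun N => \sum_(k < N) fine (\sum_(n <oo) (A k n)%:E)%E -
              \sum_(k < N) fine (\sum_(n <oo) (B k n)%:E)%E).
  apply/funext => N; rewrite -sumrB; apply: eq_bigr => k _.
  suff h : (fun N => \sum_(n < N) A k n - \sum_(n < N) B k n) @ \oo --> r k 0%N.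
    by have := cvg_unique _ h (cvgB (A1 k) (B1 k)); apply.
  have -> : (fun N => \sum_(n < N) A k n - \sum_(n < N) B k n) = (fun N => r k 0%N - r k N).
    apply/funext => M; rewrite -sumrB (eq_bigr _ (fun (i : 'I_M) _ => ABr k i)).
    by rewrite -opprB -telescope_sumr// -sumrN big_mkord; apply: eq_bigr => i _; rewrite opprB.
  by rewrite -[X in _ --> X]subr0; apply: cvgB; [exact: cvg_cst|exact: r0].
exact: cvgB.
Qed.

(** Comparison of the 2-adic and 3-adic valuations; this keeps rays of different levels or Neumann
    steps apart. *)
Lemma pow2_pow3_inj (k n k' n' b : nat) : (0 < b)%N ->
  (2 ^ k * 3 ^ (b * n) = 2 ^ k' * 3 ^ (b * n'))%N -> k = k' /\ n = n'.
Proof.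
move=> b0 E.
have := congr1 (logn 2) E; have := congr1 (logn 3) E.
rewrite !lognM ?expn_gt0// !lognX !(@logn_prime 2)// !(@logn_prime 3)//= !muln0 !muln1 !addn0 !add0n.
by move=> /eqP; rewrite eqn_pmul2l// => /eqP -> ->.
Qed.

(** * The signed measure on the rays and its balayage *)

Section signed_ray_measure.
Context {R : realType}.
Local Notation leb := (@lebesgue_measure R).
Local Notation T2 := ((measurableTypeR R * measurableTypeR R)%type).
Implicit Types (k n : nat) (s : bool) (u r x : R).
Variables (lam : R) (V : nat -> int -> R) (M P : R) (e : R) (b a0 : nat).
Hypothesis lam_gt0 : 0 < lam.
Hypothesis VM : forall k l, `|V k l| <= M.
Hypothesis VP : forall n m j, tree_sum (fun k l => `|V k l|) n m j <= P / 2 ^+ m.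
Hypotheses (e01 : 0 < e <= 1) (b_gt0 : (0 < b)%N) (e_ge : 1 <= e * 2 ^+ a0).
Local Notation D := (log_poisson_cst lam).
Local Notation c := (poisson_low_cst lam / 2).
Hypothesis neumann_lip : forall Om (q : nat -> R -> R) v, envelope envelope_cst Om ->
  (forall n, cauchy_like D c (e * (3 ^ (b * n))%N%:R^-1) (q n)) ->
  rel_lipschitz Om 1 1 v ->
  forall n, rel_lipschitz Om (4^-1 ^+ n) (3 ^ (b * n))%N%:R^-1 (neumann q v n).

Definition kernel k n : R -> R := scaled_poisson lam (scale k) (width e b n).

Definition residual k n : R -> R := neumann (kernel k) (interpolation (V k.+1)) n.

Definition mass k n : R := \int[leb]_r kernel k n r.

Definition signed_part s (x : R) : R := Num.max ((-1) ^+ s * x) 0.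

(** Arranged so that the Poisson integral along the ray is the normalized average of the signed part
    of the residual; the last factor is dy/du. *)
Definition weight s k n u : R :=
  signed_part s (residual k n u) / mass k n * (scale k * expR (scale k * u)).

Let e0 : 0 < e. Proof. by case/andP: e01. Qed.

Lemma signed_part_ge0 s x : 0 <= signed_part s x.
Proof. by rewrite /signed_part le_max lexx orbT. Qed.

Lemma signed_part_le s x : signed_part s x <= `|x|.
Proof.
rewrite /signed_part ge_max normr_ge0 andbT.
by apply: le_trans (ler_norm _) _; rewrite normrM normrX normrN1 expr1n mul1r.
Qed.

Lemma signed_partB x : signed_part false x - signed_part true x = x.
Proof.
rewrite /signed_part expr0 expr1 mul1r mulN1r.
case: (leP x 0) => x0.
  by rewrite max_l ?oppr_ge0// sub0r opprK.
by rewrite max_r ?oppr_le0 ?ltW// subr0.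
Qed.

Lemma cauchy_like_kernel k n : cauchy_like D c (width e b n) (kernel k n).
Proof.
apply: cauchy_like_scaled_poisson => //; [exact: scale_gt0|exact: width_gt0|].
apply: mulr_ile1; [exact: ltW (scale_gt0 _)|exact: ltW (width_gt0 b e0 _)| |].
  by rewrite /scale invf_le1 ?exprn_gt0// exprn_ege1// ler1n.
rewrite /width ler_pdivrMr ?ltr0n ?expn_gt0// mul1r.
by case/andP: e01 => _ /le_trans; apply; rewrite ler1n expn_gt0.
Qed.

Lemma c_gt0 : 0 < c.
Proof. by rewrite divr_gt0// poisson_low_cst_gt0. Qed.

Lemma mass_ge k n : c <= mass k n.
Proof. by case: (cauchy_like_kernel k n). Qed.

Lemma mass_gt0 k n : 0 < mass k n.
Proof. exact: lt_le_trans c_gt0 (mass_ge k n). Qed.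

Lemma rel_lipschitz_residual k n :
  rel_lipschitz (step_envelope (V k.+1)) (4^-1 ^+ n) (3 ^ (b * n))%N%:R^-1 (residual k n).
Proof.
apply: neumann_lip; first exact: envelope_step (VM k.+1).
- by move=> i; exact: cauchy_like_kernel.
- exact: rel_lipschitz_interpolation (VM k.+1).
Qed.

Lemma measurable_residual k n : measurable_fun [set: R] (residual k n).
Proof.
apply: continuous_measurable_fun.
apply: (rel_lipschitz_continuous _ (rel_lipschitz_residual k n)).
by rewrite invr_gt0 ltr0n expn_gt0.
Qed.

Lemma normr_residual k n u : `|residual k n u| <= 4^-1 ^+ n * step_envelope (V k.+1) u.
Proof. by case: (rel_lipschitz_residual k n). Qed.

Lemma residual_cvg0 k u : (fun n => residual k n u) @ \oo --> (0 : R).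
Proof.
apply: norm_cvg0; apply: (@squeeze_cvgr _ _ _ _ (cst 0) (fun n => 4^-1 ^+ n * step_envelope (V k.+1) u)).
- by apply: nearW => n; rewrite normr_ge0 normr_residual.
- exact: cvg_cst.
rewrite -(mul0r (step_envelope (V k.+1) u)); apply: cvgMr_tmp.
by apply: cvg_expr; rewrite ger0_norm ?invr_ge0// invf_lt1// ltr1n.
Qed.

Lemma measurable_signed_residual s k n :
  measurable_fun [set: R] (fun u => signed_part s (residual k n u)).
Proof.
apply: measurable_maxr => //; apply: measurable_funM => //.
exact: measurable_residual.
Qed.

Lemma weight_ge0 s k n u : 0 <= weight s k n u.
Proof.
apply: mulr_ge0; apply: mulr_ge0.
- exact: signed_part_ge0.
- by rewrite invr_ge0 ltW// mass_gt0.
- exact: ltW (scale_gt0 _).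
- exact: expR_ge0.
Qed.

Lemma measurable_weight s k n : measurable_fun [set: R] (weight s k n).
Proof.
apply: measurable_funM.
  by apply: measurable_funM => //; exact: measurable_signed_residual.
by apply: measurable_funM => //; exact: measurable_expR_scale.
Qed.

Lemma weight_le s k n u : weight s k n u <= c^-1 * ray_density V k n u.
Proof.
rewrite /weight /ray_density.
have h1 : signed_part s (residual k n u) <= 4^-1 ^+ n * step_envelope (V k.+1) u.
  exact: le_trans (signed_part_le _ _) (normr_residual _ _ _).
have h2 : (mass k n)^-1 <= c^-1 by rewrite lef_pV2 ?posrE ?mass_gt0 ?c_gt0// mass_ge.
have h3 : 0 <= scale k * expR (scale k * u).
  by apply: mulr_ge0; [exact: ltW (scale_gt0 _)|exact: expR_ge0].
rewrite [leRHS]mulrA; apply: ler_wpM2r => //; rewrite [leRHS]mulrC.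
apply: ler_pM => //; first exact: signed_part_ge0.
by rewrite invr_ge0 ltW// mass_gt0.
Qed.

Lemma ray_quadrant k n u : quadrant (ray e b k n u).
Proof.
by split => /=; rewrite in_itv/= andbT ?expR_gt0// mulr_gt0 ?expR_gt0 ?slope_gt0.
Qed.

Lemma slope_inj k n k' n' : slope e b k n = slope e b k' n' -> k = k' /\ n = n'.
Proof.
rewrite /slope /width /scale !(mulrCA _ e) => /(mulfI (lt0r_neq0 e0)).
rewrite -!invfM => /invr_inj/eqP.
rewrite -!natrX -!natrM eqr_nat => /eqP /(pow2_pow3_inj b_gt0)[[] -> ->].
by [].
Qed.

Variables mup mun : {measure set T2 -> \bar R}.
Definition mu_ s := if s then mun else mup.
Hypothesis muE : forall s (f : T2 -> \bar R), measurable_fun [set: T2] f ->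
  (forall z, 0 <= f z)%E ->
  (\int[mu_ s]_z f z =
   \sum_(k <oo) \sum_(n <oo) \int[leb]_u (f (ray e b k n u) * (weight s k n u)%:E))%E.

Lemma mu_indic s (A : set T2) : measurable A ->
  mu_ s A = (\sum_(k <oo) \sum_(n <oo)
    \int[leb]_u ((\1_A (ray e b k n u))%:E * (weight s k n u)%:E))%E.
Proof.
move=> mA.
have -> : mu_ s A = (\int[mu_ s]_z (\1_A z)%:E)%E by rewrite integral_indic// setIT.
rewrite muE//.
by apply/measurable_EFinP; exact: measurable_indic.
Qed.

Lemma mu_null s (A : set T2) : measurable A ->
  (forall k n u, A (ray e b k n u) -> weight s k n u = 0) -> mu_ s A = 0%E.
Proof.
move=> mA hA; rewrite mu_indic//.
rewrite eseries0// => k _ _; rewrite eseries0// => n _ _.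
apply: integral0_eq => u _; rewrite indicE; have [Au|_] := boolP (_ \in _); last by rewrite mul0e.
by rewrite hA ?mule0//; exact: set_mem Au.
Qed.

Lemma mu_outside_quadrant s : mu_ s (~` quadrant) = 0%E.
Proof.
apply: mu_null; first by apply: measurableC; exact: measurable_quadrant.
by move=> k n u nq; case: nq; exact: ray_quadrant.
Qed.

(** The portion of a ray on which the residual is nonnegative, the parameter u being recovered from
    the first coordinate. *)
Let pos_rays k n : set T2 :=
  [set z | 0 < z.1] `&` [set z | z.2 - slope e b k n * z.1 = 0] `&`
  [set z | 0 <= residual k n (ln z.1 / scale k)].

Let measurable_pos_rays k n : measurable (pos_rays k n).
Proof.
have m1 : measurable_fun [set: T2] (fun z : T2 => (z.1 : R)) by exact: measurable_fst.
have m2 : measurable_fun [set: T2] (fun z : T2 => (z.2 - slope e b k n * z.1 : R)).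
  apply: measurable_funB; first exact: measurable_snd.
  exact: measurable_funM.
have m3 : measurable_fun [set: T2] (fun z : T2 => residual k n (ln z.1 / scale k)).
  apply: (measurableT_comp (measurable_residual k n)).
  apply: measurable_funM => //; apply: measurableT_comp m1; exact: measurable_ln.
apply: measurableI; first apply: measurableI.
- have := m1 measurableT `]0, +oo[%classic (measurable_itv _); rewrite setTI.
  by congr measurable; apply/seteqP; split => z /=; rewrite in_itv/= andbT.
- by have := m2 measurableT [set 0] (measurable_set1 _); rewrite setTI.
- have := m3 measurableT `[0, +oo[%classic (measurable_itv _); rewrite setTI.
  by congr measurable; apply/seteqP; split => z /=; rewrite in_itv/= andbT.
Qed.

Let ln_ray k n u : ln (ray e b k n u).1 / scale k = u.
Proof. by rewrite /ray/= expRK mulrC mulKf// gt_eqF// scale_gt0. Qed.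

Lemma ray_singular : exists2 S : set T2, measurable S & (mup (~` S) = 0 /\ mun S = 0)%E.
Proof.
pose S : set T2 := \bigcup_k \bigcup_n pos_rays k n.
have mS : measurable S.
  by apply: bigcupT_measurable => k; apply: bigcupT_measurable => n; exact: measurable_pos_rays.
exists S => //; split.
  apply: (mu_null (s := false)); first exact: measurableC.
  move=> k n u nS.
  have : residual k n u < 0.
    rewrite ltNge; apply/negP => h; apply: nS; exists k => //; exists n => //; split.
      by split => /=; [exact: expR_gt0|rewrite subrr].
    by rewrite /= ln_ray.
  by move=> h; rewrite /weight /signed_part expr0 mul1r max_r ?(ltW h)// !mul0r.
(* A point of the union that lies on the ray (k, n) may have been put there by another pair (k',
   n'); equal slopes force the pairs to agree, so the residual in question is the same. *)
apply: (mu_null (s := true)) => // k n u [k' _ [n' _ [[/= _ hs]]]] /=.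
move/eqP: hs; rewrite -mulrBl mulf_eq0 (gt_eqF (expR_gt0 _)) orbF subr_eq0.
move=> /eqP/slope_inj[<- <-].
have := ln_ray k n u; rewrite /ray/= => -> h.
by rewrite /weight /signed_part expr1 mulN1r max_r ?oppr_le0// !mul0r.
Qed.

Definition ray_signed_measure : @borel_measure R := SignedMeasure ray_singular.

Lemma mu_le_nu s (nu : {measure set T2 -> \bar R}) (A : set T2) :
  (forall B : set T2, measurable B ->
    nu B = (\sum_(k <oo) \sum_(n <oo) ray_mass V e b k n B)%E) ->
  measurable A -> (mu_ s A <= (c^-1)%:E * nu A)%E.
Proof.
move=> nuE mA; rewrite mu_indic// nuE//.
have c1 : 0 <= c^-1 by rewrite invr_ge0 ltW// c_gt0.
have r0 k n : (0 <= ray_mass V e b k n A)%E by exact: ray_mass_ge0 VM _ _ _.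
have i0 k n : (0 <= \int[leb]_u ((\1_A (ray e b k n u))%:E * (weight s k n u)%:E))%E.
  by apply: integral_ge0 => u _; rewrite mule_ge0 ?lee_fin ?weight_ge0.
rewrite -nneseriesZl; last by move=> k _; apply: nneseries_ge0 => n _ _; exact: r0.
apply: lee_nneseries => [k _ _|k _]; first by apply: nneseries_ge0 => n _ _; exact: i0.
rewrite -nneseriesZl; last by move=> n _; exact: r0.
apply: lee_nneseries => [n _ _|n _]; first exact: i0.
rewrite /ray_mass -ge0_integralZl ?lee_fin//; last 2 first.
- exact: measurable_ray_integrand.
- by move=> u _; rewrite mule_ge0 ?lee_fin// (ray_density_ge0 VM).
apply: ge0_le_integral => //.
- by move=> u _; rewrite mule_ge0 ?lee_fin ?weight_ge0.
- apply: emeasurable_funM; apply/measurable_EFinP; last exact: measurable_weight.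
  exact: measurable_indic_ray.
- by apply: emeasurable_funM => //; exact: measurable_ray_integrand.
move=> u _; rewrite muleCA; apply: lee_wpmul2l; rewrite ?lee_fin//.
exact: weight_le.
Qed.

(** Both parts are dominated by a multiple of one measure with density [ray_density], to which
    [nu_tent] applies; the 2 counts the parts. *)
Lemma ray_carleson_norm :
  (carleson_norm ray_signed_measure <= (2 * c^-1 * ray_cst M P b a0)%:E)%E.
Proof.
have [nu nuE'] := curves_measure_exists leb (measurable_ray e b)
  (fun k n => measurable_ray_density V k n) (ray_density_ge0 VM).
have nuE (B : set T2) : measurable B ->
    nu B = (\sum_(k <oo) \sum_(n <oo) ray_mass V e b k n B)%E.
  move=> mB.
  have -> : nu B = (\int[nu]_z (\1_B z)%:E)%E by rewrite integral_indic// setIT.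
  rewrite nuE'//.
  by apply/measurable_EFinP; exact: measurable_indic.
have c1 : 0 <= c^-1 by rewrite invr_ge0 ltW// c_gt0.
apply: ge_ereal_sup => _ [I bI <-]; rewrite variation_measureE.
have [al [be [_ _ _ _ [_ mI]]]] := bounded_intervalP bI.
have mT : measurable (tent I : set T2) by exact: measurable_tent.
have [_ l0 _] := bI.
have h s : (mu_ s (tent I) <= (c^-1 * (ray_cst M P b a0 * itv_length I))%:E)%E.
  apply: le_trans (mu_le_nu s nuE mT) _; rewrite EFinM; apply: lee_wpmul2l; rewrite ?lee_fin//.
  exact (nu_tent VM VP e0 e_ge nuE bI).
rewrite lee_pdivrMl//.
apply: le_trans (leeD (h false) (h true)) _.
rewrite -EFinD -EFinM lee_fin le_eqVlt; apply/orP; left; apply/eqP.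
by move: (c^-1) (ray_cst M P b a0) => p q; ring.
Qed.

Lemma ray_carleson : carleson ray_signed_measure.
Proof.
split; last by apply: le_lt_trans ray_carleson_norm _; rewrite ltry.
by rewrite variation_measureE (mu_outside_quadrant false) (mu_outside_quadrant true) adde0.
Qed.

(** By homogeneity the position [w] cancels and a convolution kernel in the logarithmic coordinate
    remains. *)
Lemma poisson_ray k n w r :
  poisson lam (slope e b k n * expR (scale k * (w + r))) (expR (scale k * w))
    (expR (scale k * (w + r))) * (scale k * expR (scale k * (w + r))) = kernel k n r.
Proof.
rewrite mulrDr expRD; set X := expR _; set E := expR _.
have X0 : 0 < X by exact: expR_gt0.
have E0 : 0 < E by exact: expR_gt0.
have -> : slope e b k n * (X * E) = X * (slope e b k n * E) by ring.
rewrite -{2}[X]mulr1 poisson_scale//; last 2 first.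
- by rewrite mulr_gt0// slope_gt0.
- exact: ltW.
rewrite /kernel /scaled_poisson /log_poisson -/E -/(slope e b k n).
by move: (poisson _ _ _ _) (scale k) => p q; field; rewrite gt_eqF.
Qed.

Definition ray_average s k n w : R :=
  (mass k n)^-1 * \int[leb]_r (kernel k n r * signed_part s (residual k n (w + r))).

Let integrable_signed s k n w :
  leb.-integrable [set: R] (EFin \o (fun r => kernel k n r * signed_part s (residual k n (w + r)))).
Proof.
have [w0 w1] : 0 < width e b n /\ width e b n <= 1.
  split; first exact: width_gt0.
  rewrite /width ler_pdivrMr ?ltr0n ?expn_gt0// mul1r.
  by case/andP: e01 => _ /le_trans; apply; rewrite ler1n expn_gt0.
have D0 : 0 <= D by exact/ltW/log_poisson_cst_gt0.
have [] // := average_integrand_bound D0 (envelope_step (VM k.+1)) (w) w0 w1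
  (cauchy_like_kernel k n) (measurable_signed_residual s k n) (a := 4^-1 ^+ n).
by move=> r; apply: le_trans (normr_residual k n r); rewrite ger0_norm ?signed_part_ge0 ?signed_part_le.
Qed.

Let kernel_ge0 k n r : 0 <= kernel k n r.
Proof. by case: (cauchy_like_kernel k n) => _ /(_ r)/andP[]. Qed.

Lemma ray_average_ge0 s k n w : 0 <= ray_average s k n w.
Proof.
rewrite mulr_ge0 ?invr_ge0 ?(ltW (mass_gt0 _ _))//; apply: Rintegral_ge0 => r _.
by rewrite mulr_ge0// signed_part_ge0.
Qed.

(** The average is linear, so the two signs recombine into the average of the residual, which the
    Neumann recursion subtracts at this very step. *)
Lemma ray_averageB k n w :
  ray_average false k n w - ray_average true k n w = residual k n w - residual k n.+1 w.
Proof.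
rewrite /ray_average -mulrBr -RintegralB//.
rewrite /residual/= opprB addrC subrK /average; congr (_ * _).
by apply: eq_Rintegral => r _; rewrite -mulrBr signed_partB.
Qed.

Lemma integral_ray s k n x : 0 < x ->
  (\int[leb]_u ((poisson lam (ray e b k n u).2 x (ray e b k n u).1)%:E * (weight s k n u)%:E) =
   (ray_average s k n (ln x / scale k))%:E)%E.
Proof.
move=> x0; set w := ln x / scale k.
have xE : x = expR (scale k * w).
  by rewrite /w mulrC divfK ?gt_eqF ?scale_gt0// lnK ?posrE.
pose g u : R := (mass k n)^-1 * (kernel k n (u - w) * signed_part s (residual k n u)).
have gE u : ((poisson lam (ray e b k n u).2 x (ray e b k n u).1)%:E * (weight s k n u)%:E)%E = (g u)%:E.
  rewrite -EFinM /g /ray/= /weight -(poisson_ray k n w) xE addrCA subrr addr0.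
  by congr (_%:E); move: (poisson _ _ _ _) (scale k * expR (scale k * u)) => p q; ring.
under eq_integral do rewrite gE.
have mk : measurable_fun [set: R] (kernel k n) by case: (cauchy_like_kernel k n).
have mg : measurable_fun [set: R] (fun u => (g u)%:E).
  apply/measurable_EFinP; apply: measurable_funM => //; apply: measurable_funM.
    apply: (measurableT_comp mk); exact: measurable_funB.
  exact: measurable_signed_residual.
rewrite -(ge0_integral_shift w mg); last first.
  move=> u; rewrite lee_fin; apply: mulr_ge0; first by rewrite invr_ge0 ltW// mass_gt0.
  by apply: mulr_ge0 => //; exact: signed_part_ge0.
rewrite /g; under eq_integral => r _ do rewrite addrK (addrC r w) EFinM.
have h := integrable_signed s k n w.
rewrite integralZl// /ray_average EFinM; congr (_ * _)%E.
by rewrite /Rintegral fineK//; exact: integrable_fin_num h.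
Qed.

Lemma integral_mu_poisson s x : 0 < x ->
  (\int[mu_ s]_(z in quadrant) (poisson lam z.2 x z.1)%:E =
   \sum_(k <oo) \sum_(n <oo) (ray_average s k n (ln x / scale k))%:E)%E.
Proof.
move=> x0; rewrite integral_mkcond muE; last 2 first.
- apply/(measurable_restrictT _ _).1; first exact: measurable_quadrant.
  by apply: measurable_funTS; exact: measurable_poissonx.
- by move=> z; apply: erestrict_ge0 => y qy; rewrite lee_fin poisson_quadrant_ge0.
apply: eq_eseriesr => k _; apply: eq_eseriesr => n _; rewrite -integral_ray//.
by apply: eq_integral => u _; rewrite patchE mem_set//; exact: ray_quadrant.
Qed.

(** Absolute convergence of the balayage at [x] makes both double series of ray averages finite;
    telescoping then yields the convergence of the interpolations, which are the residuals of index
    0. *)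
Lemma ray_balayage x : 0 < x -> balayage_converges lam ray_signed_measure x ->
  (fun N => \sum_(k < N) interpolation (V k.+1) (2 ^+ k.+1 * ln x)) @ \oo -->
    balayage lam ray_signed_measure x.
Proof.
move=> x0 cx.
have Pge z : quadrant z -> (0 <= (poisson lam z.2 x z.1)%:E)%E.
  by move=> qz; rewrite lee_fin poisson_quadrant_ge0.
have mP : measurable_fun (quadrant : set T2) (fun z : T2 => (poisson lam z.2 x z.1)%:E).
  by apply: measurable_funTS; exact: measurable_poissonx.
have fin s : (\int[mu_ s]_(z in quadrant) (poisson lam z.2 x z.1)%:E < +oo)%E.
  have /integrableP[_ h] := cx.
  have {}h : (\int[variation_measure ray_signed_measure]_(z in quadrant)
      (poisson lam z.2 x z.1)%:E < +oo)%E.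
    move: h; congr (_ < _)%E; apply: eq_integral => z /set_mem qz.
    by rewrite gee0_abs// Pge.
  apply: le_lt_trans h; rewrite ge0_integral_measure_add//; last exact: measurable_quadrant.
  have I0 s' : (0 <= \int[mu_ s']_(z in quadrant) (poisson lam z.2 x z.1)%:E)%E.
    by apply: integral_ge0.
  by case: s; [rewrite leeDr// (I0 false)|rewrite leeDl// (I0 true)].
have sum_fin s : (\sum_(k <oo) \sum_(n <oo) (ray_average s k n (ln x / scale k))%:E < +oo)%E.
  by rewrite -integral_mu_poisson.
have h := double_telescope (fun k n => ray_average_ge0 false k n (ln x / scale k))
  (fun k n => ray_average_ge0 true k n (ln x / scale k))
  (fun k n => ray_averageB k n (ln x / scale k))
  (fun k => residual_cvg0 k (ln x / scale k)) (sum_fin false) (sum_fin true).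
rewrite -(integral_mu_poisson false x0) -(integral_mu_poisson true x0) in h.
have E : (fun N => \sum_(k < N) residual k 0%N (ln x / scale k)) =
    (fun N => \sum_(k < N) interpolation (V k.+1) (2 ^+ k.+1 * ln x)).
  by apply/funext => N; apply: eq_bigr => k _; rewrite /residual/= /scale invrK mulrC.
by rewrite -E.
Qed.

End signed_ray_measure.

(** * The decomposition of a function of bounded mean oscillation *)

Section decomposition.
Context {R : realType}.
Local Notation leb := (@lebesgue_measure R).
Local Notation T2 := ((measurableTypeR R * measurableTypeR R)%type).
Implicit Types (f g : R -> R) (K B x : R) (mu : @borel_measure R).

Lemma Linfty_norm_le g B : 0 <= B -> {ae leb, forall x, 0 < x -> `|g x| <= B} ->
  (Linfty_norm g <= B%:E)%E.
Proof.
move=> B0 gB; rewrite /Linfty_norm unlock /Lnorm; case: ifP => _; last by rewrite lee_fin.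
apply/ess_sup_inf.ess_supP.
apply: (@filterS _ _ (ae_filter_ringOfSetsType _)) gB => x hx.
rewrite /= lee_fin patchE; case: ifP => [|_]; last by rewrite normr0.
by rewrite inE/= in_itv/= andbT => /hx.
Qed.

Lemma positive_half_line_bigcup : `]0, +oo[%classic = \bigcup_n `]0, n.+1%:R[%classic :> set R.
Proof.
apply/seteqP; split => x /=; rewrite in_itv/= andbT; last first.
  by move=> [n _]; rewrite /= in_itv/= => /andP[].
move=> x0.
exists (Num.truncn x) => //=; rewrite in_itv/= x0.
by case/andP: (truncn_itv (ltW x0)).
Qed.

Lemma measurable_bmo_o f : bmo_o f -> measurable_fun (`]0, +oo[ : set R) f.
Proof.
move=> [fint _]; rewrite positive_half_line_bigcup.
apply/measurable_fun_bigcup => [n|n]; first exact: measurable_itv.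
have n0 : 0 < n.+1%:R :> R by [].
by have /integrableP[/measurable_EFinP] := fint _ n0.
Qed.

Lemma bmo_norm_fine f : bmo_o f -> 0 <= fine (bmo_norm f) /\ bmo_norm f = (fine (bmo_norm f))%:E.
Proof.
move=> [_ [C C0 fC]].
have n0 : (0 <= bmo_norm f)%E.
  by apply: le_ereal_inf_tmp => _ [K [K0 _] <-]; rewrite lee_fin ltW.
split; first exact: fine_ge0.
rewrite fineK// ge0_fin_numE//; apply: le_lt_trans (ltry C).
by apply: ereal_inf_lbound; exists C.
Qed.

Lemma bmo_norm_approx f B : bmo_o f -> (bmo_norm f < B%:E)%E ->
  exists2 K, 0 < K < B & bmo_bound f K.
Proof.
move=> _ /ereal_inf_lt[_ [K [K0 fK] <-]]; rewrite lte_fin => KB.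
by exists K; rewrite ?K0.
Qed.

(** Condition (b) then holds with arbitrarily small constants, so |f| has integral 0 on each ]0, n +
    1[. *)
Lemma bmo_norm_eq0 f : bmo_o f -> bmo_norm f = 0%E -> {ae leb, forall x, 0 < x -> f x = 0}.
Proof.
move=> bf f0; have [fint _] := bf.
have h n : {ae leb, forall x, `]0, n.+1%:R[%classic x -> f x = 0}.
  have n0 : 0 < n.+1%:R :> R by [].
  have fi := fint _ n0; have /integrableP[mf _] := fi.
  pose D : set R := `]0, n.+1%:R[%classic.
  rewrite -/D in fi mf *.
  have mD : measurable D by exact: measurable_itv.
  have : ae_eq leb D (EFin \o f) (cst 0%E).
    apply/ae_eq_integral_abs => //.
    have I0 : (0 <= \int[leb]_(x in D) `|(EFin \o f) x|)%E by exact: integral_ge0.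
    apply/eqP; rewrite eq_le I0 andbT; apply/lee_addgt0Pr => e e0; rewrite add0e.
    have en : 0 < e / n.+1%:R by rewrite divr_gt0.
    have [|K /andP[K0 Ke] [_ /(_ _ n0)]] := @bmo_norm_approx f (e / n.+1%:R) bf.
      by rewrite f0 lte_fin.
    rewrite ler_pdivrMl// => hK.
    have := integrable_norm fi; rewrite /= => iN.
    have -> : (\int[leb]_(x in D) `|(EFin \o f) x|)%E =
        (\int[leb]_(x in D) `|f x|)%:E.
      rewrite /Rintegral fineK//; exact: integrable_fin_num iN.
    by rewrite lee_fin; apply: le_trans hK _; rewrite mulrC -ler_pdivlMr// ltW.
  by apply: (@filterS _ _ (ae_filter_ringOfSetsType _)) => x hx /hx [].
have := ae_foralln h; apply: (@filterS _ _ (ae_filter_ringOfSetsType _)) => x hx x0.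
apply: (hx (Num.truncn x)); rewrite /= in_itv/= x0.
by case/andP: (truncn_itv (ltW x0)).
Qed.

Lemma zero_singular : exists2 S : set T2, measurable S &
  ((@mzero _ T2 R : {measure set T2 -> \bar R}) (~` S) = 0 /\
   (@mzero _ T2 R : {measure set T2 -> \bar R}) S = 0)%E.
Proof. by exists set0. Qed.

Definition zero_signed_measure : @borel_measure R := SignedMeasure zero_singular.

Lemma zero_carleson_norm : carleson_norm zero_signed_measure = 0%E.
Proof.
apply/eqP; rewrite eq_le carleson_norm_ge0 andbT.
apply: ge_ereal_sup => _ [I bI <-]; rewrite variation_measureE.
by rewrite [X in (_ * X)%E]adde0 mule0.
Qed.

Lemma zero_carleson : carleson zero_signed_measure.
Proof.
by split; [rewrite variation_measureE adde0|rewrite zero_carleson_norm].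
Qed.

Lemma zero_balayage lam x : balayage lam zero_signed_measure x = 0.
Proof. by rewrite /balayage /signed_integral /Rintegral !integral_measure_zero subrr. Qed.

Lemma exists_pow2_ge (e : R) : 0 < e <= 1 -> exists a0 : nat, 1 <= e * 2 ^+ a0.
Proof.
move=> /andP[e0 e1]; have [|n /andP[_ h]] := @exists_dyadic_floor R e^-1.
  by rewrite invf_ge1.
by exists n.+1; rewrite -ler_pdivrMl// mulr1 ltW.
Qed.

Lemma ray_cst_scale (M P K : R) (b a0 : nat) :
  ray_cst (M * K) (P * K) b a0 = ray_cst M P b a0 * K.
Proof.
rewrite /ray_cst /envelope_packing_cst.
by move: (@pi R) ((2 * b + a0).+1%:R : R) => p w; ring.
Qed.

Lemma bmo_bound_decomposition lam : 0 < lam -> exists2 C : R, 0 <= C &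
  forall f K, bmo_o f -> 0 < K -> bmo_bound f K ->
  exists mu, [/\ carleson mu, (carleson_norm mu <= (C * K)%:E)%E &
    {ae leb, forall x, 0 < x -> `|f x - balayage lam mu x| <= 16 * K}].
Proof.
move=> lam_gt0.
have D0 : 0 < log_poisson_cst lam by exact: log_poisson_cst_gt0.
have c0 : 0 < poisson_low_cst lam / 2 by rewrite divr_gt0// poisson_low_cst_gt0.
have C1 : 1 <= @envelope_cst R.
  by rewrite /envelope_cst; have := @pi_ge0 R; move: (@pi R) => p; lra.
have [e e01 [b b0 Hneu]] := neumann_rel_lipschitz C1 D0 c0.
have [a0 ea0] := exists_pow2_ge e01.
(* [e], [b] and [a0] depend on [lam] only, and 14 and 266 are the constants of the bounds on single
   and packed increments for K = 1; [ray_cst_scale] restores K. The absolute value spares a proof of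
   nonnegativity. *)
exists `|2 / (poisson_low_cst lam / 2) * ray_cst 14 266 b a0|; first exact: normr_ge0.
move=> f K bf K0 fK; have [fint _] := bf.
pose V := increment (cell_mean f) K.
have VM := increment_cell_mean_le K0 fint fK.
have VP := tree_sum_increment_cell_mean K0 fint fK.
have mu_ex s := @curves_measure_exists _ _ _ T2 R leb (ray e b)
  (weight lam V e b s) (measurable_ray e b)
  (measurable_weight lam_gt0 VM e01 Hneu s) (weight_ge0 V b lam_gt0 e01 s).
have [mup mupE] := mu_ex false; have [mun munE] := mu_ex true.
have muE s (h : T2 -> \bar R) : measurable_fun [set: T2] h -> (forall z, 0 <= h z)%E ->
    (\int[mu_ mup mun s]_z h z = \sum_(k <oo) \sum_(n <oo)
      \int[leb]_u (h (ray e b k n u) * (weight lam V e b s k n u)%:E))%E.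
  by case: s; [exact: munE|exact: mupE].
pose mu := ray_signed_measure lam_gt0 VM e01 b0 Hneu muE.
have cmu : carleson mu := ray_carleson lam_gt0 VM VP e01 b0 ea0 Hneu muE.
exists mu; split => //.
  apply: le_trans (ray_carleson_norm lam_gt0 VM VP e01 b0 ea0 Hneu muE) _.
  by rewrite ray_cst_scale mulrA lee_fin ler_pM2r// ler_norm.
have := balayage_converges_ae lam_gt0 cmu.
apply: (@filterS2 _ _ (ae_filter_ringOfSetsType _)) (ae_dist_interpolation_limit K0 fint fK).
move=> x hx hc x0; apply: (hx x0).
under eq_cvg do rewrite interpolation_stopped.
exact: ray_balayage x0 (hc x0).
Qed.

End decomposition.

Theorem theorem1p1 (R : realType) (lam : R) (lam_gt0 : 0 < lam) :
  (exists2 C : R, 0 < C & forall mu : @borel_measure R, carleson mu ->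
     [/\ {ae @lebesgue_measure R, forall x, 0 < x ->
            balayage_converges lam mu x},
         bmo_o (balayage lam mu)
       & (bmo_norm (balayage lam mu) <= C%:E * carleson_norm mu)%E]) /\
  (exists2 C : R, 0 < C & forall f : R -> R, bmo_o f ->
     (exists2 a : R, 0 < a &
        {ae @lebesgue_measure R, forall x, a < x -> f x = 0}) ->
     exists (g : R -> R) (mu : @borel_measure R),
       [/\ Linfty g, carleson mu,
           {ae @lebesgue_measure R, forall x, 0 < x ->
              f x = g x + balayage lam mu x}
         & (Linfty_norm g + carleson_norm mu <= C%:E * bmo_norm f)%E]).
Proof.
split.
  exists (4 * balayage_cst lam); first by rewrite mulr_gt0// balayage_cst_gt0.
  move=> mu cmu; split.
  - exact: balayage_converges_ae.
  - exact: bmo_o_balayage.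
  - exact: bmo_norm_balayage.
have [C C0 hC] := bmo_bound_decomposition lam_gt0.
(* 16 bounds [g], [C] bounds the measure, and 2 is the ratio allowed between the admissible constant
   [K] and the norm of [f]. *)
exists (2 * (16 + C)); first by rewrite mulr_gt0// ltr_pwDl.
move=> f bf _; have [N0 NE] := bmo_norm_fine bf.
(* The construction needs a positive [K] comparable with the norm, which does not exist for norm 0;
   in that case [f] vanishes almost everywhere and the zero measure serves. *)
have [N1|N1] := eqVneq (bmo_norm f) 0%E.
  have z0 : (Linfty_norm (fun=> 0%R : R) <= 0%:E)%E.
    by apply: Linfty_norm_le => //; apply: aeW => x _; rewrite normr0.
  exists (fun=> 0), zero_signed_measure; split.
  - by split; [exact: measurable_cst|exact: le_lt_trans z0 (ltry _)].
  - exact: zero_carleson.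
  - apply: (@filterS _ _ (ae_filter_ringOfSetsType _)) (bmo_norm_eq0 bf N1) => x hx x0.
    by rewrite hx// zero_balayage addr0.
  - by rewrite N1 mule0 zero_carleson_norm adde0.
have N2 : 0 < fine (bmo_norm f).
  by rewrite lt0r N0 andbT; apply: contra_neq N1 => h; rewrite NE h.
have [|K /andP[K0 K2] fK] := @bmo_norm_approx _ f (2 * fine (bmo_norm f)) bf.
  by rewrite {1}NE lte_fin ltr_pMl// ltr1n.
have [mu [cmu nmu hmu]] := hC f K bf K0 fK.
pose g x := f x - balayage lam mu x.
have K16 : 0 <= 16 * K by rewrite mulr_ge0// ltW.
have gK : (Linfty_norm g <= (16 * K)%:E)%E by exact: Linfty_norm_le.
exists g, mu; split => //.
- split; last exact: le_lt_trans gK (ltry _).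
  apply: measurable_funB; first exact: measurable_bmo_o.
  by apply: measurable_funTS; exact: measurable_balayage.
- by apply: aeW => x _; rewrite /g subrK.
apply: le_trans (leeD gK nmu) _; rewrite NE -EFinM -EFinD lee_fin -mulrDl.
rewrite (mulrC 2) -mulrA; apply: ler_wpM2l; last exact: ltW.
by rewrite addr_ge0.
Qed.
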